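(* Let $\alpha>0$ and let $\mu$ be a positive Borel measure on $\mathbb{C}$. The following conditions are equivalent. (a) $T_\mu$ is a compact Toeplitz operator on $F^2_h$. (b) $\widetilde{\mu}(z)\to 0$ as $|z|\to+\infty$. (c) $\mu$ is a vanishing harmonic Fock-Carleson measure for $F^2_h$.
   Context: Here $dA$ is area (Lebesgue) measure on $\mathbb{C}$ and $d\lambda_\alpha(z)=\frac{\alpha}{\pi}e^{-\alpha|z|^2}dA(z)$. The harmonic Fock space $F^2_h$ is the Hilbert space of all (complex-valued) harmonic functions $f$ on $\mathbb{C}$ with $\int_{\mathbb{C}}|f|^2d\lambda_\alpha<\infty$, with inner product $\langle f,g\rangle=\int_{\mathbb{C}}f\overline{g}\,d\lambda_\alpha$. For $z\in\mathbb{C}$ put $K_z(\omega)=e^{\alpha\bar z\omega}$, $H_z(\omega)=K_z(\omega)+\overline{K_z(\omega)}$, $k_z(\omega)=e^{\alpha\bar z\omega-\frac{\alpha}{2}|z|^2}$ and $h_z(\omega)=\frac{H_z(\omega)}{\sqrt{H_z(z)}}=\frac{\sqrt2}{2}\left(k_z(\omega)+\overline{k_z(\omega)}\right)$. The Toeplitz operator $T_\mu$ on $F^2_h$ is defined by $(T_\mu f)(z)=\int_{\mathbb{C}}f(\omega)\overline{H_z(\omega)}e^{-\alpha|\omega|^2}d\mu(\omega)$. The Berezin transform is $\widetilde{\mu}(z)=\int_{\mathbb{C}}|h_z(u)|^2e^{-\alpha|u|^2}d\mu(u)$. A positive Borel measure $\mu$ is a harmonic Fock-Carleson measure for $F^2_h$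 if there is a constant $C>0$ with $\int_{\mathbb{C}}|f(z)e^{-\alpha|z|^2/2}|^2 d\mu(z)\le C\int_{\mathbb{C}}|f(z)e^{-\alpha|z|^2/2}|^2 dA(z)$ for all $f\in F^2_h$. Such a $\mu$ is called vanishing if $\lim_{n\to\infty}\int_{\mathbb{C}}|f_n(z)e^{-\alpha|z|^2/2}|^2 d\mu(z)=0$ for every bounded sequence $\{f_n\}$ in $F^2_h$ that converges to $0$ uniformly on compact subsets of $\mathbb{C}$. *)

(* Defs.v *)
From HB Require Import structures.
From mathcomp Require Export all_boot all_order all_algebra.
From mathcomp Require Export complex.
From mathcomp Require Import ring lra.
From mathcomp Require Export all_classical all_reals all_analysis.

Set Implicit Arguments.
Unset Strict Implicit.
Unset Printing Implicit Defensive.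

Import Order.TTheory GRing.Theory Num.Theory.
Import numFieldNormedType.Exports Normc.
Local Open Scope classical_set_scope.
Local Open Scope ring_scope.
Local Open Scope complex_scope.

(* The plane on which functions, topology, derivatives and measures live is    *)
(* R * R, identified with R[i] by cplx; functions take values in R[i].  The    *)
(* norm of the normed module R * R is the max norm, so the modulus |z| is      *)
(* always written normc (cplx z).  The sigma-algebra of the product below is   *)
(* the Borel one.                                                              *)
Notation plane R := (measurableTypeR R * measurableTypeR R)%type.

Definition cplx {R : Type} (z : R * R) : R[i] := z.1 +i* z.2.

Definition area (R : realType) : {measure set (plane R) -> \bar R} :=
  (@lebesgue_measure R \x @lebesgue_measure R)%E.

Definition expC {R : realType} (z : R[i]) : R[i] :=
  (expR (complex.Re z))%:C * (cos (complex.Im z) +i* sin (complex.Im z)).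

Section ComplexIntegral.
Context {R : realType} (mu : {measure set (plane R) -> \bar R}).

Definition integrableC (f : R * R -> R[i]) : Prop :=
  mu.-integrable setT (fun w : plane R => (complex.Re (f w))%:E) /\
  mu.-integrable setT (fun w : plane R => (complex.Im (f w))%:E).

Definition integralC (f : R * R -> R[i]) : R[i] :=
  Rintegral mu setT (fun w : plane R => complex.Re (f w)) +i*
  Rintegral mu setT (fun w : plane R => complex.Im (f w)).

End ComplexIntegral.

Section Harmonic.
Context {R : realType}.

Definition dx (u : R * R -> R) : R * R -> R := 'D_(1, 0) u.
Definition dy (u : R * R -> R) : R * R -> R := 'D_(0, 1) u.

Definition C1_plane (u : R * R -> R) : Prop :=
  [/\ forall p, derivable u p (1, 0), forall p, derivable u p (0, 1),
      continuous u, continuous (dx u) & continuous (dy u)].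

Definition C2_plane (u : R * R -> R) : Prop :=
  [/\ C1_plane u, C1_plane (dx u) & C1_plane (dy u)].

Definition harmonic_real (u : R * R -> R) : Prop :=
  C2_plane u /\ forall p, dx (dx u) p + dy (dy u) p = 0.

Definition harmonicC (f : R * R -> R[i]) : Prop :=
  harmonic_real (fun w => complex.Re (f w)) /\
  harmonic_real (fun w => complex.Im (f w)).

End Harmonic.

Section HarmonicFock.
Context {R : realType} (alpha : R).
Implicit Types (f g : R * R -> R[i]) (T : (R * R -> R[i]) -> R * R -> R[i]).

(* ||f||^2, the integral of |f|^2 against d lambda_alpha *)
Definition F2h_normsq f : \bar R :=
  (\int[area R]_w ((normc (f w)) ^+ 2 *
     (alpha / pi * expR (- (alpha * (normc (cplx w)) ^+ 2))))%:E)%E.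

Definition F2h_norm f : \bar R := sqrte (F2h_normsq f).

Definition F2h f : Prop := harmonicC f /\ (F2h_normsq f < +oo)%E.

Definition F2h_bounded (f : nat -> R * R -> R[i]) : Prop :=
  (forall n, F2h (f n)) /\
  exists M : R, forall n, (F2h_norm (f n) <= M%:E)%E.

Definition compact_operator T : Prop :=
  [/\ forall f, F2h f -> F2h (T f),
      forall (a : R[i]) f g, F2h f -> F2h g -> forall z,
        T (fun w => a * f w + g w) z = a * T f z + T g z &
      forall f : nat -> R * R -> R[i], F2h_bounded f ->
        exists phi : nat -> nat, {homo phi : m n / (m < n)%N} /\
        exists g, F2h g /\
          F2h_norm (fun w => T (f (phi k)) w - g w) @[k --> \oo] --> 0%E].

Definition fockK (z w : R[i]) : R[i] := expC (alpha%:C * z^* * w).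

Definition harmH (z w : R[i]) : R[i] := fockK z w + (fockK z w)^*.

Definition fockk (z w : R[i]) : R[i] :=
  expC (alpha%:C * z^* * w - (alpha / 2 * (normc z) ^+ 2)%:C).

Definition harmh (z w : R[i]) : R[i] := harmH z w / sqrtC (harmH z z).

Lemma harmH_diag (z : R[i]) :
  harmH z z = (2 * expR (alpha * (normc z) ^+ 2))%:C.
Proof.
case: z => x y; rewrite /harmH /fockK /normc sqr_sqrtr ?addr_ge0 ?sqr_ge0//.
have -> : alpha%:C * (x +i* y)^* * (x +i* y) = (alpha * (x ^+ 2 + y ^+ 2))%:C.
  by simpc; apply/eqP; rewrite eq_complex /=; apply/andP; split; apply/eqP; ring.
rewrite /expC /= cos0 sin0; simpc.
by apply/eqP; rewrite eq_complex /=; apply/andP; split; apply/eqP; ring.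
Qed.

Lemma fockkE (z w : R[i]) :
  fockk z w = (expR (alpha * (normc z) ^+ 2 / 2))^-1%:C * fockK z w.
Proof.
rewrite /fockk /fockK /expC; set u := _ * w.
case: u => a b /=; simpc; rewrite expRD expRN.
have -> : alpha / 2 * normc z ^+ 2 = alpha * normc z ^+ 2 / 2 by ring.
by apply/eqP; rewrite eq_complex /=; apply/andP; split; apply/eqP; ring.
Qed.

Lemma harmhE (z w : R[i]) :
  harmh z w = (Num.sqrt 2 / 2)%:C * (fockk z w + (fockk z w)^*).
Proof.
rewrite !fockkE /harmh harmH_diag /harmH.
set t := alpha * _; have -> : expR t = expR (t / 2) ^+ 2.
  by rewrite expr2 -expRD; congr expR; field.
have e0 := expR_gt0 (t / 2); move: (expR _) e0 => e e0.
have s0 : 0 < Num.sqrt 2 :> R by rewrite sqrtr_gt0.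
have ss : Num.sqrt 2 ^+ 2 = 2 :> R by rewrite sqr_sqrtr.
have -> : (2 * e ^+ 2)%:C = ((Num.sqrt 2 * e)%:C) ^+ 2 :> R[i].
  by rewrite -rmorphXn /= exprMn ss.
rewrite sqrCK; last by rewrite ler0c mulr_ge0 ?ltW.
rewrite -fmorphV /=.
have -> : (Num.sqrt 2 * e)^-1 = Num.sqrt 2 / 2 * e^-1.
  rewrite invfM; congr (_ * _).
  apply: (@mulfI _ (Num.sqrt 2)); first by rewrite gt_eqF.
  by rewrite mulrA -expr2 ss !divff// gt_eqF.
case: (fockK z w) => a b; simpc.
by apply/eqP; rewrite eq_complex /=; apply/andP; split; apply/eqP; ring.
Qed.

Section Measure.
Context (mu : {measure set (plane R) -> \bar R}).

Definition toeplitz_integrand f (z w : R * R) : R[i] :=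
  f w * (harmH (cplx z) (cplx w))^* *
  (expR (- (alpha * (normc (cplx w)) ^+ 2)))%:C.

Definition toeplitz f (z : R * R) : R[i] :=
  integralC mu (toeplitz_integrand f z).

(* integralC is a junk value on a non-integrable function, so convergence of   *)
(* the defining integral on all of F^2_h is part of the condition.             *)
Definition toeplitz_compact : Prop :=
  (forall f, F2h f -> forall z, integrableC mu (toeplitz_integrand f z)) /\
  compact_operator toeplitz.

Definition berezin (z : R * R) : \bar R :=
  (\int[mu]_w ((normc (harmh (cplx z) (cplx w))) ^+ 2 *
     expR (- (alpha * (normc (cplx w)) ^+ 2)))%:E)%E.

Definition berezin_vanishes : Prop :=
  forall e : R, 0 < e -> exists M : R, forall z : R * R,
    M < normc (cplx z) -> (berezin z < e%:E)%E.

(* the square of |f(w) e^{-alpha |w|^2 / 2}| *)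
Definition weighted_sq f (w : R * R) : R :=
  (normc (f w * (expR (- (alpha * (normc (cplx w)) ^+ 2 / 2)))%:C)) ^+ 2.

Definition fock_carleson : Prop :=
  exists2 C : R, 0 < C & forall f, F2h f ->
    (\int[mu]_w (weighted_sq f w)%:E <=
     C%:E * \int[area R]_w (weighted_sq f w)%:E)%E.

Definition cvg0_on_compacts (f : nat -> R * R -> R[i]) : Prop :=
  forall A : set (R * R), compact A -> forall e : R, 0 < e ->
    \forall n \near \oo, forall w, A w -> normc (f n w) < e.

Definition vanishing_fock_carleson : Prop :=
  fock_carleson /\
  forall f : nat -> R * R -> R[i], F2h_bounded f -> cvg0_on_compacts f ->
    (\int[mu]_w (weighted_sq (f n) w)%:E)%E @[n --> \oo] --> 0%E.

End Measure.
End HarmonicFock.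

(* Main.v *)
Require Import Defs.
From HB Require Import structures.
From mathcomp Require Import ring lra measurable_realfun.
Import Order.TTheory GRing.Theory Num.Theory.
Import numFieldNormedType.Exports.

Set Implicit Arguments.
Unset Strict Implicit.
Unset Printing Implicit Defensive.

Local Open Scope classical_set_scope.
Local Open Scope ring_scope.

(** The kernel $H_z=2\,\mathrm{Re}K_z$ is real, so everything reduces to real
    functions: f lies in $F^2_h$ exactly when its real and imaginary parts do,
    and the Toeplitz operator acts on the two parts separately ([toep]).

    The real functions of the space are described by an integral equation,
    $$u(z)+u(0)=\frac{2\alpha}{\pi}\int u\,\mathrm{Re}K_z\,e^{-\alpha|w|^2}dA,$$
    called [reproduced] below. A harmonic u is the real part of an entire
    function, whose imaginary part is again square integrable, and the mean
    value property gives the equation ([harmonic_reproduced]); conversely an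
    integral of the kernel is harmonic ([reproduced_harmonic]). The equation
    passes to pointwise limits, and since $|K_z(w)|$ between the square roots of
    the weight is $e^{-\alpha|z-w|^2/2}$, it yields the local estimate
    [reproduced_local]: $|u(z)|^2e^{-\alpha|z|^2}$ is at most a constant times
    a Gaussian average of $|u|^2e^{-\alpha|w|^2}$ around z. Hence point
    evaluations are bounded, $|u(z)|^2e^{-\alpha|z|^2}$ tends to 0 at infinity
    ([reproduced_vanish]), bounded families are normal ([Montel]), and a measure
    with bounded mass on unit boxes is a Carleson measure, with a small constant
    if the masses are small ([Carleson_boxes]).

    (a) implies (b). If z tends to infinity, $Th_z\to0$ pointwise, because
    $TK_z(x)=TK_x(z)$ is a value at z of a fixed element of the space; by
    compactness $Th_z\to0$ in norm along a subsequence, and the Berezin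
    transform at z is bounded by this norm ([compact_berezin]).

    (b) implies (c). The integrand of the Berezin transform contains
    $\cos^2(\alpha\,\mathrm{Im}\,\bar z w)$, which has zeros in each box; but the sum
    of the transforms at z and at a slightly turned point controls the mass of the
    box around z ([berezin_kernel_pair]). So the masses of boxes tend to 0 at infinity,
    and a sequence that tends to 0 on compact sets has small
    $L^2(\mu)$ norm both near the origin and far away ([integral_to_0]).

    (c) implies (a). Testing on $K_z$ bounds the masses of boxes, hence T is
    bounded from $L^2(\mu)$ to the Fock space, by a Schur test ([toep_reproduced]).
    A bounded sequence has a subsequence converging on compact sets to an element
    G of the space; the differences tend to 0 in $L^2(\mu)$ by hypothesis,
    and their images tend to 0 in norm ([carleson_to_compact]). *)

(** * Continuity and measurability on the plane *)

(** Every open set is the countable union of the rational squares that it contains. *)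
Lemma open_plane_measurable (R : realType) (A : set (R * R)) :
  open A -> measurable (A : set (plane R)).
Proof.
move=> oA.
pose box (i : rat * rat * rat) : set (plane R) :=
  ball (ratr i.1.1 : R) (ratr i.2) `*` ball (ratr i.1.2 : R) (ratr i.2).
have mbox i : measurable (box i).
  apply: measurableX; exact: measurable_ball.
have -> : (A : set (plane R)) =
    \bigcup_i (if `[< box i `<=` A >] then box i else set0).
  apply/seteqP; split=> [[x y] Axy|p [i _]]; last by case: asboolP => // + bp; exact.
  have /nbhs_ballP[e /= e0 eA] := open_nbhs_nbhs (conj oA Axy).
  have e20 : 0 < e / 2 by rewrite divr_gt0.
  have [q /[!in_itv]/= /andP[q0 qe]] := @rat_in_itvoo R 0 (e / 2) e20.
  have [a /[!in_itv]/= /andP[a0 a1]] : exists a, ratr a \in `]x - ratr q, x + ratr q[.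
    by apply: rat_in_itvoo; lra.
  have [b /[!in_itv]/= /andP[b0 b1]] : exists b, ratr b \in `]y - ratr q, y + ratr q[.
    by apply: rat_in_itvoo; lra.
  exists (a, b, q) => //=; rewrite asboolT.
    by split; rewrite /ball/= ltr_norml; apply/andP; split; lra.
  move=> [u v] [/=]; rewrite /ball/= !ltr_norml => /andP[u0 u1] /andP[v0 v1].
  by apply: eA; split; rewrite /ball/= ltr_norml; apply/andP; split; lra.
apply: countable_bigcupT_measurable; first exact: countableP.
by move=> i; case: asboolP.
Qed.

Lemma continuous_plane_measurable (R : realType) (f : R * R -> R) :
  continuous f -> measurable_fun [set: plane R] (f : plane R -> R).
Proof.
move=> /continuousP cf; apply: (measurability _ (RGenOpens.measurableE R)).
move=> _ [_ [a [b ->] <-]]; rewrite setTI.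
apply: open_plane_measurable; exact/cf/interval_open.
Qed.

Section ContinuityCalculus.
Context {R : realType} {T : topologicalType}.
Implicit Types f g : T -> R.

Lemma contC (c : R) : continuous (fun _ : T => c).
Proof. by move=> x; exact: cvg_cst. Qed.

Lemma contD f g : continuous f -> continuous g -> continuous (fun x => f x + g x).
Proof. by move=> cf cg x; apply: cvgD; [exact: cf|exact: cg]. Qed.

Lemma contN f : continuous f -> continuous (fun x => - f x).
Proof. by move=> cf x; apply: cvgN; exact: cf. Qed.

Lemma contM f g : continuous f -> continuous g -> continuous (fun x => f x * g x).
Proof. by move=> cf cg x; apply: cvgM; [exact: cf|exact: cg]. Qed.

Lemma contX f n : continuous f -> continuous (fun x => f x ^+ n).
Proof.
move=> cf; elim: n => [|n IH]; first exact: contC.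
rewrite (_ : (fun _ => _) = (fun x => f x * f x ^+ n)); first exact: contM.
by apply/funext => x; rewrite exprS.
Qed.

Lemma cont_comp (h : R -> R) f :
  continuous h -> continuous f -> continuous (fun x => h (f x)).
Proof. by move=> ch cf x; apply: (cvg_comp f h); [exact: cf|exact: ch]. Qed.

Lemma cont_exp f : continuous f -> continuous (fun x => expR (f x)).
Proof. exact/cont_comp/continuous_expR. Qed.

Lemma cont_cos f : continuous f -> continuous (fun x => cos (f x)).
Proof. exact/cont_comp/continuous_cos. Qed.

Lemma cont_sin f : continuous f -> continuous (fun x => sin (f x)).
Proof. exact/cont_comp/continuous_sin. Qed.

Lemma cont_norm f : continuous f -> continuous (fun x => `|f x|).
Proof. by move=> cf x; apply: cvg_norm; exact: cf. Qed.

End ContinuityCalculus.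

Lemma cont_fst (R : realType) : continuous (fun w : R * R => w.1).
Proof. by move=> x; exact: cvg_fst. Qed.

Lemma cont_snd (R : realType) : continuous (fun w : R * R => w.2).
Proof. by move=> x; exact: cvg_snd. Qed.

Lemma cont_idR (R : realType) : continuous (fun x : R => x).
Proof. by move=> x; exact: cvg_id. Qed.

Ltac cont := repeat lazymatch goal with
  | |- continuous (fun _ => ?c) => exact: contC
  | |- continuous (fun x => x) => exact: cont_idR
  | |- continuous (fun x => x.1) => exact: cont_fst
  | |- continuous (fun x => x.2) => exact: cont_snd
  | |- continuous (fun x => @?f x + @?g x) => apply: (@contD _ _ f g)
  | |- continuous (fun x => - @?f x) => apply: (@contN _ _ f)
  | |- continuous (fun x => @?f x * @?g x) => apply: (@contM _ _ f g)
  | |- continuous (fun x => @?f x ^+ _) => apply: (@contX _ _ f)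
  | |- continuous (fun x => expR (@?f x)) => apply: (@cont_exp _ _ f)
  | |- continuous (fun x => cos (@?f x)) => apply: (@cont_cos _ _ f)
  | |- continuous (fun x => sin (@?f x)) => apply: (@cont_sin _ _ f)
  | |- continuous (fun x => `|@?f x|) => apply: (@cont_norm _ _ f)
  | _ => assumption
  end.

(** * Gaussians on the plane *)

Section Plane.
Context {R : realType}.
Implicit Types (z w p q : R * R).

Definition sqn z : R := z.1 ^+ 2 + z.2 ^+ 2.

Lemma sqn_ge0 z : 0 <= sqn z.
Proof. by rewrite addr_ge0 ?sqr_ge0. Qed.

Definition gauss (c : R) p w : R := expR (- (c * sqn (w - p))).

Lemma gauss_ge0 c p w : 0 <= gauss c p w. Proof. exact: expR_ge0. Qed.

Lemma gauss_gt0 c p w : 0 < gauss c p w. Proof. exact: expR_gt0. Qed.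

Lemma gaussC c p w : gauss c p w = gauss c w p.
Proof. by rewrite /gauss /sqn /=; congr expR; ring. Qed.

Lemma gauss_sq c p w : gauss c p w ^+ 2 = gauss (2 * c) p w.
Proof. by rewrite /gauss expr2 -expRD; congr expR; ring. Qed.

Lemma continuous_gauss c p : continuous (gauss c p).
Proof. by rewrite /gauss /sqn /=; cont. Qed.

Lemma measurable_gauss c p : measurable_fun [set: plane R] (gauss c p : plane R -> R).
Proof. by apply: continuous_plane_measurable; exact: continuous_gauss. Qed.

(** This is a multiple of the density of a normal law of variance 1/(2c), whose total mass is 1. *)
Lemma integral_gauss1 (c m : R) : 0 < c ->
  (\int[@lebesgue_measure R]_x (expR (- (c * (x - m) ^+ 2)))%:E =
   (Num.sqrt (pi / c))%:E)%E.
Proof.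
move=> c0; pose s := Num.sqrt (2 * c)^-1.
have s2 : s ^+ 2 = (2 * c)^-1 by rewrite sqr_sqrtr// invr_ge0 mulr_ge0// ltW.
have s0 : s != 0 by rewrite gt_eqF// sqrtr_gt0 invr_gt0 mulr_gt0.
have pk : normal_peak s = (Num.sqrt (pi / c))^-1.
  rewrite /normal_peak s2; congr (Num.sqrt _)^-1.
  by rewrite -mulr_natr invfM; field; rewrite gt_eqF.
have p0 : 0 < Num.sqrt (pi / c) by rewrite sqrtr_gt0 divr_gt0 ?pi_gt0.
have := integral_normal_pdf m s; rewrite normal_pdfE// pk.
under eq_integral => x _.
  rewrite EFinM /normal_fun s2 -mulr_natr.
  have -> : - (x - m) ^+ 2 / ((2 * c)^-1 * 2) = - (c * (x - m) ^+ 2).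
    by field; rewrite gt_eqF.
  over.
rewrite ge0_integralZl; [|exact: measurableT| | |]; last 3 first.
- by apply/measurable_EFinP; apply: continuous_measurable_fun; cont.
- by move=> x _; rewrite lee_fin expR_ge0.
- by rewrite lee_fin invr_ge0 ltW.
move=> /(congr1 (fun y => (Num.sqrt (pi / c))%:E * y)%E).
by rewrite muleA -EFinM divff ?gt_eqF// mul1e mule1.
Qed.

Lemma integral_gauss (c : R) p : 0 < c ->
  (\int[area R]_w (gauss c p w)%:E = (pi / c)%:E)%E.
Proof.
move=> c0; rewrite /area fubini_tonelli1/=; last 2 first.
- by apply/measurable_EFinP; exact: measurable_gauss.
- by move=> w; rewrite lee_fin gauss_ge0.
rewrite /fubini_F.
under eq_integral => x _.
  under eq_integral => y _.
    rewrite (_ : gauss _ _ _ = expR (- (c * (x - p.1) ^+ 2)) * expR (- (c * (y - p.2) ^+ 2))); last first.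
      by rewrite /gauss /sqn /= -expRD; congr expR; ring.
    rewrite EFinM; over.
  rewrite ge0_integralZl; [|exact: measurableT| | |]; last 3 first.
  - by apply/measurable_EFinP; apply: continuous_measurable_fun; cont.
  - by move=> y _; rewrite lee_fin expR_ge0.
  - by rewrite lee_fin expR_ge0.
  rewrite integral_gauss1// muleC; over.
rewrite ge0_integralZl; [|exact: measurableT| | |]; last 3 first.
- by apply/measurable_EFinP; apply: continuous_measurable_fun; cont.
- by move=> y _; rewrite lee_fin expR_ge0.
- by rewrite lee_fin sqrtr_ge0.
by rewrite integral_gauss1// -EFinM -expr2 sqr_sqrtr// divr_ge0 ?pi_ge0 ?ltW.
Qed.

Lemma integrable_gauss (c : R) p : 0 < c ->
  (area R).-integrable setT (EFin \o gauss c p).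
Proof.
move=> c0; apply/integrableP; split.
  by apply/measurable_EFinP; exact: measurable_gauss.
under eq_integral => w _ do rewrite /= ger0_norm ?gauss_ge0//.
by rewrite integral_gauss// ltry.
Qed.

End Plane.

(** * Integrals of real functions *)

Section Integrals.
Context d (T : measurableType d) (R : realType) (m : {measure set T -> \bar R}).
Implicit Types f g : T -> R.

Notation intble f := (m.-integrable setT (EFin \o f)).

Lemma intble_meas f : intble f -> measurable_fun setT f.
Proof. by move=> /measurable_int/measurable_EFinP. Qed.

Lemma intble_le f g : measurable_fun setT f -> intble g ->
  (forall x, `|f x| <= g x) -> intble f.
Proof.
move=> mf ig fg; apply: (le_integrable measurableT _ _ ig).
  exact/measurable_EFinP.
move=> x _ /=; rewrite lee_fin (le_trans (fg x))// ler_norm//.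
Qed.

Lemma intbleD f g : intble f -> intble g -> intble (fun x => f x + g x).
Proof.
move=> fi gi; rewrite (_ : _ \o _ = (EFin \o f) \+ (EFin \o g))%E; last by [].
exact: integrableD.
Qed.

Lemma intbleZ c f : intble f -> intble (fun x => c * f x).
Proof.
move=> fi; rewrite (_ : _ \o _ = (fun x => c%:E * (EFin \o f) x))%E; last by [].
exact: integrableZl.
Qed.

Lemma intbleN f : intble f -> intble (fun x => - f x).
Proof.
move=> /(intbleZ (-1)); congr (m.-integrable _ _).
by apply/funext => x /=; rewrite mulN1r.
Qed.

Lemma intbleB f g : intble f -> intble g -> intble (fun x => f x - g x).
Proof. by move=> fi gi; apply: intbleD => //; apply: intbleN. Qed.

Lemma intble_norm f : intble f -> intble (fun x => `|f x|).
Proof. by move=> /integrable_abse. Qed.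

Lemma RintD f g : intble f -> intble g ->
  \int[m]_x (f x + g x) = \int[m]_x f x + \int[m]_x g x.
Proof. by move=> fi gi; rewrite RintegralD. Qed.

Lemma RintB f g : intble f -> intble g ->
  \int[m]_x (f x - g x) = \int[m]_x f x - \int[m]_x g x.
Proof. by move=> fi gi; rewrite RintegralB. Qed.

Lemma RintZ c f : intble f -> \int[m]_x (c * f x) = c * \int[m]_x f x.
Proof. by move=> fi; rewrite RintegralZl. Qed.

Lemma Rint_le f g : intble f -> intble g -> (forall x, f x <= g x) ->
  \int[m]_x f x <= \int[m]_x g x.
Proof. by move=> fi gi fg; apply: le_Rintegral. Qed.

Lemma Rint_norm f : intble f -> `|\int[m]_x f x| <= \int[m]_x `|f x|.
Proof. by move=> fi; apply: le_normr_Rintegral. Qed.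

Lemma EFin_Rint f : intble f -> (\int[m]_x (f x)%:E = (\int[m]_x f x)%:E)%E.
Proof.
by move=> fi; rewrite /Rintegral fineK//; apply: integrable_fin_num.
Qed.

Lemma intble_ge0 f : measurable_fun setT f -> (forall x, 0 <= f x) ->
  (\int[m]_x (f x)%:E < +oo)%E -> intble f.
Proof.
move=> mf f0 foo; apply/integrableP; split; first exact/measurable_EFinP.
by under eq_integral => x _ do rewrite /= ger0_norm//.
Qed.

Lemma intble_sqM f g : measurable_fun setT f -> measurable_fun setT g ->
  intble (fun x => f x ^+ 2) -> intble (fun x => g x ^+ 2) ->
  intble (fun x => f x * g x).
Proof.
move=> mf mg f2 g2; apply: intble_le (intbleD f2 g2) _.
  exact: measurable_funM.
move=> x; rewrite normrM -(real_normK (num_real (f x))) -(real_normK (num_real (g x))).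
have := sqr_ge0 (`|f x| - `|g x|); have := normr_ge0 (f x); have := normr_ge0 (g x).
by nra.
Qed.

(** The integral of $(f-tg)^2$ is a nonnegative quadratic polynomial in t. *)
Lemma Cauchy_Schwarz f g : measurable_fun setT f -> measurable_fun setT g ->
  intble (fun x => f x ^+ 2) -> intble (fun x => g x ^+ 2) ->
  (\int[m]_x (f x * g x)) ^+ 2 <=
    (\int[m]_x (f x ^+ 2)) * (\int[m]_x (g x ^+ 2)).
Proof.
move=> mf mg f2 g2; have fg := intble_sqM mf mg f2 g2.
set A := \int[m]_x (f x ^+ 2); set B := \int[m]_x (g x ^+ 2).
set C := \int[m]_x _.
have H t : 0 <= A - 2 * t * C + t ^+ 2 * B.
  have <- : \int[m]_x ((f x ^+ 2 - 2 * t * (f x * g x)) + t ^+ 2 * g x ^+ 2) =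
      A - 2 * t * C + t ^+ 2 * B.
    rewrite RintD; [|apply: intbleB => //; exact: intbleZ|exact: intbleZ].
    by rewrite RintB//; [rewrite !RintZ|exact: intbleZ].
  apply: Rintegral_ge0 => x _.
  suff -> : f x ^+ 2 - 2 * t * (f x * g x) + t ^+ 2 * g x ^+ 2 =
    (f x - t * g x) ^+ 2 by exact: sqr_ge0.
  by ring.
have B0 : 0 <= B by apply: Rintegral_ge0 => x _; exact: sqr_ge0.
have A0 : 0 <= A by apply: Rintegral_ge0 => x _; exact: sqr_ge0.
have [B00|B00] := eqVneq B 0.
  rewrite B00 mulr0; have [->|C0] := eqVneq C 0; first by rewrite expr0n.
  have := H ((A + 1) / (2 * C)); rewrite B00 mulr0 addr0.
  have -> : 2 * ((A + 1) / (2 * C)) * C = A + 1 by field.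
  by rewrite opprD addrA subrr sub0r; lra.
have B1 : 0 < B by rewrite lt_neqAle eq_sym B00.
have := H (C / B).
have -> : A - 2 * (C / B) * C + (C / B) ^+ 2 * B = (A * B - C ^+ 2) / B by field.
by rewrite pmulr_lge0 ?invr_gt0// subr_ge0.
Qed.

End Integrals.

(** * Derivatives along lines and gradients *)

Section DerivativeCalculus.
Context {R : realType}.
Implicit Types (f g : R -> R) (x a b : R).

Lemma der_id x : is_derive x 1 (fun t : R => t) 1.
Proof. exact: is_derive_id. Qed.

Lemma der_cst (c : R) x : is_derive x 1 (fun _ : R => c) 0.
Proof. exact: is_derive_cst. Qed.

Lemma derD f g x a b : is_derive x 1 f a -> is_derive x 1 g b ->
  is_derive x 1 (fun t => f t + g t) (a + b).
Proof. by move=> fa gb; exact: is_deriveD. Qed.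

Lemma derN f x a : is_derive x 1 f a -> is_derive x 1 (fun t => - f t) (- a).
Proof. by move=> fa; exact: is_deriveN. Qed.

Lemma derM f g x a b : is_derive x 1 f a -> is_derive x 1 g b ->
  is_derive x 1 (fun t => f t * g t) (f x * b + g x * a).
Proof. by move=> fa gb; exact: is_deriveM. Qed.

Lemma derX2 f x a : is_derive x 1 f a ->
  is_derive x 1 (fun t => f t ^+ 2) (2 * f x * a).
Proof.
move=> fa; rewrite (_ : (fun t => _) = (fun t => f t * f t)); last first.
  by apply/funext => t; rewrite expr2.
by rewrite (_ : 2 * f x * a = f x * a + f x * a); [exact: derM|ring].
Qed.

Lemma der_comp (h : R -> R) f x a b : is_derive (f x) 1 h b -> is_derive x 1 f a ->
  is_derive x 1 (fun t => h (f t)) (a * b).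
Proof.
by move=> hb fa; rewrite mulrC; exact: (@is_derive1_comp _ h f x b a).
Qed.

Lemma der_exp f x a : is_derive x 1 f a ->
  is_derive x 1 (fun t => expR (f t)) (a * expR (f x)).
Proof. by move=> fa; apply: der_comp fa; exact: is_derive_expR. Qed.

Lemma der_cos f x a : is_derive x 1 f a ->
  is_derive x 1 (fun t => cos (f t)) (a * - sin (f x)).
Proof. by move=> fa; apply: der_comp fa; exact: is_derive_cos. Qed.

Lemma der_sin f x a : is_derive x 1 f a ->
  is_derive x 1 (fun t => sin (f t)) (a * cos (f x)).
Proof. by move=> fa; apply: der_comp fa; exact: is_derive_sin. Qed.

Lemma der_eq f x a b : is_derive x 1 f a -> a = b -> is_derive x 1 f b.
Proof. by move=> + <-. Qed.

Lemma der_cont f (df : R -> R) : (forall x, is_derive x 1 f (df x)) -> continuous f.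
Proof.
move=> fd x; apply: differentiable_continuous.
by apply/derivable1_diffP; have [] := fd x.
Qed.

Lemma MVT_abs f (df : R -> R) a b : (forall x, is_derive x 1 f (df x)) ->
  exists2 c, `|c - a| <= `|b - a| & f b - f a = df c * (b - a).
Proof.
move=> fd; have cf := der_cont fd.
have [ab|ba] := leP a b.
  have [c /[!in_itv]/= /andP[ac cb] ->] :=
    MVT_segment ab (fun x _ => fd x) (continuous_subspaceT cf).
  by exists c => //; rewrite !ger0_norm ?subr_ge0// lerD2r.
have [c /[!in_itv]/= /andP[ac cb] e] :=
  MVT_segment (ltW ba) (fun x _ => fd x) (continuous_subspaceT cf).
exists c; first by rewrite !ler0_norm ?subr_le0//; [lra|exact: ltW].
by rewrite -[LHS]opprB e; ring.
Qed.

End DerivativeCalculus.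

(** The rules are applied by [notypeclasses refine] because [is_derive] is a class:
    instance search would otherwise answer the premises before the recursion. *)
Ltac der := repeat lazymatch goal with
  | |- is_derive _ _ (fun x => x) _ => exact: der_id
  | |- is_derive _ _ (fun _ => ?c) _ => exact: der_cst
  | |- is_derive _ _ (fun x => @?f x + @?g x) _ =>
      notypeclasses refine (@derD _ f g _ _ _ _ _)
  | |- is_derive _ _ (fun x => - @?f x) _ => notypeclasses refine (@derN _ f _ _ _)
  | |- is_derive _ _ (fun x => @?f x * @?g x) _ =>
      notypeclasses refine (@derM _ f g _ _ _ _ _)
  | |- is_derive _ _ (fun x => @?f x ^+ 2) _ => notypeclasses refine (@derX2 _ f _ _ _)
  | |- is_derive _ _ (fun x => expR (@?f x)) _ =>
      notypeclasses refine (@der_exp _ f _ _ _)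
  | |- is_derive _ _ (fun x => cos (@?f x)) _ =>
      notypeclasses refine (@der_cos _ f _ _ _)
  | |- is_derive _ _ (fun x => sin (@?f x)) _ =>
      notypeclasses refine (@der_sin _ f _ _ _)
  | _ => eassumption
  end.

Ltac der_ring := notypeclasses refine (@der_eq _ _ _ _ _ _ _); [der|rewrite /=; ring].

Section Partials.
Context {R : realType}.
Implicit Types (u ux uy : R * R -> R) (p q z w : R * R).

Definition has_grad u ux uy :=
  (forall p, is_derive p (1, 0) u (ux p)) /\
  (forall p, is_derive p (0, 1) u (uy p)).

Lemma is_derive_dx u p l :
  is_derive p (1, 0) u l <-> is_derive p.1 1 (fun t => u (t, p.2)) l.
Proof.
have e : (fun h : R => h^-1 *: ((u \o shift p) (h *: (1, 0)) - u p)) =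
    (fun h : R => h^-1 *: (((fun t => u (t, p.2)) \o shift p.1) (h *: 1) - u (p.1, p.2))).
  apply/funext => h /=; congr (_ *: (u _ - u _)); last by case: p.
  by case: p => a b; congr (_, _); rewrite /= /GRing.scale/= mulr0 add0r.
by split=> -[D V]; split; move: D V; rewrite /derivable /derive e.
Qed.

Lemma is_derive_dy u p l :
  is_derive p (0, 1) u l <-> is_derive p.2 1 (fun t => u (p.1, t)) l.
Proof.
have e : (fun h : R => h^-1 *: ((u \o shift p) (h *: (0, 1)) - u p)) =
    (fun h : R => h^-1 *: (((fun t => u (p.1, t)) \o shift p.2) (h *: 1) - u (p.1, p.2))).
  apply/funext => h /=; congr (_ *: (u _ - u _)); last by case: p.
  by case: p => a b; congr (_, _); rewrite /= /GRing.scale/= mulr0 add0r.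
by split=> -[D V]; split; move: D V; rewrite /derivable /derive e.
Qed.

Lemma has_gradP u ux uy : has_grad u ux uy <->
  (forall x y : R, is_derive x 1 (fun t => u (t, y)) (ux (x, y))) /\
  (forall x y : R, is_derive y 1 (fun t => u (x, t)) (uy (x, y))).
Proof.
split=> -[hx hy]; split.
- by move=> x y; have /is_derive_dx := hx (x, y).
- by move=> x y; have /is_derive_dy := hy (x, y).
- by move=> [x y]; apply/is_derive_dx; exact: hx.
- by move=> [x y]; apply/is_derive_dy; exact: hy.
Qed.

Lemma has_grad_dx u ux uy : has_grad u ux uy -> dx u = ux.
Proof. by move=> [hx _]; apply/funext => p; have [_] := hx p. Qed.

Lemma has_grad_dy u ux uy : has_grad u ux uy -> dy u = uy.
Proof. by move=> [_ hy]; apply/funext => p; have [_] := hy p. Qed.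

(** Moving along one coordinate at a time reduces to segments. *)
Lemma MVT_plane u ux uy p q : has_grad u ux uy ->
  exists c1 c2 : R, [/\ `|c1 - p.1| <= `|q.1 - p.1|, `|c2 - p.2| <= `|q.2 - p.2| &
    u q - u p = (q.1 - p.1) * ux (c1, q.2) + (q.2 - p.2) * uy (p.1, c2)].
Proof.
move=> /has_gradP[hx hy].
have [c1 h1 e1] := MVT_abs p.1 q.1 (fun x => hx x q.2).
have [c2 h2 e2] := MVT_abs p.2 q.2 (hy p.1).
exists c1, c2; split => //.
case: p q h1 h2 e1 e2 => [p1 p2] [q1 q2] /= _ _ e1 e2.
by rewrite mulrC -e1 mulrC -e2; ring.
Qed.

Definition locally_bounded u := forall r : R, exists M : R,
  forall p, `|p.1| <= r -> `|p.2| <= r -> `|u p| <= M.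

(** Locally bounded partial derivatives suffice; for integrals depending on a
    parameter this is a cheaper hypothesis than their continuity. *)
Lemma has_grad_continuous u ux uy : has_grad u ux uy ->
  locally_bounded ux -> locally_bounded uy -> continuous u.
Proof.
move=> g bx byy p.
pose r := Num.max `|p.1| `|p.2| + 1.
have [Mx HMx] := bx r; have [My HMy] := byy r.
pose M := Num.max 1 (Num.max Mx My).
have M1 : 1 <= M by rewrite le_max lexx.
have MMx : Mx <= M by rewrite !le_max lexx orbT.
have MMy : My <= M by rewrite !le_max lexx !orbT.
have r1 : `|p.1| + 1 <= r by rewrite lerD2r le_max lexx.
have r2 : `|p.2| + 1 <= r by rewrite lerD2r le_max lexx orbT.
apply/cvgrPdist_lt => e e0; apply/(@nbhs_ballP R (R * R)%type).
pose d := Num.min 1 (e / (2 * M)).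
have d0 : 0 < d by rewrite lt_min ltr01 divr_gt0// mulr_gt0// (lt_le_trans ltr01).
have d1 : d <= 1 by rewrite ge_min lexx.
have dM : d * M <= e / 2.
  have : d <= e / (2 * M) by rewrite ge_min lexx orbT.
  by rewrite invfM mulrA ler_pdivlMr// (lt_le_trans ltr01).
exists d => //= q [/=]; rewrite /ball/= => q1 q2.
have [c1 [c2 [h1 h2 h]]] := MVT_plane p q g.
rewrite distrC h; rewrite distrC in q1; rewrite distrC in q2.
have B1 : `|ux (c1, q.2)| <= M.
  apply: le_trans MMx; apply: HMx => /=.
    by have := ler_normD (c1 - p.1) p.1; rewrite subrK; lra.
  by have := ler_normD (q.2 - p.2) p.2; rewrite subrK; lra.
have B2 : `|uy (p.1, c2)| <= M.
  apply: le_trans MMy; apply: HMy => /=; first lra.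
  by have := ler_normD (c2 - p.2) p.2; rewrite subrK; lra.
apply: le_lt_trans (ler_normD _ _) _; rewrite !normrM.
have : `|q.1 - p.1| * `|ux (c1, q.2)| <= `|q.1 - p.1| * M by rewrite ler_wpM2l.
have : `|q.2 - p.2| * `|uy (p.1, c2)| <= `|q.2 - p.2| * M by rewrite ler_wpM2l.
have : `|q.1 - p.1| * M < d * M by rewrite ltr_pM2r// (lt_le_trans ltr01).
have : `|q.2 - p.2| * M < d * M by rewrite ltr_pM2r// (lt_le_trans ltr01).
lra.
Qed.

Lemma continuous_locally_bounded u : continuous u -> locally_bounded u.
Proof.
move=> cu r.
have K : compact (`[- r, r]%classic `*` `[- r, r]%classic : set (R * R)).
  by apply: compact_setX; exact: segment_compact.
have /compact_bounded[M [_ HM]] :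
    compact (u @` (`[- r, r]%classic `*` `[- r, r]%classic : set (R * R))).
  by apply: continuous_compact => //; exact: continuous_subspaceT.
exists (M + 1) => p p1 p2; apply: (HM (M + 1)); first by rewrite ltrDl.
by exists p => //; split; rewrite /= in_itv/= -ler_norml.
Qed.

Lemma has_grad_cont u ux uy : has_grad u ux uy ->
  continuous ux -> continuous uy -> continuous u.
Proof.
by move=> g cx cy; apply: (has_grad_continuous g); exact: continuous_locally_bounded.
Qed.

(** The difference quotient is a combination of partial derivatives at nearby
    points by [MVT_plane], and these converge by continuity. *)
Lemma has_grad_ray u ux uy z w (s : R) : has_grad u ux uy ->
  continuous ux -> continuous uy ->
  is_derive s 1 (fun s => u (z.1 + s * w.1, z.2 + s * w.2))
    (w.1 * ux (z.1 + s * w.1, z.2 + s * w.2) + w.2 * uy (z.1 + s * w.1, z.2 + s * w.2)).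
Proof.
move=> g cx cy; set p := (_, _).
set L := _ + _; set F := fun s : R => _.
suff H : h^-1 *: (F (h *: 1 + s) - F s) @[h --> 0^'] --> L.
  by split; [apply: cvgP H|apply: cvg_lim H].
apply/cvgrPdist_lt => e e0.
pose W := `|w.1| + `|w.2| + 1.
have W0 : 0 < W by rewrite ltr_wpDl// addr_ge0.
have eW : 0 < e / W by rewrite divr_gt0.
have /cvgrPdist_lt/(_ _ eW)/nbhs_ballP[d1 /= d10 H1] := cx p.
have /cvgrPdist_lt/(_ _ eW)/nbhs_ballP[d2 /= d20 H2] := cy p.
apply/nbhs_ballP; exists (Num.min d1 d2 / W) => /=.
  by rewrite divr_gt0// lt_min d10.
move=> h; rewrite /ball/= sub0r normrN ltr_pdivlMr// lt_min => /andP[h1 h2] hn0.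
pose q := (z.1 + (h + s) * w.1, z.2 + (h + s) * w.2).
have [c1 [c2 [k1 k2 k]]] := MVT_plane p q g.
have W1 : `|w.1| <= W by have := normr_ge0 w.2; rewrite /W; lra.
have W2 : `|w.2| <= W by have := normr_ge0 w.1; rewrite /W; lra.
have qp1 : q.1 - p.1 = h * w.1 by rewrite /q /p /=; ring.
have qp2 : q.2 - p.2 = h * w.2 by rewrite /q /p /=; ring.
have hw1 : `|h * w.1| <= `|h| * W by rewrite normrM ler_wpM2l.
have hw2 : `|h * w.2| <= `|h| * W by rewrite normrM ler_wpM2l.
rewrite {1}/GRing.scale /= {1}/GRing.scale /= mulr1.
rewrite (_ : F (h + s) - F s = u q - u p)// k qp1 qp2.
rewrite (_ : h^-1 * _ = w.1 * ux (c1, q.2) + w.2 * uy (p.1, c2)); last by field.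
rewrite /L (_ : _ - _ = w.1 * (ux p - ux (c1, q.2)) + w.2 * (uy p - uy (p.1, c2))); last by ring.
have B1 : `|ux p - ux (c1, q.2)| < e / W.
  apply: H1; split; rewrite /ball/= distrC.
    by apply: le_lt_trans k1 _; rewrite qp1; apply: le_lt_trans hw1 _.
  by rewrite -[X in X - _]/(q.2) qp2; apply: le_lt_trans hw2 _.
have B2 : `|uy p - uy (p.1, c2)| < e / W.
  apply: H2; split; rewrite /ball/= distrC.
    by rewrite subrr normr0.
  by apply: le_lt_trans k2 _; rewrite qp2; apply: le_lt_trans hw2 _.
apply: le_lt_trans (ler_normD _ _) _; rewrite !normrM.
have : `|w.1| * `|ux p - ux (c1, q.2)| <= `|w.1| * (e / W) by rewrite ler_wpM2l// ltW.
have : `|w.2| * `|uy p - uy (p.1, c2)| <= `|w.2| * (e / W) by rewrite ler_wpM2l// ltW.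
have : (`|w.1| + `|w.2|) * (e / W) < e.
  by rewrite mulrA ltr_pdivrMr// mulrC ltr_pM2l// /W ltrDl.
by rewrite mulrDl; lra.
Qed.

(** Continuity propagates from the second derivatives down to u, so these are the
    only functions whose continuity has to be checked. *)
Lemma harmonic_grads u ux uy uxx uxy uyx uyy :
  has_grad u ux uy -> has_grad ux uxx uxy -> has_grad uy uyx uyy ->
  continuous uxx -> continuous uxy -> continuous uyx -> continuous uyy ->
  (forall p, uxx p + uyy p = 0) -> harmonic_real u.
Proof.
move=> g gx gy cxx cxy cyx cyy H.
have cx := has_grad_cont gx cxx cxy; have cy := has_grad_cont gy cyx cyy.
have cu := has_grad_cont g cx cy.
split; last first.
  move=> p; rewrite (has_grad_dx g) (has_grad_dy g).
  by rewrite (has_grad_dx gx) (has_grad_dy gy).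
rewrite /C2_plane (has_grad_dx g) (has_grad_dy g).
have C1 v vx vy : has_grad v vx vy -> continuous vx -> continuous vy -> C1_plane v.
  move=> gv cvx cvy; have cv := has_grad_cont gv cvx cvy.
  split => //; try by rewrite ?(has_grad_dx gv) ?(has_grad_dy gv).
    by move=> p; have [/(_ p)[]] := gv.
  by move=> p; have [_ /(_ p)[]] := gv.
by split; [exact: C1 g _ _|exact: C1 gx _ _|exact: C1 gy _ _].
Qed.

Lemma C1_has_grad u : C1_plane u ->
  [/\ has_grad u (dx u) (dy u), continuous (dx u) & continuous (dy u)].
Proof. by move=> [Dx Dy _ cx cy]; split => //; split=> p; split. Qed.

End Partials.

(** * The Fock kernel *)

Section FockKernel.
Context {R : realType} (alpha : R).
Implicit Types (z w : R * R).

(** The real part of $e^{\alpha\bar z w}$, that is, half of the kernel $H_z(w)$. *)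
Definition KC z w : R := expR (alpha * (z.1 * w.1 + z.2 * w.2)) *
  cos (alpha * (z.1 * w.2 - z.2 * w.1)).

(** The imaginary part of $e^{\alpha\bar z w}$. *)
Definition KS z w : R := expR (alpha * (z.1 * w.1 + z.2 * w.2)) *
  sin (alpha * (z.1 * w.2 - z.2 * w.1)).

Lemma KC_sym z w : KC z w = KC w z.
Proof.
rewrite /KC -[in RHS]cosN; congr (expR _ * cos _); ring.
Qed.

Lemma continuous_KC z : continuous (KC z).
Proof. by rewrite /KC; cont. Qed.

Lemma continuous_KS z : continuous (KS z).
Proof. by rewrite /KS; cont. Qed.

Lemma KC_le z w : `|KC z w| <= expR (alpha * (z.1 * w.1 + z.2 * w.2)).
Proof.
by rewrite normrM ger0_norm ?expR_ge0// ler_piMr ?expR_ge0// ler_norml cos_geN1 cos_le1.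
Qed.

Lemma KS_le z w : `|KS z w| <= expR (alpha * (z.1 * w.1 + z.2 * w.2)).
Proof.
by rewrite normrM ger0_norm ?expR_ge0// ler_piMr ?expR_ge0// ler_norml sin_geN1 sin_le1.
Qed.

Lemma KC2_KS2 z w :
  KC z w ^+ 2 + KS z w ^+ 2 = expR (2 * alpha * (z.1 * w.1 + z.2 * w.2)).
Proof.
rewrite /KC /KS !exprMn -mulrDr cos2Dsin2 mulr1 expr2 -expRD; congr expR; ring.
Qed.

Lemma expR_dot_le z w r1 r2 : `|z.1| <= r1 -> `|z.2| <= r2 ->
  expR (alpha * (z.1 * w.1 + z.2 * w.2)) <=
  expR (`|alpha| * (r1 + r2) * (`|w.1| + `|w.2|)).
Proof.
move=> h1 h2; rewrite ler_expR; apply: le_trans (ler_norm _) _.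
rewrite normrM -mulrA ler_wpM2l//; apply: le_trans (ler_normD _ _) _; rewrite !normrM.
have := normr_ge0 z.1; have := normr_ge0 z.2; have := normr_ge0 w.1; have := normr_ge0 w.2.
by nra.
Qed.

End FockKernel.

(** * Integrals of the kernel are harmonic *)

Section KernelIntegral.
Context {R : realType} (alpha : R) (nu : {measure set (plane R) -> \bar R}).
Implicit Types (q : R * R -> R) (z w : R * R).

Notation intble f := (nu.-integrable [set: plane R] (EFin \o (f : plane R -> R))).

(** Decay of a complex density $q_1+iq_2$ that allows any number of
    differentiations under its integral against the kernel. *)
Definition exp_integrable q1 q2 :=
  [/\ measurable_fun [set: plane R] (q1 : plane R -> R),
      measurable_fun [set: plane R] (q2 : plane R -> R) &
      forall r : R, intble (fun w => (`|q1 w| + `|q2 w|) * expR (r * (`|w.1| + `|w.2|)))].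

(** The real part of $\int(q_1+iq_2)(w)\,e^{\alpha\bar z w}\,d\nu(w)$. *)
Definition Kint q1 q2 z : R := \int[nu]_w (q1 w * KC alpha z w - q2 w * KS alpha z w).

(** [mulw1] and [mulw2] are the two parts of $\alpha w(q_1+iq_2)(w)$. *)
Definition mulw1 q1 q2 w : R := alpha * (w.1 * q1 w - w.2 * q2 w).
Definition mulw2 q1 q2 w : R := alpha * (w.1 * q2 w + w.2 * q1 w).

(** Multiplication of the density by $-i$, which comes with every derivative in
    the second coordinate. *)
Lemma exp_integrable_rot q1 q2 : exp_integrable q1 q2 ->
  exp_integrable q2 (fun w => - q1 w).
Proof.
move=> [m1 m2 H]; split => //; first exact: measurableT_comp.
move=> r; apply: eq_integrable (H r) => //= w _.
by rewrite normrN addrC.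
Qed.

Lemma measurable_cont_mul (f : R * R -> R) q :
  continuous f -> measurable_fun [set: plane R] (q : plane R -> R) ->
  measurable_fun [set: plane R] (fun w : plane R => q w * f w).
Proof.
by move=> cf mq; apply: measurable_funM => //; exact: continuous_plane_measurable.
Qed.

(** A factor w only raises the exponent, as $|w_1|+|w_2|\le e^{|w_1|+|w_2|}$. *)
Lemma exp_integrable_mulw q1 q2 : exp_integrable q1 q2 ->
  exp_integrable (mulw1 q1 q2) (mulw2 q1 q2).
Proof.
move=> [m1 m2 H].
have mm1 : measurable_fun [set: plane R] (mulw1 q1 q2 : plane R -> R).
  apply: measurable_funM => //; apply: measurable_funB; exact: measurable_funM.
have mm2 : measurable_fun [set: plane R] (mulw2 q1 q2 : plane R -> R).
  apply: measurable_funM => //; apply: measurable_funD; exact: measurable_funM.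
split => // r.
apply: intble_le (intbleZ (2 * `|alpha|) (H (r + 1))) _.
  apply: measurable_cont_mul; last first.
    by apply: measurable_funD; exact: measurableT_comp.
  by cont.
move=> w.
have E0 := expR_ge0 (r * (`|w.1| + `|w.2|)).
rewrite ger0_norm; last by rewrite mulr_ge0// addr_ge0.
have -> : (r + 1) * (`|w.1| + `|w.2|) = r * (`|w.1| + `|w.2|) + (`|w.1| + `|w.2|) by ring.
rewrite expRD; set E := expR (r * _) in E0 *; set X := expR _.
rewrite (_ : _ * (_ * _) = 2 * `|alpha| * X * (`|q1 w| + `|q2 w|) * E); last by ring.
apply: ler_wpM2r => //.
have Hexp : `|w.1| + `|w.2| <= expR (`|w.1| + `|w.2|).
  by apply: le_trans (expR_ge1Dx _); rewrite lerDr.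
have A1 : `|mulw1 q1 q2 w| <= `|alpha| * (`|w.1| * `|q1 w| + `|w.2| * `|q2 w|).
  rewrite /mulw1 normrM ler_wpM2l//; apply: le_trans (ler_normD _ _) _.
  by rewrite normrN !normrM.
have A2 : `|mulw2 q1 q2 w| <= `|alpha| * (`|w.1| * `|q2 w| + `|w.2| * `|q1 w|).
  rewrite /mulw2 normrM ler_wpM2l//; apply: le_trans (ler_normD _ _) _.
  by rewrite !normrM.
apply: (@le_trans _ _ (`|alpha| * ((`|w.1| + `|w.2|) * (`|q1 w| + `|q2 w|)))).
  by apply: le_trans (lerD A1 A2) _; rewrite -mulrDr ler_wpM2l//; lra.
rewrite -/X in Hexp.
rewrite (_ : 2 * _ * X * _ = `|alpha| * (2 * X * (`|q1 w| + `|q2 w|))); last by ring.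
apply: ler_wpM2l => //; apply: ler_wpM2r; first by rewrite addr_ge0.
by have := expR_ge0 (`|w.1| + `|w.2|); rewrite -/X; lra.
Qed.

Lemma Kint_bound q1 q2 z w r1 r2 : `|z.1| <= r1 -> `|z.2| <= r2 ->
  `|q1 w * KC alpha z w - q2 w * KS alpha z w| <=
  (`|q1 w| + `|q2 w|) * expR (`|alpha| * (r1 + r2) * (`|w.1| + `|w.2|)).
Proof.
move=> h1 h2; apply: le_trans (ler_normD _ _) _; rewrite normrN (normrM (q1 w)) (normrM (q2 w)) mulrDl.
have E := expR_dot_le alpha w h1 h2.
by apply: lerD; apply: ler_wpM2l => //; apply: le_trans E; [exact: KC_le|exact: KS_le].
Qed.

Lemma Kint_integrable q1 q2 z : exp_integrable q1 q2 ->
  intble (fun w => q1 w * KC alpha z w - q2 w * KS alpha z w).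
Proof.
move=> [m1 m2 H]; apply: intble_le (H (`|alpha| * (`|z.1| + `|z.2|))) _; last first.
  by move=> w; exact: Kint_bound.
by apply: measurable_funB; apply: measurable_cont_mul => //;
  [exact: continuous_KC|exact: continuous_KS].
Qed.

Lemma der_KC_KS (a b : R) w (x y : R) :
  is_derive x 1 (fun t => a * KC alpha (t, y) w - b * KS alpha (t, y) w)
   (alpha * (w.1 * a - w.2 * b) * KC alpha (x, y) w
    - alpha * (w.1 * b + w.2 * a) * KS alpha (x, y) w) /\
  is_derive y 1 (fun t => a * KC alpha (x, t) w - b * KS alpha (x, t) w)
   (alpha * (w.1 * b + w.2 * a) * KC alpha (x, y) w
    + alpha * (w.1 * a - w.2 * b) * KS alpha (x, y) w).
Proof. by rewrite /KC /KS /=; split; der_ring. Qed.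

(** Differentiating $e^{\alpha\bar z w}$ in the first coordinate of z inserts the
    factor $\alpha w$, in the second one $-i\alpha w$; for z in a bounded set both
    integrands are dominated by a single integrable exponential. *)
Lemma Kint_has_grad q1 q2 : exp_integrable q1 q2 ->
  has_grad (Kint q1 q2) (Kint (mulw1 q1 q2) (mulw2 q1 q2))
    (Kint (mulw2 q1 q2) (fun w => - mulw1 q1 q2 w)).
Proof.
move=> A; have Aw := exp_integrable_mulw A; have [_ _ H] := Aw.
apply/has_gradP; split=> x y.
- pose f (t : R) (w : plane R) : R := q1 w * KC alpha (t, y) w - q2 w * KS alpha (t, y) w.
  have dE t w : partial1of2 f t w =
      mulw1 q1 q2 w * KC alpha (t, y) w - mulw2 q1 q2 w * KS alpha (t, y) w.
    rewrite partial1of2E; have [D _] := der_KC_KS (q1 w) (q2 w) w t y.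
    by case: D => _ ->.
  pose G (w : plane R) : R := (`|mulw1 q1 q2 w| + `|mulw2 q1 q2 w|) *
     expR (`|alpha| * (`|x| + 1 + `|y|) * (`|w.1| + `|w.2|)).
  have Ia : (`]x - 1, x + 1[%classic) x by rewrite /= in_itv/=; apply/andP; split; lra.
  have i1 t : `]x - 1, x + 1[%classic t -> intble (f t) by move=> _; exact: Kint_integrable.
  have i2 t w : `]x - 1, x + 1[%classic t -> [set: plane R] w -> derivable (f ^~ w) t 1.
    by move=> _ _; have [[]] := der_KC_KS (q1 w) (q2 w) w t y.
  have i3 (w : plane R) : 0 <= G w by rewrite mulr_ge0 ?expR_ge0// addr_ge0.
  have i4 : intble G by exact: H.
  have i5 t w : `]x - 1, x + 1[%classic t -> [set: plane R] w -> `|partial1of2 f t w| <= G w.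
    rewrite /= in_itv/= => /andP[t1 t2] _; rewrite dE; apply: Kint_bound => //=.
    have := ler_normD (t - x) x; rewrite subrK => h; apply: le_trans h _.
    by rewrite addrC lerD2l ler_norml; apply/andP; split; lra.
  split.
    exact: (derivable_under_integral measurableT Ia i1 i2 i3 i4 i5).
  rewrite -derive1E (differentiation_under_integral measurableT Ia i1 i2 i3 i4 i5).
  by apply: eq_Rintegral => w _; rewrite dE.
- pose f (t : R) (w : plane R) : R := q1 w * KC alpha (x, t) w - q2 w * KS alpha (x, t) w.
  have dE t w : partial1of2 f t w =
      mulw2 q1 q2 w * KC alpha (x, t) w - (- mulw1 q1 q2 w) * KS alpha (x, t) w.
    rewrite partial1of2E; have [_ D] := der_KC_KS (q1 w) (q2 w) w x t.
    by case: D => _ ->; rewrite /mulw1 /mulw2; ring.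
  pose G (w : plane R) : R := (`|mulw1 q1 q2 w| + `|mulw2 q1 q2 w|) *
     expR (`|alpha| * (`|x| + (`|y| + 1)) * (`|w.1| + `|w.2|)).
  have Ia : (`]y - 1, y + 1[%classic) y by rewrite /= in_itv/=; apply/andP; split; lra.
  have i1 t : `]y - 1, y + 1[%classic t -> intble (f t) by move=> _; exact: Kint_integrable.
  have i2 t w : `]y - 1, y + 1[%classic t -> [set: plane R] w -> derivable (f ^~ w) t 1.
    by move=> _ _; have [_ []] := der_KC_KS (q1 w) (q2 w) w x t.
  have i3 (w : plane R) : 0 <= G w by rewrite mulr_ge0 ?expR_ge0// addr_ge0.
  have i4 : intble G by exact: H.
  have i5 t w : `]y - 1, y + 1[%classic t -> [set: plane R] w -> `|partial1of2 f t w| <= G w.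
    rewrite /= in_itv/= => /andP[t1 t2] _; rewrite dE /G [X in _ <= X * _]addrC.
    rewrite -[`|mulw1 q1 q2 w|]normrN.
    apply: (@Kint_bound (mulw2 q1 q2) (fun w => - mulw1 q1 q2 w)) => //=.
    have := ler_normD (t - y) y; rewrite subrK => h; apply: le_trans h _.
    by rewrite addrC lerD2l ler_norml; apply/andP; split; lra.
  split.
    exact: (derivable_under_integral measurableT Ia i1 i2 i3 i4 i5).
  rewrite -derive1E (differentiation_under_integral measurableT Ia i1 i2 i3 i4 i5).
  by apply: eq_Rintegral => w _; rewrite dE.
Qed.

Lemma Kint_locally_bounded q1 q2 : exp_integrable q1 q2 -> locally_bounded (Kint q1 q2).
Proof.
move=> A r; have [_ _ H] := A.
exists (\int[nu]_w ((`|q1 w| + `|q2 w|) * expR (`|alpha| * (r + r) * (`|w.1| + `|w.2|)))).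
move=> p p1 p2; apply: le_trans (Rint_norm (Kint_integrable p A)) _.
apply: Rint_le; [exact: intble_norm (Kint_integrable p A)|exact: H|].
by move=> w; exact: Kint_bound.
Qed.

Lemma Kint_continuous q1 q2 : exp_integrable q1 q2 -> continuous (Kint q1 q2).
Proof.
move=> A; apply: (has_grad_continuous (Kint_has_grad A)); apply: Kint_locally_bounded.
  exact: exp_integrable_mulw.
exact/exp_integrable_rot/exp_integrable_mulw.
Qed.

(** Each derivative of the kernel $e^{\alpha\bar z w}$ in z inserts a factor
    $\alpha w$, up to $-i$, so the two pure second derivatives cancel under the integral. The constant c
    is there for the value at the origin in the reproducing formula. *)
Lemma Kint_harmonic q1 q2 (c : R) : exp_integrable q1 q2 ->
  harmonic_real (fun z => Kint q1 q2 z - c).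
Proof.
move=> A; have Aw := exp_integrable_mulw A; have Ar := exp_integrable_rot Aw.
have Aww := exp_integrable_mulw Aw; have Arw := exp_integrable_mulw Ar.
have [g1 g2] := Kint_has_grad A.
apply: (@harmonic_grads _ _ _ _ _ _ _ _ _ (Kint_has_grad Aw) (Kint_has_grad Ar)).
- split=> p.
    by have := is_deriveB (g1 p) (is_derive_cst c p (1, 0)); rewrite subr0; apply.
  by have := is_deriveB (g2 p) (is_derive_cst c p (0, 1)); rewrite subr0; apply.
- exact: Kint_continuous.
- exact/Kint_continuous/exp_integrable_rot.
- exact: Kint_continuous.
- exact/Kint_continuous/exp_integrable_rot.
move=> p; rewrite /Kint -RintD; last 2 first.
- exact: Kint_integrable.
- by apply: Kint_integrable; exact: exp_integrable_rot.
transitivity (\int[nu]_w (cst 0 w : R)); last by rewrite Rintegral_cst ?mul0r.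
by apply: eq_Rintegral => w _; rewrite /mulw1 /mulw2 /=; ring.
Qed.

End KernelIntegral.

(** * Cauchy-Riemann pairs *)

Section Holomorphic.
Context {R : realType}.
Implicit Types P Q p q u v : R * R -> R.

(** P + iQ is holomorphic with derivative p + iq: the Cauchy-Riemann equations are
    built into the two gradients. *)
Definition holo P Q p q :=
  [/\ has_grad P p (fun w => - q w), has_grad Q q p, continuous p & continuous q].

Lemma holo_cont P Q p q : holo P Q p q -> continuous P /\ continuous Q.
Proof.
move=> [gP gQ cp cq]; split; first by apply: (has_grad_cont gP) => //; exact: contN.
exact: (has_grad_cont gQ).
Qed.

Lemma holoM P Q p q P' Q' p' q' : holo P Q p q -> holo P' Q' p' q' ->
  holo (fun w => P w * P' w - Q w * Q' w) (fun w => P w * Q' w + Q w * P' w)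
    (fun w => (P w * p' w - Q w * q' w) + (p w * P' w - q w * Q' w))
    (fun w => (P w * q' w + Q w * p' w) + (p w * Q' w + q w * P' w)).
Proof.
move=> h h'; have [cP cQ] := holo_cont h; have [cP' cQ'] := holo_cont h'.
have [gP gQ cp cq] := h; have [gP' gQ' cp' cq'] := h'.
have [px py] := (has_gradP _ _ _).1 gP.
have [qx qy] := (has_gradP _ _ _).1 gQ.
have [px' py'] := (has_gradP _ _ _).1 gP'.
have [qx' qy'] := (has_gradP _ _ _).1 gQ'.
split; [| |by cont|by cont].
  apply/has_gradP; split=> x y.
    have := px x y; have := qx x y; have := px' x y; have := qx' x y => *.
    by der_ring.
  have := py x y; have := qy x y; have := py' x y; have := qy' x y => *.
  by der_ring.
apply/has_gradP; split=> x y.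
  have := px x y; have := qx x y; have := px' x y; have := qx' x y => *.
  by der_ring.
have := py x y; have := qy x y; have := py' x y; have := qy' x y => *.
by der_ring.
Qed.

(** The function $e^{a\bar z(w-c)}$ of w. *)
Lemma holo_exp (a : R) (z c : R * R) :
  holo (fun w => expR (a * (z.1 * (w.1 - c.1) + z.2 * (w.2 - c.2))) *
          cos (a * (z.1 * (w.2 - c.2) - z.2 * (w.1 - c.1))))
       (fun w => expR (a * (z.1 * (w.1 - c.1) + z.2 * (w.2 - c.2))) *
          sin (a * (z.1 * (w.2 - c.2) - z.2 * (w.1 - c.1))))
       (fun w => a * (z.1 * (expR (a * (z.1 * (w.1 - c.1) + z.2 * (w.2 - c.2))) *
          cos (a * (z.1 * (w.2 - c.2) - z.2 * (w.1 - c.1)))) +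
           z.2 * (expR (a * (z.1 * (w.1 - c.1) + z.2 * (w.2 - c.2))) *
          sin (a * (z.1 * (w.2 - c.2) - z.2 * (w.1 - c.1))))))
       (fun w => a * (z.1 * (expR (a * (z.1 * (w.1 - c.1) + z.2 * (w.2 - c.2))) *
          sin (a * (z.1 * (w.2 - c.2) - z.2 * (w.1 - c.1)))) -
           z.2 * (expR (a * (z.1 * (w.1 - c.1) + z.2 * (w.2 - c.2))) *
          cos (a * (z.1 * (w.2 - c.2) - z.2 * (w.1 - c.1)))))).
Proof.
split; [| |by cont|by cont]; apply/has_gradP; split=> x y /=;
by der_ring.
Qed.

End Holomorphic.

(** * Limits under the integral *)

Section LimitTheorems.
Context d (T : measurableType d) (R : realType) (m : {measure set T -> \bar R}).
Notation intble f := (m.-integrable setT (EFin \o f)).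

Lemma Rint_dominated (f_ : nat -> T -> R) (f g : T -> R) :
  (forall n, measurable_fun setT (f_ n)) -> intble g ->
  (forall x, f_ n x @[n --> \oo] --> f x) -> (forall n x, `|f_ n x| <= g x) ->
  intble f /\ \int[m]_x f_ n x @[n --> \oo] --> \int[m]_x f x.
Proof.
move=> mf ig ff fg.
have mff : measurable_fun setT f by apply: (measurable_fun_cvg mf) => x _; exact: ff.
have ffE x : (EFin \o f_ n) x @[n --> \oo] --> (f x)%:E.
  by apply: cvg_EFin (ff x); exact: nearW.
have [h1 _ h2] := @dominated_convergence _ _ _ m setT measurableT
  (fun n => EFin \o f_ n) (EFin \o f) (EFin \o g)
  (fun n => (measurable_EFinP _ _).2 (mf n)) ((measurable_EFinP _ _).2 mff)
  (aeW _ (fun x _ => ffE x)) ig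
  (aeW _ (fun x n _ => fg n x)).
split => //; apply: fine_cvg; rewrite fineK; first exact: h2.
exact: integrable_fin_num.
Qed.

Lemma Rint_Fatou (f_ : nat -> T -> R) (f : T -> R) (B : R) :
  (forall n, measurable_fun setT (f_ n)) -> (forall n x, 0 <= f_ n x) ->
  (forall x, f_ n x @[n --> \oo] --> f x) ->
  (forall n, \int[m]_x (f_ n x)%:E <= B%:E)%E ->
  (\int[m]_x (f x)%:E <= B%:E)%E.
Proof.
move=> mf f0 ff fB.
have := @fatou _ _ _ m setT measurableT (fun n => EFin \o f_ n)
  (fun n => (measurable_EFinP _ _).2 (mf n)) (fun n x _ => f0 n x).
rewrite (_ : (fun x : T => limn_einf _) = (fun x => (f x)%:E)); last first.
  apply/funext => x; have h : (EFin \o f_ n) x @[n --> \oo] --> (f x)%:E.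
    by apply: cvg_EFin (ff x); exact: nearW.
  by rewrite is_cvg_limn_einfE; [exact/cvg_lim|apply/cvg_ex; eexists; exact: h].
move=> h; apply: le_trans h _.
rewrite limn_einf_lim; apply: lime_le; first exact: is_cvg_einfs.
apply: nearW => n; apply: le_trans (fB n).
by apply: ereal_inf_lbound; exists n => /=.
Qed.

End LimitTheorems.

Lemma cont_pair (R : realType) (T : topologicalType) (f g : T -> R) :
  continuous f -> continuous g -> continuous (fun w => (f w, g w)).
Proof. by move=> cf cg w; exact: (cvg_pair (cf w) (cg w)). Qed.

Lemma cont_slice1 (R : realType) (f : R * R -> R) (y : R) :
  continuous f -> continuous (fun x => f (x, y)).
Proof.
move=> cf x; apply: (cvg_comp (fun t : R => (t, y)) f); last exact: cf.
exact: (cont_pair (@cont_idR R) (@contC R R y)).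
Qed.

Lemma cont_slice2 (R : realType) (f : R * R -> R) (x : R) :
  continuous f -> continuous (fun y => f (x, y)).
Proof.
move=> cf y; apply: (cvg_comp (fun t : R => (x, t)) f); last exact: cf.
exact: (cont_pair (@contC R R x) (@cont_idR R)).
Qed.

(** * Integrals of exact derivatives *)

Section CompactSupport.
Context {R : realType}.
Notation leb := (@lebesgue_measure R).
Notation intble f := ((area R).-integrable [set: plane R] (EFin \o (f : plane R -> R))).

Lemma FTC (F f : R -> R) (a b : R) : a < b ->
  (forall x : R, is_derive x 1 F (f x)) -> continuous f ->
  (\int[leb]_(x in `[a, b]) (f x)%:E = (F b - F a)%:E)%E.
Proof.
move=> ab Ff cf; rewrite (@continuous_FTC2 _ f F)//.
- exact: continuous_subspaceT.
- have cF := der_cont Ff; split.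
  + by move=> x _; have [] := Ff x.
  + by apply: cvg_at_right_filter; exact: cF.
  + by apply: cvg_at_left_filter; exact: cF.
- by move=> x _; rewrite derive1E; have [] := Ff x.
Qed.

Lemma integral_supp (f : R -> R) (a b : R) : (forall x, ~~ (a <= x <= b) -> f x = 0) ->
  (\int[leb]_x (f x)%:E = \int[leb]_(x in `[a, b]) (f x)%:E)%E.
Proof.
move=> f0; rewrite [RHS]integral_mkcond; apply: eq_integral => x _.
rewrite patchE; case: ifPn => //; rewrite notin_setE /= in_itv /= => /negP h.
by rewrite f0.
Qed.

(** A bounded function with bounded support is dominated by a multiple of a
    Gaussian. *)
Lemma intble_compact_support (f : R * R -> R) (z : R * R) (L : R) : continuous f ->
  (forall w, L <= `|w.1 - z.1| \/ L <= `|w.2 - z.2| -> f w = 0) -> intble f.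
Proof.
move=> cf f0; have [M HM] := continuous_locally_bounded cf (`|z.1| + `|z.2| + L).
pose K := expR (2 * L ^+ 2) * `|M|.
have := intbleZ K (@integrable_gauss R 1 z ltr01) => iK.
apply: (intble_le _ iK); first exact: continuous_plane_measurable.
move=> w; have K0 : 0 <= K * gauss 1 z w.
  by rewrite mulr_ge0 ?gauss_ge0// mulr_ge0 ?expR_ge0.
have [h1|h1] := leP L `|w.1 - z.1|; first by rewrite f0 ?normr0//; left.
have [h2|h2] := leP L `|w.2 - z.2|; first by rewrite f0 ?normr0//; right.
have fM : `|f w| <= `|M|.
  apply: le_trans (ler_norm _); apply: HM.
    by have := ler_normD (w.1 - z.1) z.1; rewrite subrK; have := normr_ge0 z.2; lra.
  by have := ler_normD (w.2 - z.2) z.2; rewrite subrK; have := normr_ge0 z.1; lra.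
apply: le_trans fM _; rewrite /K mulrAC ler_peMl// /gauss -expRD.
apply: le_trans (expR_ge1Dx _); rewrite lerDl /sqn /= mul1r.
rewrite -(real_normK (num_real (w.1 - z.1))) -(real_normK (num_real (w.2 - z.2))).
have := normr_ge0 (w.1 - z.1); have := normr_ge0 (w.2 - z.2); by nra.
Qed.

Definition supported (F : R * R -> R) (z : R * R) (L : R) :=
  forall w, L <= `|w.1 - z.1| \/ L <= `|w.2 - z.2| -> F w = 0.

(** Fubini, then the fundamental theorem of calculus on a segment that contains
    the support. *)
Lemma Rint_dy_eq0 (F G : R * R -> R) (z : R * R) (L : R) : 0 < L ->
  (forall x y : R, is_derive y 1 (fun t => F (x, t)) (G (x, y))) -> continuous G ->
  supported F z L -> supported G z L -> \int[area R]_w G w = 0.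
Proof.
move=> L0 FG cG sF sG; have iG := intble_compact_support cG sG.
rewrite /Rintegral /area -integral12_prod_meas1//= /fubini_F/=.
rewrite (_ : (fun x : measurableTypeR R => _) = cst 0%E) ?integral_cst ?mul0e//.
apply/funext => x.
rewrite (@integral_supp (fun y => G (x, y)) (z.2 - L) (z.2 + L)); last first.
  move=> y h; apply: sG; right => /=; rewrite leNgt; apply: contra h.
  by rewrite ltr_norml => /andP[h1 h2]; apply/andP; split; lra.
have ab : z.2 - L < z.2 + L by lra.
have cGx : continuous (fun y => G (x, y)).
  exact: cont_slice2.
rewrite (FTC ab (FG x) cGx).
by rewrite !sF ?subrr//; right; rewrite /= addrAC subrr add0r ?normrN ler_norm.
Qed.

Lemma Rint_dx_eq0 (F G : R * R -> R) (z : R * R) (L : R) : 0 < L ->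
  (forall x y : R, is_derive x 1 (fun t => F (t, y)) (G (x, y))) -> continuous G ->
  supported F z L -> supported G z L -> \int[area R]_w G w = 0.
Proof.
move=> L0 FG cG sF sG; have iG := intble_compact_support cG sG.
rewrite /Rintegral /area -integral21_prod_meas1//= /fubini_G/=.
rewrite (_ : (fun x : measurableTypeR R => _) = cst 0%E) ?integral_cst ?mul0e//.
apply/funext => y.
rewrite (@integral_supp (fun x => G (x, y)) (z.1 - L) (z.1 + L)); last first.
  move=> x h; apply: sG; left => /=; rewrite leNgt; apply: contra h.
  by rewrite ltr_norml => /andP[h1 h2]; apply/andP; split; lra.
have ab : z.1 - L < z.1 + L by lra.
have cGy : continuous (fun x => G (x, y)).
  exact: cont_slice1.
rewrite (FTC ab (fun x => FG x y) cGy).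
by rewrite !sF ?subrr//; left; rewrite /= addrAC subrr add0r ?normrN ler_norm.
Qed.

End CompactSupport.

(** * Mean value property with radial cutoffs *)

Section MeanValue.
Context {R : realType}.
Notation intble f := ((area R).-integrable [set: plane R] (EFin \o (f : plane R -> R))).

(** The cutoff itself is $k(|w-z|^2)$; as a function of the squared distance it is
    continuously differentiable at the centre as well. *)
Definition radial_cutoff (k k' : R -> R) (L : R) :=
  [/\ 0 < L, forall t : R, is_derive t 1 k (k' t), continuous k' &
     forall t, L ^+ 2 <= t -> k t = 0 /\ k' t = 0].

Lemma sqn_large (z w : R * R) (L : R) : 0 < L ->
  L <= `|w.1 - z.1| \/ L <= `|w.2 - z.2| -> L ^+ 2 <= sqn (w - z).
Proof.
move=> L0; rewrite /sqn /=.
rewrite -(real_normK (num_real (w.1 - z.1))) -(real_normK (num_real (w.2 - z.2))).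
have h1 := sqr_ge0 `|w.1 - z.1|; have h2 := sqr_ge0 `|w.2 - z.2|.
by case=> h; have : L ^+ 2 <= _ ^+ 2 := lerXn2r 2 (ltW L0) (normr_ge0 _) h; lra.
Qed.

(** In polar coordinates around z the integrand is the angular derivative of Q
    times a radial weight: it is the difference of two exact derivatives of
    compactly supported functions. *)
Lemma Rint_angular (Q qx qy : R * R -> R) (k k' : R -> R) (L : R) (z : R * R) :
  has_grad Q qx qy -> continuous qx -> continuous qy -> radial_cutoff k k' L ->
  \int[area R]_w (((w.1 - z.1) * qy w - (w.2 - z.2) * qx w) * k (sqn (w - z))) = 0.
Proof.
move=> gQ cx cy [L0 dk ck' k0]; have cQ := has_grad_cont gQ cx cy.
have ck := der_cont dk; have [qX qY] := (has_gradP _ _ _).1 gQ.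
have csq : continuous (fun w : R * R => sqn (w - z)) by rewrite /sqn /=; cont.
have ckk : continuous (fun w : R * R => k (sqn (w - z))) by apply: cont_comp.
have ckk' : continuous (fun w : R * R => k' (sqn (w - z))) by apply: cont_comp.
pose F1 (w : R * R) := (w.1 - z.1) * (Q w * k (sqn (w - z))).
pose F2 (w : R * R) := (w.2 - z.2) * (Q w * k (sqn (w - z))).
pose G1 (w : R * R) := (w.1 - z.1) * (qy w * k (sqn (w - z)) +
  Q w * (2 * (w.2 - z.2) * k' (sqn (w - z)))).
pose G2 (w : R * R) := (w.2 - z.2) * (qx w * k (sqn (w - z)) +
  Q w * (2 * (w.1 - z.1) * k' (sqn (w - z)))).
have s (F : R * R -> R) : (forall w, k (sqn (w - z)) = 0 -> k' (sqn (w - z)) = 0 -> F w = 0) ->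
    supported F z L.
  by move=> h w /(sqn_large L0)/k0[? ?]; exact: h.
have sF1 : supported F1 z L by apply: s => w e _; rewrite /F1 e !mulr0.
have sF2 : supported F2 z L by apply: s => w e _; rewrite /F2 e !mulr0.
have sG1 : supported G1 z L by apply: s => w e e'; rewrite /G1 e e' !(mulr0, addr0).
have sG2 : supported G2 z L by apply: s => w e e'; rewrite /G2 e e' !(mulr0, addr0).
have cG1 : continuous G1 by rewrite /G1; cont.
have cG2 : continuous G2 by rewrite /G2; cont.
have D1 (x y : R) : is_derive y 1 (fun t => F1 (x, t)) (G1 (x, y)).
  have hQ := qY x y.
  have hk : is_derive y 1 (fun t => k (sqn ((x, t) - z))) (2 * (y - z.2) * k' (sqn ((x, y) - z))).
    notypeclasses refine (@der_comp _ k (fun t => sqn ((x, t) - z)) _ _ _ (dk _) _).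
    by rewrite /sqn /= ; der_ring.
  by rewrite /F1 /G1 /=; der_ring.
have D2 (x y : R) : is_derive x 1 (fun t => F2 (t, y)) (G2 (x, y)).
  have hQ := qX x y.
  have hk : is_derive x 1 (fun t => k (sqn ((t, y) - z))) (2 * (x - z.1) * k' (sqn ((x, y) - z))).
    notypeclasses refine (@der_comp _ k (fun t => sqn ((t, y) - z)) _ _ _ (dk _) _).
    by rewrite /sqn /= ; der_ring.
  by rewrite /F2 /G2 /=; der_ring.
transitivity (\int[area R]_w (G1 w - G2 w)).
  by apply: eq_Rintegral => w _; rewrite /G1 /G2; ring.
rewrite RintB; [|exact: intble_compact_support cG1 sG1|exact: intble_compact_support cG2 sG2].
by rewrite (Rint_dy_eq0 L0 D1 cG1 sF1 sG1) (Rint_dx_eq0 L0 D2 cG2 sF2 sG2) subrr.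
Qed.

(** By the Cauchy-Riemann equations the radial derivative of P is the angular
    derivative of Q, so the weighted mean of P over dilations about z does not
    depend on the dilation factor. *)
Lemma holo_mean_cutoff (P Q p q : R * R -> R) (k k' : R -> R) (L : R) (z : R * R) :
  holo P Q p q -> radial_cutoff k k' L ->
  \int[area R]_w (P w * k (sqn (w - z))) = P z * \int[area R]_w k (sqn (w - z)).
Proof.
move=> hol kL; have [gP gQ cp cq] := hol; have [cP cQ] := holo_cont hol.
have [L0 dk ck' k0] := kL; have ck := der_cont dk.
have csq : continuous (fun w : R * R => sqn (w - z)) by rewrite /sqn /=; cont.
have ckk : continuous (fun w : R * R => k (sqn (w - z))) by apply: cont_comp.
pose ray (s : R) (w : R * R) : R * R := (z.1 + s * (w.1 - z.1), z.2 + s * (w.2 - z.2)).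
have cray s (f : R * R -> R) : continuous f -> continuous (fun w => f (ray s w)).
  move=> cf w; apply: (cvg_comp (ray s) f); last exact: cf.
  by apply: (@cont_pair _ _ (fun w => z.1 + s * (w.1 - z.1)) (fun w => z.2 + s * (w.2 - z.2))); cont.
pose f (s : R) (w : plane R) : R := P (ray s w) * k (sqn (w - z)).
pose f' (s : R) (w : plane R) : R :=
  ((w.1 - z.1) * p (ray s w) + (w.2 - z.2) * - q (ray s w)) * k (sqn (w - z)).
have df (s : R) w : is_derive s 1 (f ^~ w) (f' s w).
  have h := has_grad_ray z (w.1 - z.1, w.2 - z.2) s gP cp (contN cq).
  by rewrite /f /f'; notypeclasses refine (@der_eq _ _ _ _ _ (derM h (der_cst _ _)) _); rewrite mulr0 add0r mulrC.
have d1 s w : partial1of2 f s w = f' s w by rewrite partial1of2E; have [_] := df s w.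
have supp (g : R * R -> R) : supported (fun w => g w * k (sqn (w - z))) z L.
  by move=> w /(sqn_large L0)/k0[-> _]; rewrite mulr0.
have if_ s : intble (f s).
  by apply: (intble_compact_support (z := z) (L := L)); [apply: contM => //; exact: cray|exact: supp].
have [Mp HMp] := continuous_locally_bounded cp (`|z.1| + `|z.2| + 2 * L).
have [Mq HMq] := continuous_locally_bounded cq (`|z.1| + `|z.2| + 2 * L).
pose G (w : plane R) : R :=
  (`|w.1 - z.1| * `|Mp| + `|w.2 - z.2| * `|Mq|) * `|k (sqn (w - z))|.
have iG : intble G.
  apply: (intble_compact_support (z := z) (L := L)).
    by rewrite /G; cont.
  by move=> w /(sqn_large L0)/k0[e _]; rewrite /G e normr0 mulr0.
(* The mean of P over dilations by s; its derivative vanishes for s > 0, and the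
   margin around [0, 1] below gives differentiability at the endpoints. *)
pose N (s : R) : R := \int[area R]_w f s w.
have Is s : `]-1, 2[%classic s -> forall w, `|f' s w| <= G w.
  rewrite /= in_itv/= => /andP[s1 s2] w.
  have [h1|h1] := leP L `|w.1 - z.1|.
    by rewrite /f' /G (k0 _ (sqn_large L0 (or_introl h1))).1 !(mulr0, normr0).
  have [h2|h2] := leP L `|w.2 - z.2|.
    by rewrite /f' /G (k0 _ (sqn_large L0 (or_intror h2))).1 !(mulr0, normr0).
  have s2' : `|s| <= 2 by rewrite ler_norml; apply/andP; split; lra.
  have r1 : `|(ray s w).1| <= `|z.1| + `|z.2| + 2 * L.
    apply: le_trans (ler_normD _ _) _; rewrite normrM -addrA lerD2l.
    apply: ler_wpDl => //; apply: ler_pM => //; exact: ltW.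
  have r2 : `|(ray s w).2| <= `|z.1| + `|z.2| + 2 * L.
    apply: le_trans (ler_normD _ _) _; rewrite normrM [X in _ <= X + _]addrC -addrA lerD2l.
    apply: ler_wpDl => //; apply: ler_pM => //; exact: ltW.
  rewrite /f' /G normrM ler_wpM2r//; apply: le_trans (ler_normD _ _) _.
  rewrite (normrM (w.1 - z.1)) (normrM (w.2 - z.2)) normrN.
  by apply: lerD; rewrite ler_wpM2l//; apply: le_trans (ler_norm _); [exact: HMp|exact: HMq].
have dN (s : R) : `]-1, 2[%classic s -> is_derive s 1 N (\int[area R]_w f' s w).
  move=> Ia.
  have i1 t : `]-1, 2[%classic t -> intble (f t) by move=> _.
  have i2 t w : `]-1, 2[%classic t -> [set: plane R] w -> derivable (f ^~ w) t 1.
    by move=> _ _; have [] := df t w.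
  have i3 (w : plane R) : 0 <= G w by rewrite mulr_ge0// addr_ge0// mulr_ge0.
  have i5 t w : `]-1, 2[%classic t -> [set: plane R] w -> `|partial1of2 f t w| <= G w.
    by move=> It _; rewrite d1; exact: Is.
  split; first exact: (derivable_under_integral measurableT Ia i1 i2 i3 iG i5).
  rewrite -derive1E (differentiation_under_integral measurableT Ia i1 i2 i3 iG i5).
  by apply: eq_Rintegral => w _; rewrite d1.
have N'0 s : 0 < s -> \int[area R]_w f' s w = 0.
  move=> s0.
  have gQs : has_grad (fun w => Q (ray s w)) (fun w => s * q (ray s w)) (fun w => s * p (ray s w)).
    have [qx qy] := (has_gradP _ _ _).1 gQ.
    apply/has_gradP; split=> x y.
      have := qx (ray s (x, y)).1 (ray s (x, y)).2 => h.
      notypeclasses refine (@der_comp _ (fun t => Q (t, (ray s (x, y)).2)) (fun t => z.1 + s * (t - z.1)) _ _ _ h _).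
      by der_ring.
    have := qy (ray s (x, y)).1 (ray s (x, y)).2 => h.
    notypeclasses refine (@der_comp _ (fun t => Q ((ray s (x, y)).1, t)) (fun t => z.2 + s * (t - z.2)) _ _ _ h _).
    by der_ring.
  have cqs : continuous (fun w => s * q (ray s w)) by apply: contM; [exact: contC|exact: cray].
  have cps : continuous (fun w => s * p (ray s w)) by apply: contM; [exact: contC|exact: cray].
  have := Rint_angular z gQs cqs cps kL.
  rewrite (_ : \int[_]_w _ = \int[area R]_w (s * f' s w)); last first.
    by apply: eq_Rintegral => w _; rewrite /f'; ring.
  rewrite RintZ; last first.
    apply: (intble_compact_support (z := z) (L := L)); last exact: supp.
    by have cp1 := cray s _ cp; have cq1 := cray s _ cq; rewrite /f'; cont.
  by move/eqP; rewrite mulf_eq0 gt_eqF//= => /eqP.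
have I01 : `[0, 1]%classic `<=` (`]-1, 2[%classic : set R).
  by move=> s; rewrite /= !in_itv/= => /andP[s0 s1]; apply/andP; split; lra.
have cN : {within `[0, 1], continuous N}.
  apply: continuous_subspaceW I01 _.
  by apply: derivable_within_continuous => s Is'; have [] := dN s Is'.
have [c /[!in_itv]/= /andP[c0 c1]] := @MVT R N (fun s => \int[area R]_w f' s w) 0 1 ltr01
  (fun x hx => dN x (I01 x (subset_itv_oo_cc hx))) cN.
rewrite N'0// mul0r => /eqP; rewrite subr_eq0 => /eqP e.
transitivity (N 1).
  apply: eq_Rintegral => w _; rewrite /f /ray !mul1r; congr (P _ * _).
  by case: w => a b /=; congr (_, _); ring.
rewrite e /N /f -RintZ; last first.
  apply: (intble_compact_support (z := z) (L := L)) => //.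
  by move=> w /(sqn_large L0)/k0[-> _].
apply: eq_Rintegral => w _; rewrite /ray !mul0r !addr0; congr (P _ * _).
by case: (z).
Qed.

End MeanValue.

(** * Gaussian mean values *)

Section GaussianMean.
Context {R : realType} (alpha : R) (alpha0 : 0 < alpha).
Notation intble f := ((area R).-integrable [set: plane R] (EFin \o (f : plane R -> R))).

(** The square makes the truncation continuously differentiable. *)
Definition pos_sqr (x : R) : R := Num.max 0 x ^+ 2.

Lemma der_pos_sqr (x : R) : is_derive x 1 pos_sqr (2 * Num.max 0 x).
Proof.
have key (t : R) : `|pos_sqr (t + x) - pos_sqr x - 2 * t * Num.max 0 x| <= t ^+ 2.
  rewrite /pos_sqr ler_norml; apply/andP.
  by case: (leP 0 x) => h1; case: (leP 0 (t + x)) => h2; split; nra.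
suff H : h^-1 *: (pos_sqr (h *: 1 + x) - pos_sqr x) @[h --> 0^'] --> 2 * Num.max 0 x.
  by split; [apply: cvgP H|apply: cvg_lim H].
apply/cvgrPdist_lt => e e0; apply/nbhs_ballP; exists e => //= t.
rewrite /ball/= sub0r normrN => te t0.
rewrite !/(_ *: _)/= mulr1.
rewrite (_ : _ - _ = - (t^-1 * (pos_sqr (t + x) - pos_sqr x - 2 * t * Num.max 0 x))); last by field.
rewrite normrN normrM normfV mulrC ltr_pdivrMr ?normr_gt0//.
apply: le_lt_trans (key t) _.
by rewrite -(real_normK (num_real t)) expr2 ltr_pM2r ?normr_gt0.
Qed.

(** A Gaussian profile damped to vanish outside the disc of radius r; it increases
    to the Gaussian with r. *)
Definition cut (r t : R) : R := pos_sqr (1 - t / r ^+ 2) * expR (- (alpha * t)).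
Definition cut' (r t : R) : R :=
  - (2 / r ^+ 2 * Num.max 0 (1 - t / r ^+ 2) + alpha * pos_sqr (1 - t / r ^+ 2)) *
    expR (- (alpha * t)).

Lemma cont_max0 (T : topologicalType) (f : T -> R) :
  continuous f -> continuous (fun x => Num.max 0 (f x)).
Proof.
move=> cf; rewrite (_ : (fun _ => _) = (fun x => (f x + `|f x|) * 2^-1)); first by cont.
apply/funext => x; case: (leP 0 (f x)) => h; first by rewrite ger0_norm//; field.
by rewrite ltr0_norm//; field.
Qed.

Lemma cut_radial (r : R) : 0 < r -> radial_cutoff (cut r) (cut' r) r.
Proof.
move=> r0; split => //.
- move=> t; rewrite /cut.
  have h : is_derive t 1 (fun t => pos_sqr (1 - t / r ^+ 2))
      (- (r ^+ 2)^-1 * (2 * Num.max 0 (1 - t / r ^+ 2))).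
    notypeclasses refine (@der_comp _ pos_sqr (fun t => 1 - t / r ^+ 2) _ _ _ (der_pos_sqr _) _).
    by der_ring.
  by notypeclasses refine (@der_eq _ _ _ _ _ _ _); [der|rewrite /cut' /=; field; rewrite gt_eqF].
- rewrite /cut' /pos_sqr; cont; apply: cont_max0; cont.
- move=> t ht; rewrite /cut /cut' /pos_sqr.
  have -> : Num.max 0 (1 - t / r ^+ 2) = 0.
    by apply/max_idPl; rewrite subr_le0 ler_pdivlMr ?exprn_gt0// mul1r.
  by rewrite expr0n /= !(mulr0, mul0r, addr0, oppr0).
Qed.

Lemma cut_ge0 r t : 0 <= cut r t.
Proof. by rewrite mulr_ge0 ?expR_ge0// sqr_ge0. Qed.

Lemma cut_le r t : 0 <= t -> cut r t <= expR (- (alpha * t)).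
Proof.
move=> t0; rewrite /cut ler_piMl ?expR_ge0// /pos_sqr.
have h : t / r ^+ 2 >= 0 by rewrite divr_ge0// sqr_ge0.
rewrite expr_le1//; first by rewrite ge_max ler01 gerBl.
by rewrite le_max lexx.
Qed.

Lemma cut_cvg (t : R) : cut n.+1%:R t @[n --> \oo] --> expR (- (alpha * t)).
Proof.
have cp : continuous pos_sqr by rewrite /pos_sqr; cont; apply: cont_max0; cont.
have H : (fun n => 1 - t / n.+1%:R ^+ 2 : R) @ \oo --> (1 - t * (0 * 0) : R).
  apply: cvgB; first exact: cvg_cst; apply: cvgM; first exact: cvg_cst.
  under eq_fun do rewrite expr2 invfM.
  by apply: cvgM; exact: cvg_harmonic.
have := cvg_comp _ pos_sqr H (cp _).
rewrite !mulr0 subr0 {2}/pos_sqr (elimT max_idPr) ?ler01// expr1n => H1.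
rewrite -[X in _ --> X]mul1r; apply: cvgM; first exact: H1.
exact: cvg_cst.
Qed.

Lemma continuous_cut (r : R) (z : R * R) : 0 < r ->
  continuous (fun w : R * R => cut r (sqn (w - z))).
Proof.
move=> r0; have [_ dk _ _] := cut_radial r0.
by apply: cont_comp (der_cont dk) _; rewrite /sqn /=; cont.
Qed.

(** The truncated mean value property of [holo_mean_cutoff] with the radius of the
    cutoff tending to infinity. *)
Lemma holo_mean_gauss (P Q p q : R * R -> R) (z : R * R) : holo P Q p q ->
  intble (fun w => P w * gauss alpha z w) ->
  \int[area R]_w (P w * gauss alpha z w) = P z * (pi / alpha).
Proof.
move=> hol iP; have [cP _] := holo_cont hol.
have n0 n : 0 < n.+1%:R :> R by [].
have E n := holo_mean_cutoff z hol (cut_radial (n0 n)).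
have L (f : R * R -> R) : continuous f -> intble (fun w => f w * gauss alpha z w) ->
    \int[area R]_w (f w * cut n.+1%:R (sqn (w - z))) @[n --> \oo] -->
    \int[area R]_w (f w * gauss alpha z w).
  move=> cf if_.
  apply: (@Rint_dominated _ (plane R) R (area R)
    (fun n w => f w * cut n.+1%:R (sqn (w - z))) (fun w => f w * gauss alpha z w)
    (fun w => `|f w * gauss alpha z w|) _ (intble_norm if_) _ _).2.
  - move=> n; apply: continuous_plane_measurable; apply: contM => //.
    exact: continuous_cut.
  - by move=> w; apply: cvgM; [exact: cvg_cst|exact: cut_cvg].
  - move=> n w; rewrite (normrM (f w)) (normrM (f w)); apply: ler_wpM2l => //.
    rewrite (ger0_norm (cut_ge0 _ _)) (ger0_norm (gauss_ge0 _ _ _)).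
    by apply: cut_le => //; exact: sqn_ge0.
have L1 := L _ cP iP.
have i1 : intble (fun w => 1 * gauss alpha z w) by apply: intbleZ; exact: integrable_gauss.
have := L (fun=> 1) (@contC R _ 1) i1.
have -> : \int[area R]_w (1 * gauss alpha z w) = pi / alpha.
  under eq_Rintegral do rewrite mul1r.
  by rewrite /Rintegral integral_gauss.
move=> /(cvgM (cvg_cst (P z))) L2.
have EE : (fun n => \int[area R]_w (P w * cut n.+1%:R (sqn (w - z)))) =
    cst (P z) \* (fun n => \int[area R]_w (1 * cut n.+1%:R (sqn (w - z)))).
  apply/funext => n; rewrite /= /cst/= E.
  by under [X in _ = _ * X]eq_Rintegral do rewrite mul1r.
rewrite EE in L1.
by rewrite -(cvg_lim (@Rhausdorff R) L1) (cvg_lim (@Rhausdorff R) L2).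
Qed.

(** The mean value property of $(u+iv)^2$ bounds the weighted norm of v by
    that of u; the cutoff makes all the integrals finite beforehand. *)
Lemma holo_conjugate_L2 (u v p q : R * R -> R) (z : R * R) : holo u v p q ->
  intble (fun w => u w ^+ 2 * gauss alpha z w) ->
  intble (fun w => v w ^+ 2 * gauss alpha z w).
Proof.
move=> hol iu; have [cu cv] := holo_cont hol.
have h2 := holoM hol hol.
have n0 n : 0 < n.+1%:R :> R by [].
have E n := holo_mean_cutoff z h2 (cut_radial (n0 n)).
have supp n (g : R * R -> R) : continuous g -> intble (fun w => g w * cut n.+1%:R (sqn (w - z))).
  move=> cg; apply: (intble_compact_support (z := z) (L := n.+1%:R)).
    by apply: contM => //; exact: continuous_cut.
  have [L0 _ _ k0] := cut_radial (n0 n).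
  by move=> w /(sqn_large L0)/k0[-> _]; rewrite mulr0.
pose I := \int[area R]_w (u w ^+ 2 * gauss alpha z w).
(* The mean of u^2 - v^2 is (u^2 - v^2)(z), hence that of v^2 is at most this. *)
pose B := I + v z ^+ 2 * (pi / alpha).
have cu2 : continuous (fun w => u w ^+ 2) by cont.
have cv2 : continuous (fun w => v w ^+ 2) by cont.
have bound n : (\int[area R]_w (v w ^+ 2 * cut n.+1%:R (sqn (w - z)))%:E <= B%:E)%E.
  rewrite EFin_Rint; last exact: supp.
  rewrite lee_fin.
  have := E n.
  rewrite (_ : \int[_]_w _ = \int[area R]_w (u w ^+ 2 * cut n.+1%:R (sqn (w - z)) -
       v w ^+ 2 * cut n.+1%:R (sqn (w - z)))); last first.
    by apply: eq_Rintegral => w _; ring.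
  rewrite RintB; [|exact: supp|exact: supp].
  set J := \int[area R]_w cut _ _ => e.
  have J0 : 0 <= J by apply: Rintegral_ge0 => w _; exact: cut_ge0.
  have J1 : J <= pi / alpha.
    have -> : pi / alpha = \int[area R]_w gauss alpha z w by rewrite /Rintegral integral_gauss.
    apply: Rint_le; [|exact: integrable_gauss|].
      have := supp n (fun=> 1) (@contC R _ 1); congr (_.-integrable _ _).
      by apply/funext => w /=; rewrite mul1r.
    by move=> w; apply: cut_le; exact: sqn_ge0.
  have K : \int[area R]_w (u w ^+ 2 * cut n.+1%:R (sqn (w - z))) <= I.
    apply: Rint_le => //; first exact: supp.
    by move=> w; rewrite ler_wpM2l ?sqr_ge0//; apply: cut_le; exact: sqn_ge0.
  have : v z ^+ 2 * J <= v z ^+ 2 * (pi / alpha) by rewrite ler_wpM2l// sqr_ge0.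
  have : 0 <= u z ^+ 2 * J by rewrite mulr_ge0// sqr_ge0.
  rewrite /B; have -> : u z ^+ 2 * J = (u z * u z - v z * v z) * J + v z ^+ 2 * J by ring.
  by move: e; lra.
apply: intble_ge0.
- apply: continuous_plane_measurable; apply: contM => //; exact: continuous_gauss.
- by move=> w; rewrite mulr_ge0 ?sqr_ge0 ?gauss_ge0.
apply: (@le_lt_trans _ _ B%:E); last by rewrite ltry.
apply: (@Rint_Fatou _ (plane R) R (area R)
  (fun n w => v w ^+ 2 * cut n.+1%:R (sqn (w - z))) (fun w => v w ^+ 2 * gauss alpha z w)) => //.
- by move=> n; apply: continuous_plane_measurable; apply: contM => //; exact: continuous_cut.
- by move=> n w; rewrite mulr_ge0 ?sqr_ge0 ?cut_ge0.
- by move=> w; apply: cvgM; [exact: cvg_cst|exact: cut_cvg].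
Qed.

End GaussianMean.

(** * Harmonic conjugates *)

Section HarmonicConjugate.
Context {R : realType}.
Notation leb := (@lebesgue_measure R).

Lemma cont_comp2 (T : topologicalType) (F : R * R -> R) (a b : T -> R) :
  continuous F -> continuous a -> continuous b -> continuous (fun p => F (a p, b p)).
Proof.
move=> cF ca cb p; apply: (cvg_comp (fun p => (a p, b p)) F); last exact: cF.
exact: (cont_pair ca cb).
Qed.

Lemma intble01 (f : R -> R) : continuous f -> leb.-integrable `[0, 1] (EFin \o f).
Proof.
move=> cf; apply: continuous_compact_integrable; first exact: segment_compact.
exact: continuous_subspaceT.
Qed.

Lemma der_under_integral01 (f f' : R -> R -> R) (x : R) :
  (forall t s : R, is_derive t 1 (f ^~ s) (f' t s)) ->
  (forall t, continuous (f t)) -> continuous (fun p : R * R => f' p.1 p.2) ->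
  is_derive x 1 (fun t => \int[leb]_(s in `[0, 1]) f t s)
    (\int[leb]_(s in `[0, 1]) f' x s).
Proof.
move=> df cf cf'.
have d1 t s : partial1of2 f t s = f' t s by rewrite partial1of2E; have [_] := df t s.
have [M HM] := continuous_locally_bounded cf' (`|x| + 1).
pose G (s : R) : R := `|M|.
have Ia : (`]x - 1, x + 1[%classic) x by rewrite /= in_itv/=; apply/andP; split; lra.
have i1 t : `]x - 1, x + 1[%classic t -> leb.-integrable `[0, 1] (EFin \o f t).
  by move=> _; exact: intble01.
have i2 t s : `]x - 1, x + 1[%classic t -> `[0, 1]%classic s -> derivable (f ^~ s) t 1.
  by move=> _ _; have [] := df t s.
have i3 s : 0 <= G s by exact: normr_ge0.
have i4 : leb.-integrable `[0, 1] (EFin \o G) by apply: intble01; exact: contC.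
have i5 t s : `]x - 1, x + 1[%classic t -> `[0, 1]%classic s -> `|partial1of2 f t s| <= G s.
  rewrite /= !in_itv/= => /andP[t1 t2] /andP[s1 s2]; rewrite d1.
  apply: le_trans (ler_norm M); apply: (HM (t, s)) => /=.
    have := ler_normD (t - x) x; rewrite subrK => h; apply: le_trans h _.
    by rewrite addrC lerD2l ler_norml; apply/andP; split; lra.
  by rewrite ger0_norm//; have := normr_ge0 x; lra.
have m01 : measurable (`[0, 1]%classic : set R) by exact: measurable_itv.
split; first exact: (@derivable_under_integral R _ (measurableTypeR R) leb f _ m01 _ _ _ Ia i1 i2 G i3 i4 i5).
rewrite -derive1E (@differentiation_under_integral R _ (measurableTypeR R) leb f _ m01 _ _ _ Ia i1 i2 G i3 i4 i5).
by apply: eq_Rintegral => s _; rewrite d1.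
Qed.

Lemma Rint01 (F f : R -> R) : (forall x : R, is_derive x 1 F (f x)) -> continuous f ->
  \int[leb]_(s in `[0, 1]) f s = F 1 - F 0.
Proof. by move=> Ff cf; rewrite /Rintegral (FTC ltr01 Ff cf). Qed.

Lemma has_grad_ray0 (u ux uy : R * R -> R) (x y s : R) : has_grad u ux uy ->
  continuous ux -> continuous uy ->
  is_derive s 1 (fun s => u (s * x, s * y)) (x * ux (s * x, s * y) + y * uy (s * x, s * y)).
Proof.
move=> g cx cy; have := has_grad_ray (0, 0) (x, y) s g cx cy.
rewrite /= !add0r; congr is_derive.
by apply/funext => t; rewrite !add0r.
Qed.

(** The conjugate is the primitive along rays of the differential form
    $-u_y\,dx+u_x\,dy$, which is closed because u is harmonic. *)
Lemma harmonic_conjugate (u : R * R -> R) : harmonic_real u ->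
  exists v, holo u v (dx u) (fun w => - dy u w).
Proof.
move=> [[/C1_has_grad[gu cx cy] /C1_has_grad[gx cxx cxy] /C1_has_grad[gy cyx cyy]] H].
set ux := dx u in gu cx gx cxx cxy H *; set uy := dy u in gu cy gy cyx cyy H *.
clearbody ux uy.
have [gx1 gx2] := (has_gradP _ _ _).1 gx; have [gy1 gy2] := (has_gradP _ _ _).1 gy.
pose f (x y s : R) : R := - uy (s * x, s * y) * x + ux (s * x, s * y) * y.
pose v (w : R * R) : R := \int[leb]_(s in `[0, 1]) f w.1 w.2 s.
exists v; split => //; last exact: contN.
  by split; [exact: gu.1|move=> p; rewrite opprK; exact: gu.2].
have slope (g : R -> R) (a s t : R) : is_derive (s * t) 1 g a ->
    is_derive t 1 (fun t => g (s * t)) (s * a).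
  move=> ga; notypeclasses refine (@der_comp _ g (fun t => s * t) _ _ _ ga _).
  by der_ring.
apply/has_gradP; split=> x y; rewrite /v /=.
- pose f' (t s : R) := - uy (s * t, s * y) - s * t * dx uy (s * t, s * y) +
    s * y * dx ux (s * t, s * y).
  have df (t s : R) : is_derive t 1 (fun t => f t y s) (f' t s).
    have h1 := slope (fun a => uy (a, s * y)) _ s t (gy1 (s * t) (s * y)).
    have h2 := slope (fun a => ux (a, s * y)) _ s t (gx1 (s * t) (s * y)).
    by rewrite /f /f'; der_ring.
  have e := der_under_integral01 x df.
  have -> : - uy (x, y) = \int[leb]_(s in `[0, 1]) f' x s.
    have D (s : R) : is_derive s 1 (fun s => - (s * uy (s * x, s * y))) (f' x s).
      have h := has_grad_ray0 x y s gy cyx cyy.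
      notypeclasses refine (@der_eq _ _ _ _ _ _ _); [der|].
      rewrite /f'; have := H (s * x, s * y).
      by move=> /eqP; rewrite addr_eq0 => /eqP ->; ring.
    have c : continuous (f' x) by rewrite /f'; cont; apply: cont_comp2; cont.
    by rewrite (Rint01 D c) mul0r !mul1r oppr0 subr0.
  apply: e; last by rewrite /f'; cont; apply: cont_comp2; cont.
  by move=> t; rewrite /f; cont; apply: cont_comp2; cont.
- pose f' (t s : R) := - (s * x * dy uy (s * x, s * t)) + ux (s * x, s * t) +
    s * t * dy ux (s * x, s * t).
  have df (t s : R) : is_derive t 1 (fun t => f x t s) (f' t s).
    have h1 := slope (fun a => uy (s * x, a)) _ s t (gy2 (s * x) (s * t)).
    have h2 := slope (fun a => ux (s * x, a)) _ s t (gx2 (s * x) (s * t)).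
    by rewrite /f /f'; der_ring.
  have e := der_under_integral01 y df.
  have -> : ux (x, y) = \int[leb]_(s in `[0, 1]) f' y s.
    have D (s : R) : is_derive s 1 (fun s => s * ux (s * x, s * y)) (f' y s).
      have h := has_grad_ray0 x y s gx cxx cxy.
      notypeclasses refine (@der_eq _ _ _ _ _ _ _); [der|].
      rewrite /f'; have := H (s * x, s * y).
      by move=> /eqP; rewrite addr_eq0 => /eqP ->; ring.
    have c : continuous (f' y) by rewrite /f'; cont; apply: cont_comp2; cont.
    by rewrite (Rint01 D c) mul0r !mul1r subr0.
  apply: e; last by rewrite /f'; cont; apply: cont_comp2; cont.
  by move=> t; rewrite /f; cont; apply: cont_comp2; cont.
Qed.

End HarmonicConjugate.

(** * The reproducing formula *)

Section Reproducing.
Context {R : realType} (alpha : R) (alpha0 : 0 < alpha).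
Implicit Types (u : R * R -> R) (nu : {measure set (plane R) -> \bar R}).
Notation aintble f := ((area R).-integrable [set: plane R] (EFin \o (f : plane R -> R))).
Notation wgt := (gauss alpha (0, 0)).

Lemma sqn0 (w : R * R) : sqn (w - (0, 0)) = sqn w.
Proof. by rewrite /sqn /= !subr0. Qed.

Lemma wgtE (w : R * R) : wgt w = expR (- (alpha * sqn w)).
Proof. by rewrite /gauss sqn0. Qed.

Definition weighted_L2 nu u := measurable_fun [set: plane R] (u : plane R -> R) /\
  nu.-integrable [set: plane R] (EFin \o (fun w : plane R => u w ^+ 2 * wgt w)).

(** The square root of the weight: multiplication by it turns weighted norms into
    plain ones. *)
Definition half_wgt (w : R * R) : R := gauss (alpha / 2) (0, 0) w.

Lemma half_wgt_sq w : half_wgt w ^+ 2 = wgt w.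
Proof. by rewrite /half_wgt gauss_sq (_ : 2 * (alpha / 2) = alpha)//; field. Qed.

Lemma half_wgt_gt0 w : 0 < half_wgt w. Proof. exact: expR_gt0. Qed.

Lemma weighted_L2_prod nu u v : weighted_L2 nu u -> weighted_L2 nu v ->
  nu.-integrable [set: plane R] (EFin \o (fun w : plane R => u w * v w * wgt w)).
Proof.
move=> [mu iu] [mv iv].
have mh : measurable_fun [set: plane R] (half_wgt : plane R -> R).
  by exact: measurable_gauss.
have := @intble_sqM _ (plane R) R nu (fun w => u w * half_wgt w) (fun w => v w * half_wgt w)
  (measurable_funM mu mh) (measurable_funM mv mh).
have E (f : R * R -> R) : (fun w : plane R => (f w * half_wgt w) ^+ 2) = (fun w => f w ^+ 2 * wgt w).
  by apply/funext => w; rewrite exprMn half_wgt_sq.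
rewrite !E => /(_ iu iv); congr (nu.-integrable _ _); apply/funext => w /=.
by congr (_%:E); rewrite -half_wgt_sq; ring.
Qed.

Lemma weighted_L2_CS nu u v : weighted_L2 nu u -> weighted_L2 nu v ->
  (\int[nu]_w (u w * v w * wgt w)) ^+ 2 <=
  (\int[nu]_w (u w ^+ 2 * wgt w)) * (\int[nu]_w (v w ^+ 2 * wgt w)).
Proof.
move=> [mu iu] [mv iv].
have mh : measurable_fun [set: plane R] (half_wgt : plane R -> R).
  by exact: measurable_gauss.
have := @Cauchy_Schwarz _ (plane R) R nu (fun w => u w * half_wgt w) (fun w => v w * half_wgt w)
  (measurable_funM mu mh) (measurable_funM mv mh).
have E (f : R * R -> R) : (fun w : plane R => (f w * half_wgt w) ^+ 2) = (fun w => f w ^+ 2 * wgt w).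
  by apply/funext => w; rewrite exprMn half_wgt_sq.
rewrite !E => /(_ iu iv); congr (_ ^+ 2 <= _); apply: eq_Rintegral => w _.
by rewrite -half_wgt_sq; ring.
Qed.

Lemma weighted_L2_lin nu u v (a b : R) : weighted_L2 nu u -> weighted_L2 nu v ->
  weighted_L2 nu (fun w => a * u w + b * v w).
Proof.
move=> U V; have I := weighted_L2_prod U V; have [mu iu] := U; have [mv iv] := V; split.
  by apply: measurable_funD; apply: measurable_funM.
have := intbleD (intbleD (intbleZ (a ^+ 2) iu) (intbleZ (2 * a * b) I)) (intbleZ (b ^+ 2) iv).
by congr (nu.-integrable _ _); apply/funext => w /=; congr (_%:E); ring.
Qed.

(** Completing the square: the squared kernel against the weight is a Gaussian
    centred at z. *)
Lemma expR_wgt (z w : R * R) :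
  expR (alpha * (z.1 * w.1 + z.2 * w.2)) ^+ 2 * wgt w =
  expR (alpha * sqn z) * gauss alpha z w.
Proof. by rewrite wgtE /gauss /sqn /= expr2 -!expRD; congr expR; ring. Qed.

Lemma kernel_L2 nu (f : R * R -> R) (z : R * R) : continuous f ->
  (forall w, `|f w| <= expR (alpha * (z.1 * w.1 + z.2 * w.2))) ->
  nu.-integrable [set: plane R] (EFin \o (gauss alpha z : plane R -> R)) ->
  weighted_L2 nu f.
Proof.
move=> cf fle ig; split; first exact: continuous_plane_measurable.
apply: (intble_le _ (intbleZ (expR (alpha * sqn z)) ig)).
  by apply: continuous_plane_measurable; apply: contM; [cont|exact: continuous_gauss].
move=> w; rewrite -expR_wgt normrM (ger0_norm (gauss_ge0 _ _ _)).
apply: ler_wpM2r; first exact: gauss_ge0.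
by rewrite normrX; apply: lerXn2r; rewrite ?nnegrE ?expR_ge0.
Qed.

Lemma area_KC_L2 z : weighted_L2 (area R) (KC alpha z).
Proof.
apply: (@kernel_L2 _ _ z); [exact: continuous_KC|exact: KC_le|exact: integrable_gauss].
Qed.

Lemma area_KS_L2 z : weighted_L2 (area R) (KS alpha z).
Proof.
apply: (@kernel_L2 _ _ z); [exact: continuous_KS|exact: KS_le|exact: integrable_gauss].
Qed.

(** The kernel of evaluation at z on the harmonic Fock space is
    $\frac{\alpha}{\pi}(H_z-1)$. The formula below is that of $H_z$: the constants lie
    both in the holomorphic and in the antiholomorphic half of the space, so
    they are counted twice and the value at the origin is added. *)
Definition reproduced u := weighted_L2 (area R) u /\
  forall z, u z + u (0, 0) = 2 * alpha / pi * \int[area R]_w (u w * KC alpha z w * wgt w).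

(** Write u as the real part of a holomorphic G. The mean of $GK_z$ against the
    weight is G(0), by the mean value property at the origin; that of
    $G\overline{K_z}$ is G(z), because the weight times $\overline{K_z}$ is the Gaussian
    centred at z times the holomorphic function $e^{-\alpha\bar z(w-z)}$. The sum of the real
    parts only involves u. *)
Lemma harmonic_reproduced u : harmonic_real u -> weighted_L2 (area R) u -> reproduced u.
Proof.
move=> hu U; split => // z.
have [v hol] := harmonic_conjugate hu.
have [cu cv] := holo_cont hol.
have V : weighted_L2 (area R) v.
  split; first exact: continuous_plane_measurable.
  exact: (holo_conjugate_L2 alpha0 hol U.2).
have C := area_KC_L2 z; have S := area_KS_L2 z.
have UC := weighted_L2_prod U C; have VS := weighted_L2_prod V S.
have hK := holo_exp alpha z (0, 0).
have hK' := holo_exp (- alpha) z z.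
have E1 : \int[area R]_w (u w * KC alpha z w * wgt w - v w * KS alpha z w * wgt w) =
    u (0, 0) * (pi / alpha).
  have := holo_mean_gauss alpha0 (z := (0, 0)) (holoM hol hK).
  set f := fun w : plane R => (_ : R).
  have -> : f = fun w => u w * KC alpha z w * wgt w - v w * KS alpha z w * wgt w.
    by apply/funext => w; rewrite /f /KC /KS /= !subr0; ring.
  move=> -> /=; last exact: intbleB.
  by rewrite !subr0 !mulr0 add0r subrr mulr0 expR0 cos0 sin0 !mulr0 subr0 mulr1 mulr1.
have E2 : \int[area R]_w (u w * KC alpha z w * wgt w + v w * KS alpha z w * wgt w) =
    u z * (pi / alpha).
  have := holo_mean_gauss alpha0 (z := z) (holoM hol hK').
  set f := fun w : plane R => (_ : R).
  have -> : f = fun w => u w * KC alpha z w * wgt w + v w * KS alpha z w * wgt w.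
    apply/funext => w; rewrite /f /KC /KS /=.
    have -> : - alpha * (z.1 * (w.2 - z.2) - z.2 * (w.1 - z.1)) =
       - (alpha * (z.1 * w.2 - z.2 * w.1)) by ring.
    rewrite cosN sinN; set c := cos _; set s := sin _.
    have -> : expR (alpha * (z.1 * w.1 + z.2 * w.2)) * c = c * expR (alpha * (z.1 * w.1 + z.2 * w.2)) by ring.
    have -> : expR (alpha * (z.1 * w.1 + z.2 * w.2)) * s = s * expR (alpha * (z.1 * w.1 + z.2 * w.2)) by ring.
    have e : expR (- alpha * (z.1 * (w.1 - z.1) + z.2 * (w.2 - z.2))) * gauss alpha z w =
      expR (alpha * (z.1 * w.1 + z.2 * w.2)) * wgt w.
      by rewrite wgtE /gauss /sqn /= -!expRD; congr expR; ring.
    rewrite -!(mulrA _ _ (wgt w)) -e; ring.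
  move=> -> /=; last exact: intbleD.
  by rewrite !subrr !mulr0 subrr addr0 mulr0 expR0 cos0 sin0 !mulr0 subr0 mulr1 mulr1.
rewrite RintB// in E1; rewrite RintD// in E2.
have p0 : pi != 0 :> R by rewrite gt_eqF// pi_gt0.
have a0 : alpha != 0 by rewrite gt_eqF.
apply: (@mulIf _ (pi / alpha)); first by rewrite mulf_neq0// invr_eq0.
rewrite mulrDl -E1 -E2.
have e (I p a : R) : p != 0 -> a != 0 -> 2 * a / p * I * (p / a) = 2 * I.
  by move=> hp ha; field; rewrite hp ha.
rewrite e//; ring.
Qed.

(** As $|u|e^{r|w|}\le u^2+e^{2r|w|}$, it is enough that the weight times an
    exponential is bounded by a multiple of its own square root. *)
Lemma exp_integrable_wgt nu u (k : R) : weighted_L2 nu u ->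
  nu.-integrable [set: plane R] (EFin \o (half_wgt : plane R -> R)) ->
  exp_integrable nu (fun w => k * (u w * wgt w)) (fun=> 0).
Proof.
move=> [mu iu] ih.
have mw : measurable_fun [set: plane R] (wgt : plane R -> R).
  by exact: measurable_gauss.
have m1 : measurable_fun [set: plane R] (fun w : plane R => k * (u w * wgt w)).
  by apply: measurable_funM => //; apply: measurable_funM.
split => // r.
pose C := expR (4 * r ^+ 2 / alpha).
apply: (intble_le _ (intbleZ (`|k|) (intbleD iu (intbleZ C ih)))).
  apply: measurable_cont_mul; first by cont.
  by apply: measurable_funD; apply: measurableT_comp.
move=> w; rewrite normr0 addr0; set s := expR _.
have s0 : 0 <= s by exact: expR_ge0.
rewrite normrM normr_id (ger0_norm s0) (normrM k) (normrM (u w)) (ger0_norm (gauss_ge0 _ _ _)).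
rewrite -mulrA; apply: ler_wpM2l => //.
have w0 := gauss_ge0 alpha (0, 0) w.
have : `|u w| * wgt w * s <= u w ^+ 2 * wgt w + wgt w * s ^+ 2.
  have : `|u w| * s <= u w ^+ 2 + s ^+ 2.
    rewrite -(real_normK (num_real (u w))); have := sqr_ge0 (`|u w| - s).
    by have := normr_ge0 (u w); nra.
  by move=> /(ler_wpM2l w0); rewrite mulrDr; congr (_ <= _); ring.
move=> h; apply: le_trans h _; rewrite lerD2l.
rewrite /C /s /half_wgt /gauss sqn0 expr2 -!expRD ler_expR /sqn.
rewrite -(real_normK (num_real w.1)) -(real_normK (num_real w.2)).
move: `|w.1| `|w.2| => a b.
rewrite -(ler_pM2l alpha0) -subr_ge0.
have -> : alpha * (4 * r ^+ 2 / alpha + - (alpha / 2 * (a ^+ 2 + b ^+ 2))) -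
    alpha * (- (alpha * (a ^+ 2 + b ^+ 2)) + (r * (a + b) + r * (a + b))) =
    2^-1 * ((alpha * a - 2 * r) ^+ 2 + (alpha * b - 2 * r) ^+ 2).
  by field; rewrite gt_eqF.
by rewrite mulr_ge0// addr_ge0 ?sqr_ge0.
Qed.

Lemma area_half_wgt : aintble half_wgt.
Proof. by apply: integrable_gauss; rewrite divr_gt0. Qed.

(** The reproducing formula writes u, up to a constant, as an integral of the
    kernel. *)
Lemma reproduced_harmonic u : reproduced u -> harmonic_real u.
Proof.
move=> [U H].
rewrite (_ : u = (fun z => Kint alpha (area R) (fun w => 2 * alpha / pi * (u w * wgt w))
    (fun=> 0) z - u (0, 0))).
  by apply: Kint_harmonic; apply: exp_integrable_wgt => //; exact: area_half_wgt.
apply/funext => z; rewrite -[LHS](addrK (u (0, 0))) H; congr (_ - _).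
rewrite /Kint -RintZ; last by apply: weighted_L2_prod => //; exact: area_KC_L2.
by apply: eq_Rintegral => w _; ring.
Qed.

Lemma reproduced_lin u v (a b : R) : reproduced u -> reproduced v ->
  reproduced (fun w => a * u w + b * v w).
Proof.
move=> [U HU] [V HV]; split; first exact: weighted_L2_lin.
move=> z; have C := area_KC_L2 z.
transitivity (a * (u z + u (0, 0)) + b * (v z + v (0, 0))); first by ring.
rewrite HU HV.
transitivity (2 * alpha / pi * (a * \int[area R]_w (u w * KC alpha z w * wgt w) +
    b * \int[area R]_w (v w * KC alpha z w * wgt w))); first by ring.
have UC := weighted_L2_prod U C; have VC := weighted_L2_prod V C.
congr (_ * _); rewrite -RintZ// -[X in _ + X]RintZ// -RintD; [|exact: intbleZ|exact: intbleZ].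
by apply: eq_Rintegral => w _; ring.
Qed.

(** The span of the two parts of the kernel is stable under both partial
    derivatives. *)
Lemma KC_harmonic z : harmonic_real (KC alpha z) /\ harmonic_real (KS alpha z).
Proof.
pose C := KC alpha z; pose S := KS alpha z.
have cC : continuous C by exact: continuous_KC.
have cS : continuous S by exact: continuous_KS.
pose L (a b : R) w := a * C w + b * S w.
have cL a b : continuous (L a b) by rewrite /L; cont.
have gL (a b : R) : has_grad (L a b) (L (alpha * (a * z.1 - b * z.2)) (alpha * (a * z.2 + b * z.1)))
    (L (alpha * (a * z.2 + b * z.1)) (- (alpha * (a * z.1 - b * z.2)))).
  by apply/has_gradP; split=> x y; rewrite /L /C /S /KC /KS /=; der_ring.
have hL a b : harmonic_real (L a b).
  apply: (harmonic_grads (gL a b) (gL _ _) (gL _ _)) => // p.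
  by rewrite /L; ring.
have -> : KC alpha z = L 1 0 by apply/funext => w; rewrite /L mul1r mul0r addr0.
have -> : KS alpha z = L 0 1 by apply/funext => w; rewrite /L mul1r mul0r add0r.
by split.
Qed.

Lemma reproduced_KC z : reproduced (KC alpha z).
Proof. by apply: harmonic_reproduced; [have [] := KC_harmonic z|exact: area_KC_L2]. Qed.

Lemma reproduced_KS z : reproduced (KS alpha z).
Proof. by apply: harmonic_reproduced; [have [] := KC_harmonic z|exact: area_KS_L2]. Qed.

End Reproducing.

(** * Real sequences *)

Section SequenceLimits.
Context {R : realType}.
Implicit Types (f g : nat -> R) (a b c : R).

Lemma seq_cvgD f g a b : f n @[n --> \oo] --> a -> g n @[n --> \oo] --> b ->
  f n + g n @[n --> \oo] --> a + b.
Proof. by move=> fa gb; exact: cvgD. Qed.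

Lemma seq_cvgZ c f a : f n @[n --> \oo] --> a -> c * f n @[n --> \oo] --> c * a.
Proof. by move=> fa; apply: cvgM => //; exact: cvg_cst. Qed.

Lemma seq_cvg_unique f a b : f n @[n --> \oo] --> a -> f n @[n --> \oo] --> b -> a = b.
Proof. by move=> fa fb; rewrite -(cvg_lim (@Rhausdorff R) fa) (cvg_lim (@Rhausdorff R) fb). Qed.

Lemma seq_cvg0_le f g : (forall n, 0 <= f n <= g n) -> g n @[n --> \oo] --> 0 ->
  f n @[n --> \oo] --> 0.
Proof. by move=> fg g0; apply: (squeeze_cvgr _ (cvg_cst 0) g0); exact: nearW. Qed.

End SequenceLimits.

(** * Local estimates and limits of solutions *)

Section PointEstimates.
Context {R : realType} (alpha : R) (alpha0 : 0 < alpha).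
Implicit Types (u : R * R -> R) (z w : R * R).
Notation aintble f := ((area R).-integrable [set: plane R] (EFin \o (f : plane R -> R))).
Notation wgt := (gauss alpha (0, 0)).
Notation reproduced := (reproduced alpha).
Notation KC := (KC alpha).
Notation half_wgt := (half_wgt alpha).

Definition fock_sq u : R := \int[area R]_w (u w ^+ 2 * wgt w).

Lemma fock_sq_ge0 u : 0 <= fock_sq u.
Proof. by apply: Rintegral_ge0 => w _; rewrite mulr_ge0 ?sqr_ge0 ?gauss_ge0. Qed.

Lemma KC0 w : KC (0, 0) w = 1.
Proof. by rewrite /KC /= !mul0r addr0 subrr mulr0 expR0 cos0 mulr1. Qed.

Lemma gauss_le1 (c : R) z w : 0 <= c -> gauss c z w <= 1.
Proof.
move=> c0; rewrite /gauss -[leRHS]expR0 ler_expR oppr_le0 mulr_ge0//.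
exact: sqn_ge0.
Qed.

(** The formula at the origin, where the kernel is 1, eliminates the extra value. *)
Lemma reproduced_at u z : reproduced u ->
  u z = alpha / pi * \int[area R]_w (u w * (2 * KC z w - 1) * wgt w).
Proof.
move=> [U H]; have h0 := H (0, 0); have hz := H z.
have C := area_KC_L2 alpha0 z; have C0 := area_KC_L2 alpha0 (0, 0).
have I := weighted_L2_prod U C; have I0 := weighted_L2_prod U C0.
rewrite (_ : \int[_]_w _ = 2 * \int[area R]_w (u w * KC z w * wgt w) -
    \int[area R]_w (u w * KC (0, 0) w * wgt w)); last first.
  rewrite -RintZ// -RintB//; last exact: intbleZ.
  by apply: eq_Rintegral => w _; rewrite KC0; ring.
set A := \int[area R]_w _ in hz *; set B := \int[area R]_w _ in h0 *.
rewrite mulrBr.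
have -> : alpha / pi * (2 * A) = u z + u (0, 0) by rewrite hz; ring.
have -> : alpha / pi * B = u (0, 0).
  have : 2 * (alpha / pi * B) = 2 * u (0, 0).
    rewrite (_ : 2 * (alpha / pi * B) = 2 * alpha / pi * B); last by ring.
    by rewrite -h0; ring.
  by move/mulfI; apply.
by rewrite addrK.
Qed.

Lemma gauss_wgt_le z w : half_wgt z * half_wgt w <= gauss (alpha / 4) z w.
Proof.
rewrite /half_wgt /gauss !sqn0 -expRD ler_expR /sqn /=.
have := mulr_ge0 (ltW alpha0) (sqr_ge0 (w.1 + z.1)).
have := mulr_ge0 (ltW alpha0) (sqr_ge0 (w.2 + z.2)).
rewrite !sqrrD !mulrDr; lra.
Qed.

(** Through the square roots of the weight, $e^{\alpha\mathrm{Re}(\bar z w)}$ becomes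
    a Gaussian in z - w. *)
Lemma gauss_exp_half z w : expR (alpha * (z.1 * w.1 + z.2 * w.2)) * (half_wgt z * half_wgt w) =
  gauss (alpha / 2) z w.
Proof.
by rewrite /half_wgt /gauss !sqn0 -!expRD; congr expR; rewrite /sqn /=; field.
Qed.

Lemma reproduced_local_int u z : reproduced u ->
  aintble (fun w => u w ^+ 2 * wgt w * gauss (alpha / 4) z w).
Proof.
move=> [[mu iu] _]; apply: (intble_le _ iu).
  apply: measurable_cont_mul; first exact: continuous_gauss.
  by have := intble_meas iu.
move=> w; rewrite ger0_norm; last by rewrite mulr_ge0 ?gauss_ge0// mulr_ge0 ?sqr_ge0 ?gauss_ge0.
rewrite ler_piMr//; first by rewrite mulr_ge0 ?sqr_ge0 ?gauss_ge0.
by apply: gauss_le1; rewrite divr_ge0// ltW.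
Qed.

(** The kernel seen through the weights decays like a Gaussian in |z - w|, so
    the value at z is controlled by the mass of u near z. *)
Lemma reproduced_local u z : reproduced u ->
  u z ^+ 2 * wgt z <= 36 * alpha / pi *
    \int[area R]_w (u w ^+ 2 * wgt w * gauss (alpha / 4) z w).
Proof.
move=> ru; have [[mu iu] _] := ru.
pose F (w : plane R) : R := u w * (half_wgt w * gauss (alpha / 8) z w).
pose G (w : plane R) : R := (2 * KC z w - 1) * (half_wgt z * half_wgt w) * expR (alpha / 8 * sqn (w - z)).
have chw : continuous half_wgt by exact: continuous_gauss.
have mF : measurable_fun [set: plane R] F.
  by apply: measurable_cont_mul => //; apply: contM => //; exact: continuous_gauss.
have cG : continuous (G : R * R -> R).
  by rewrite /G; have cK := @continuous_KC R alpha z; rewrite /sqn /=; cont.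
have mG : measurable_fun [set: plane R] G by exact: continuous_plane_measurable.
have F2 w : F w ^+ 2 = u w ^+ 2 * wgt w * gauss (alpha / 4) z w.
  rewrite /F !exprMn half_wgt_sq gauss_sq (_ : 2 * (alpha / 8) = alpha / 4); last by field.
  by ring.
have Gle w : G w ^+ 2 <= 9 * gauss (alpha / 4) z w.
  have g0 := gauss_gt0 (alpha / 8) z w.
  have -> : 9 * gauss (alpha / 4) z w = (3 * gauss (alpha / 8) z w) ^+ 2.
    by rewrite exprMn gauss_sq (_ : 2 * (alpha / 8) = alpha / 4); [ring|field].
  rewrite -[X in X <= _](real_normK (num_real _)); apply: lerXn2r; rewrite ?nnegrE//.
    by rewrite mulr_ge0// ltW.
  have e : gauss (alpha / 4) z w * expR (alpha / 8 * sqn (w - z)) = gauss (alpha / 8) z w.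
    by rewrite /gauss -expRD; congr expR; field.
  rewrite /G normrM (ger0_norm (expR_ge0 _)) -e [X in _ <= X]mulrA; apply: ler_wpM2r; first exact: expR_ge0.
  have h0 : 0 <= half_wgt z * half_wgt w by rewrite mulr_ge0// ltW// half_wgt_gt0.
  rewrite normrM (ger0_norm h0).
  have k1 : `|2 * KC z w - 1| <= 2 * expR (alpha * (z.1 * w.1 + z.2 * w.2)) + 1.
    apply: le_trans (ler_normB _ _) _; rewrite normr1 lerD2r normrM ger0_norm//.
    by rewrite ler_pM2l// KC_le.
  apply: le_trans (ler_wpM2r h0 k1) _; rewrite mulrDl -mulrA gauss_exp_half mul1r.
  have := gauss_wgt_le z w.
  have : gauss (alpha / 2) z w <= gauss (alpha / 4) z w.
    rewrite /gauss ler_expR lerN2; apply: ler_wpM2r; first exact: sqn_ge0.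
    by have := alpha0; lra.
  lra.
have iG : aintble (fun w => G w ^+ 2).
  have a40 : 0 < alpha / 4 by rewrite divr_gt0.
  apply: (intble_le _ (intbleZ 9 (integrable_gauss z a40))).
    by apply: continuous_plane_measurable; cont.
  by move=> w; rewrite ger0_norm ?sqr_ge0.
have iF : aintble (fun w => F w ^+ 2).
  have := reproduced_local_int z ru; congr (_.-integrable _ _).
  by apply/funext => w /=; rewrite F2.
have CS := Cauchy_Schwarz mF mG iF iG.
have E : u z * half_wgt z = alpha / pi * \int[area R]_w (F w * G w).
  rewrite (reproduced_at z ru) -mulrA; congr (_ * _); rewrite mulrC -RintZ; last first.
    have := weighted_L2_prod (conj mu iu)
      (weighted_L2_lin 2 (- 1) (area_KC_L2 alpha0 z) (area_KC_L2 alpha0 (0, 0))).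
    congr (_.-integrable _ _); apply/funext => w /=; rewrite KC0; congr (_%:E); ring.
  apply: eq_Rintegral => w _; rewrite /F /G -half_wgt_sq.
  have e : gauss (alpha / 8) z w * expR (alpha / 8 * sqn (w - z)) = 1.
    by rewrite /gauss -expRD addNr expR0.
  rewrite -[LHS]mulr1 -[X in _ * X = _]e; ring.
rewrite -half_wgt_sq -exprMn E exprMn.
have IG : \int[area R]_w (G w ^+ 2) <= 36 * pi / alpha.
  have a40 : 0 < alpha / 4 by rewrite divr_gt0.
  have -> : 36 * pi / alpha = \int[area R]_w (9 * gauss (alpha / 4) z w).
    rewrite RintZ; last exact: integrable_gauss.
    by rewrite /Rintegral integral_gauss//=; field; rewrite gt_eqF.
  by apply: Rint_le => //; apply: intbleZ; exact: integrable_gauss.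
have F0 : 0 <= \int[area R]_w (F w ^+ 2) by apply: Rintegral_ge0 => w _; exact: sqr_ge0.
have ap : 0 <= (alpha / pi) ^+ 2 by exact: sqr_ge0.
apply: le_trans (ler_wpM2l ap (le_trans CS (ler_wpM2l F0 IG))) _.
have -> : \int[area R]_w (F w ^+ 2) =
    \int[area R]_w (u w ^+ 2 * wgt w * gauss (alpha / 4) z w).
  by apply: eq_Rintegral => w _; rewrite F2.
set J := \int[area R]_w _.
have e (p a : R) : p != 0 -> a != 0 -> (a / p) ^+ 2 * (J * (36 * p / a)) = 36 * a / p * J.
  by move=> hp ha; field; rewrite hp ha.
by rewrite e// gt_eqF// pi_gt0.
Qed.

Lemma reproduced_sup u z : reproduced u -> u z ^+ 2 * wgt z <= 36 * alpha / pi * fock_sq u.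
Proof.
move=> ru; apply: le_trans (reproduced_local z ru) _; have [[mu iu] _] := ru.
apply: ler_wpM2l; first by rewrite divr_ge0 ?pi_ge0// mulr_ge0// ltW.
apply: Rint_le => //; first exact: reproduced_local_int.
move=> w; rewrite ler_piMr//; first by rewrite mulr_ge0 ?sqr_ge0 ?gauss_ge0.
by apply: gauss_le1; rewrite divr_ge0// ltW.
Qed.

(** From $|w-z|^2\ge\frac12|z|^2-|w|^2$. *)
Lemma gauss_le_far (c : R) z w : 0 <= c ->
  gauss c z w <= expR (c * sqn w) * expR (- (c / 2 * sqn z)).
Proof.
move=> c0; rewrite /gauss -expRD ler_expR /sqn /=.
have := mulr_ge0 c0 (sqr_ge0 (2 * w.1 - z.1)); have := mulr_ge0 c0 (sqr_ge0 (2 * w.2 - z.2)).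
rewrite !sqrrB; lra.
Qed.

Lemma expN_cvg0 (c : R) (t : nat -> R) : 0 < c -> (forall n, n%:R <= t n) ->
  expR (- (c * t n)) @[n --> \oo] --> (0 : R).
Proof.
move=> c0 ht.
have H : (fun n : nat => c^-1 * n.+1%:R^-1 * (1 + c)) @ \oo --> (c^-1 * 0 * (1 + c) : R).
  by apply: cvgM; [apply: cvgM; [exact: cvg_cst|exact: cvg_harmonic]|exact: cvg_cst].
rewrite mulr0 mul0r in H.
apply: (seq_cvg0_le _ H) => n; rewrite expR_ge0/=.
have h : c * n%:R <= c * t n by rewrite ler_pM2l.
have n0 : 0 <= n%:R :> R by exact: ler0n.
rewrite expRN; apply: (@le_trans _ _ (1 + c * n%:R)^-1).
  have p : 0 < 1 + c * n%:R by rewrite ltr_pwDl// mulr_ge0// ltW.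
  rewrite lef_pV2 ?posrE ?expR_gt0//; apply: le_trans (expR_ge1Dx _); lra.
have n1 : 0 < n.+1%:R :> R by [].
rewrite -[X in _ <= X]mul1r -subr_ge0.
have -> : 1 * (c^-1 * n.+1%:R^-1 * (1 + c)) - (1 + c * n%:R)^-1 =
    (1 + c ^+ 2 * n%:R) / (c * n.+1%:R * (1 + c * n%:R)).
  rewrite -[n.+1%:R]natr1; field.
  rewrite (gt_eqF c0) natr1 (gt_eqF n1) andbT /=.
  by rewrite gt_eqF// ltr_pwDl// mulr_ge0// ltW.
rewrite divr_ge0//; first by rewrite addr_ge0// mulr_ge0// sqr_ge0.
by rewrite !mulr_ge0 ?addr_ge0 ?mulr_ge0// ltW.
Qed.

(** [reproduced_local] only sees the mass of u near the escaping points, and this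
    mass tends to 0 by dominated convergence. *)
Lemma reproduced_vanish u (z : nat -> R * R) : reproduced u -> (forall n, n%:R <= sqn (z n)) ->
  u (z n) ^+ 2 * wgt (z n) @[n --> \oo] --> 0.
Proof.
move=> ru hz; have [[mu iu] _] := ru.
have a4 : 0 < alpha / 4 by rewrite divr_gt0.
have L : \int[area R]_w (u w ^+ 2 * wgt w * gauss (alpha / 4) (z n) w) @[n --> \oo] -->
    \int[area R]_w (cst 0 w : R).
  apply: (@Rint_dominated _ (plane R) R (area R) (fun n w => u w ^+ 2 * wgt w * gauss (alpha / 4) (z n) w)
    (cst 0) (fun w => u w ^+ 2 * wgt w) _ iu _ _).2.
  - by move=> n; exact: (intble_meas (reproduced_local_int (z n) ru)).
  - move=> w; rewrite -[X in _ --> X](mulr0 (u w ^+ 2 * wgt w)); apply: cvgM; first exact: cvg_cst.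
    have H : (fun n => expR (alpha / 4 * sqn w) * expR (- (alpha / 4 / 2 * sqn (z n)))) @ \oo -->
        (expR (alpha / 4 * sqn w) * 0 : R).
      by apply: cvgM; [exact: cvg_cst|apply: expN_cvg0 => //; rewrite divr_gt0].
    rewrite mulr0 in H.
    apply: (seq_cvg0_le _ H) => n; rewrite gauss_ge0/=.
    by apply: gauss_le_far; exact: ltW.
  - move=> n w; rewrite ger0_norm; last by rewrite mulr_ge0 ?gauss_ge0// mulr_ge0 ?sqr_ge0 ?gauss_ge0.
    rewrite ler_piMr//; first by rewrite mulr_ge0 ?sqr_ge0 ?gauss_ge0.
    by apply: gauss_le1; exact: ltW.
rewrite Rintegral_cst ?mul0r// in L.
have L2 := seq_cvgZ (c := 36 * alpha / pi) L; rewrite mulr0 in L2.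
apply: (seq_cvg0_le _ L2) => n.
by rewrite mulr_ge0 ?sqr_ge0 ?gauss_ge0//=; exact: reproduced_local.
Qed.

(** Cauchy-Schwarz applied to the reproducing formula with
    $\mathrm{Re}(K_z-K_{z'})$, whose norm the same formula computes. *)
Lemma reproduced_equicontinuous u z z' : reproduced u ->
  (u z - u z') ^+ 2 <= 2 * alpha / pi * fock_sq u * (KC z z - 2 * KC z z' + KC z' z').
Proof.
move=> ru; have [U H] := ru.
have C := area_KC_L2 alpha0 z; have C' := area_KC_L2 alpha0 z'.
have D : weighted_L2 alpha (area R) (fun w => KC z w - KC z' w).
  have := weighted_L2_lin 1 (- 1) C C'; congr (weighted_L2 _ _ _).
  by apply/funext => w; ring.
have I := weighted_L2_prod U C; have I' := weighted_L2_prod U C'.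
have E : u z - u z' = 2 * alpha / pi * \int[area R]_w (u w * (KC z w - KC z' w) * wgt w).
  transitivity ((u z + u (0, 0)) - (u z' + u (0, 0))); first by ring.
  rewrite !H -mulrBr -RintB//; congr (_ * _); apply: eq_Rintegral => w _; ring.
have DD : 2 * alpha / pi * \int[area R]_w ((KC z w - KC z' w) ^+ 2 * wgt w) =
    KC z z - 2 * KC z z' + KC z' z'.
  have [_ h] := reproduced_KC alpha0 z; have [_ h'] := reproduced_KC alpha0 z'.
  have e1 := h z; have e2 := h z'; have e3 := h' z'.
  rewrite (KC_sym alpha z (0, 0)) KC0 in e1 e2; rewrite (KC_sym alpha z' (0, 0)) KC0 in e3.
  transitivity ((KC z z + 1) - 2 * (KC z z' + 1) + (KC z' z' + 1)); last by ring.
  rewrite e1 e2 e3.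
  have J1 := weighted_L2_prod C C; have J2 := weighted_L2_prod C C'.
  have J3 := weighted_L2_prod C' C'.
  rewrite (_ : \int[_]_w _ = \int[area R]_w ((KC z w * KC z w * wgt w - 2 * (KC z w * KC z' w * wgt w))
     + KC z' w * KC z' w * wgt w)); last first.
    by apply: eq_Rintegral => w _; ring.
  rewrite RintD//; last by apply: intbleB => //; exact: intbleZ.
  by rewrite RintB//; [rewrite RintZ//; ring|exact: intbleZ].
rewrite E exprMn -DD.
have ap : 0 <= (2 * alpha / pi) ^+ 2 by exact: sqr_ge0.
apply: le_trans (ler_wpM2l ap (weighted_L2_CS U D)) _.
by rewrite /fock_sq expr2; rewrite le_eqVlt; apply/orP; left; apply/eqP; ring.
Qed.

Lemma Rint_area_le_Fatou (f_ : nat -> R * R -> R) (f : R * R -> R) (M : R) :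
  (forall n, aintble (f_ n)) -> (forall n w, 0 <= f_ n w) ->
  (forall w, f_ n w @[n --> \oo] --> f w) -> (forall n, \int[area R]_w f_ n w <= M) ->
  aintble f /\ \int[area R]_w f w <= M.
Proof.
move=> if_ f0 ff fM.
have mf n : measurable_fun [set: plane R] (f_ n : plane R -> R) by exact: intble_meas (if_ n).
have mff : measurable_fun [set: plane R] (f : plane R -> R).
  by apply: (measurable_fun_cvg mf) => x _; exact: ff.
have f0' w : 0 <= f w.
  rewrite -(cvg_lim (@Rhausdorff R) (ff w)); apply: limr_ge; last exact: nearW.
  by apply/cvg_ex; eexists; exact: ff.
have h : (\int[area R]_w (f w)%:E <= M%:E)%E.
  apply: (@Rint_Fatou _ (plane R) R (area R) f_ f M mf f0 ff).
  by move=> n; rewrite EFin_Rint// lee_fin.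
have i : aintble f by apply: intble_ge0 => //; apply: le_lt_trans h _; rewrite ltry.
by split => //; rewrite -lee_fin -EFin_Rint.
Qed.

(** The reproducing formula passes to pointwise limits because [reproduced_sup]
    dominates the integrands by a Gaussian. *)
Lemma reproduced_limit (u : nat -> R * R -> R) (g : R * R -> R) (M : R) :
  (forall n, reproduced (u n)) -> (forall n, fock_sq (u n) <= M) ->
  (forall z, u n z @[n --> \oo] --> g z) -> reproduced g /\ fock_sq g <= M.
Proof.
move=> ru uM ug.
have M0 : 0 <= M by apply: le_trans (uM 0%N); exact: fock_sq_ge0.
have mg : measurable_fun [set: plane R] (g : plane R -> R).
  by apply: (measurable_fun_cvg (fun n => (ru n).1.1)) => x _; exact: ug.
have [ig gM] := @Rint_area_le_Fatou (fun n w => u n w ^+ 2 * wgt w) (fun w => g w ^+ 2 * wgt w) M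
   (fun n => (ru n).1.2) (fun n w => mulr_ge0 (sqr_ge0 _) (gauss_ge0 _ _ _))
   (fun w => cvgM (cvg_comp _ (fun x => x ^+ 2) (ug w) (@exprn_continuous R 2 _)) (cvg_cst _)) uM.
split => //; split => // z.
have C := area_KC_L2 alpha0 z.
pose B := Num.sqrt (36 * alpha / pi * M).
have KM : 0 <= 36 * alpha / pi * M.
  by rewrite mulr_ge0// divr_ge0 ?pi_ge0// mulr_ge0// ltW.
have ub n w : `|u n w| * half_wgt w <= B.
  rewrite -(ger0_norm (ltW (half_wgt_gt0 alpha w))) -normrM.
  rewrite -(@ler_pXn2r _ 2) ?nnegrE ?sqrtr_ge0// real_normK ?num_real// /B sqr_sqrtr//.
  rewrite exprMn half_wgt_sq; apply: le_trans (reproduced_sup w (ru n)) _.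
  by apply: ler_wpM2l => //; rewrite divr_ge0 ?pi_ge0// mulr_ge0// ltW.
have a20 : 0 < alpha / 2 by rewrite divr_gt0.
pose D (w : plane R) : R := B * (half_wgt z)^-1 * gauss (alpha / 2) z w.
have iD : aintble D by apply: intbleZ; exact: integrable_gauss.
have L : \int[area R]_w (u n w * KC z w * wgt w) @[n --> \oo] -->
    \int[area R]_w (g w * KC z w * wgt w).
  apply: (@Rint_dominated _ (plane R) R (area R) (fun n w => u n w * KC z w * wgt w)
    (fun w => g w * KC z w * wgt w) D _ iD _ _).2.
  - by move=> n; exact: (intble_meas (weighted_L2_prod (ru n).1 C)).
  - by move=> w; apply: cvgM; [apply: cvgM; [exact: ug|exact: cvg_cst]|exact: cvg_cst].
  - move=> n w; rewrite /D -gauss_exp_half -half_wgt_sq.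
    have hz := half_wgt_gt0 alpha z; have hw := half_wgt_gt0 alpha w.
    rewrite !(normrM (_ * _)) (normrM (u n w)) (ger0_norm (sqr_ge0 _)).
    have -> : B / half_wgt z * (expR (alpha * (z.1 * w.1 + z.2 * w.2)) * (half_wgt z * half_wgt w)) =
      B * (expR (alpha * (z.1 * w.1 + z.2 * w.2)) * half_wgt w) by field; rewrite gt_eqF.
    have -> : `|u n w| * `|KC z w| * half_wgt w ^+ 2 =
      (`|u n w| * half_wgt w) * (`|KC z w| * half_wgt w) by ring.
    apply: ler_pM => //; try by rewrite mulr_ge0// ltW.
    by apply: ler_wpM2r; [exact: ltW|exact: KC_le].
apply: (seq_cvg_unique (seq_cvgD (ug z) (ug (0, 0)))).
rewrite (_ : (fun n => _) = (fun n => 2 * alpha / pi * \int[area R]_w (u n w * KC z w * wgt w))).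
  exact: seq_cvgZ.
by apply/funext => n; rewrite (ru n).2.
Qed.

End PointEstimates.

(** * Averaging over boxes *)

Section Boxes.
Context {R : realType}.
Implicit Types (z w : R * R) (mu : {measure set (plane R) -> \bar R}).

Definition box z : set (plane R) := [set w | `|w.1 - z.1| < 1 /\ `|w.2 - z.2| < 1].

Definition square (r : R) : set (plane R) := [set w | `|w.1| <= r /\ `|w.2| <= r].

Definition locally_finite mu := forall r, (mu (square r) < +oo)%E.

Lemma box_sym z w : box z w -> box w z.
Proof. by rewrite /box /= distrC (distrC w.2). Qed.

Lemma measurable_box z : measurable (box z).
Proof.
have -> : box z = ball z.1 1 `*` ball z.2 1.
  by apply/seteqP; split=> w; rewrite /box /ball/= distrC (distrC z.2).
by apply: measurableX; exact: measurable_ball.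
Qed.

Lemma area_box z : area R (box z) = 4%:E.
Proof.
have -> : box z = ball z.1 1 `*` ball z.2 1.
  by apply/seteqP; split=> w; rewrite /box /ball/= distrC (distrC z.2).
have mb (x : R) : measurable (ball x 1 : set (measurableTypeR R)) by exact: measurable_ball.
rewrite [LHS](product_measure1E (@lebesgue_measure R) (@lebesgue_measure R) (mb z.1) (mb z.2)).
transitivity (2%:E * 2%:E : \bar R)%E; last by rewrite -EFinM; congr (_%:E); ring.
by congr (_ * _)%E; exact: lebesgue_measure_ball.
Qed.

Lemma measurable_square r : measurable (square r).
Proof.
have -> : square r = `[- r, r]%classic `*` `[- r, r]%classic.
  by apply/seteqP; split=> w; rewrite /square /= !in_itv/= !ler_norml.
by apply: measurableX; exact: measurable_itv.
Qed.

Lemma box_in_square (M : R) z : sqn z <= `|M| -> box z `<=` square (`|M| + 2).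
Proof.
move=> hM w [b1 b2].
have small (a : R) : a ^+ 2 <= `|M| -> `|a| <= `|M| + 1.
  rewrite -(real_normK (num_real a)); have := normr_ge0 a; have := normr_ge0 M; nra.
have z1 : `|z.1| <= `|M| + 1 by apply: small; apply: le_trans hM; rewrite lerDl sqr_ge0.
have z2 : `|z.2| <= `|M| + 1 by apply: small; apply: le_trans hM; rewrite lerDr sqr_ge0.
have := ler_normD (w.1 - z.1) z.1; have := ler_normD (w.2 - z.2) z.2; rewrite !subrK.
by split; lra.
Qed.

Lemma locally_finite_sigma mu : locally_finite mu -> sigma_finite setT mu.
Proof.
move=> lf; exists (fun n => square n%:R); last by move=> n; split; [exact: measurable_square|].
apply/seteqP; split=> // w _; exists (Num.truncn (Num.max `|w.1| `|w.2|)).+1 => //.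
have h := truncnS_gt (Num.max `|w.1| `|w.2|).
by split; apply: le_trans (ltW h); rewrite le_max lexx ?orbT.
Qed.

Lemma area_sigma_finite : sigma_finite setT (area R).
Proof.
apply: locally_finite_sigma => r.
have -> : square r = `[- r, r]%classic `*` `[- r, r]%classic.
  by apply/seteqP; split=> w; rewrite /square /= !in_itv/= !ler_norml.
have mI : measurable (`[- r, r]%classic : set (measurableTypeR R)) by exact: measurable_itv.
rewrite [X in (X < _)%E](product_measure1E (@lebesgue_measure R) (@lebesgue_measure R) mI mI).
by apply: lte_mul_pinfty => //; rewrite ?ge0_fin_numE// [X in (X < _)%E]lebesgue_measure_itv;
   case: ifP => // _; rewrite -EFinB ltry.
Qed.

(** Fubini's theorem asks for a measure bundled with its sigma-finiteness. *)
Definition sigma_finite_pack mu (sf : sigma_finite setT mu) :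
    {sigma_finite_measure set (plane R) -> \bar R} :=
  HB.pack_for (SigmaFiniteMeasure.type (plane R) R) (Measure.sort mu)
    (isSFinite.Build _ _ _ _ (sfinite_measure_sigma_finite sf))
    (isSigmaFinite.Build _ _ _ _ sf).

(** Markov's inequality. *)
Lemma measure_le_integral mu (A : set (plane R)) (k : R) (f : plane R -> R) :
  measurable A -> 0 < k -> measurable_fun setT f -> (forall w, 0 <= f w) ->
  (forall w, A w -> k <= f w) -> (k%:E * mu A <= \int[mu]_w (f w)%:E)%E.
Proof.
move=> mA k0 mf f0 kf; rewrite -integral_cst//.
have mEf : measurable_fun setT (EFin \o f) by exact/measurable_EFinP.
apply: (@le_trans _ _ (\int[mu]_(w in A) (f w)%:E)%E).
  apply: ge0_le_integral => //.
  - by move=> w _; rewrite lee_fin ltW.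
  - exact: measurable_funTS.
by apply: ge0_subset_integral => // w _; rewrite lee_fin.
Qed.

Lemma measurable_coords :
  [/\ measurable_fun setT (fun p : plane R * plane R => p.1.1 : R),
      measurable_fun setT (fun p : plane R * plane R => p.1.2 : R),
      measurable_fun setT (fun p : plane R * plane R => p.2.1 : R) &
      measurable_fun setT (fun p : plane R * plane R => p.2.2 : R)].
Proof.
split.
- by apply: (measurableT_comp (f := fst)) => //; exact: measurable_fst.
- by apply: (measurableT_comp (f := snd)) => //; exact: measurable_fst.
- by apply: (measurableT_comp (f := fst)) => //; exact: measurable_snd.
- by apply: (measurableT_comp (f := snd)) => //; exact: measurable_snd.
Qed.

Lemma measurable_boxes : measurable [set p : plane R * plane R | box p.2 p.1].
Proof.
pose f (p : plane R * plane R) : R := Num.max `|p.1.1 - p.2.1| `|p.1.2 - p.2.2|.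
have [m11 m12 m21 m22] := measurable_coords.
have mf : measurable_fun setT f.
  by apply: measurable_maxr; apply: measurableT_comp => //; apply: measurable_funB.
have -> : [set p : plane R * plane R | box p.2 p.1] = setT `&` f @^-1` [set x | x < 1].
  apply/seteqP; split=> p; rewrite /box /f /= gt_max.
    by move=> [-> ->].
  by move=> [_ /andP].
by apply: mf => //; have := measurable_itv `]-oo, (1 : R)[; rewrite set_itvNyo.
Qed.

(** Integrate the pointwise bound over the pairs of points in a common box, and
    exchange the order of integration. *)
Lemma box_average mu (D : set (plane R)) (e : R) (phi : plane R -> R)
    (Psi : plane R -> \bar R) :
  sigma_finite setT mu -> measurable D -> measurable_fun setT phi ->
  measurable_fun setT Psi -> (forall w, 0 <= phi w) -> (forall w, 0 <= Psi w)%E ->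
  (forall z w, box z w -> ((phi w)%:E <= Psi z)%E) ->
  (forall z, (mu (box z `&` D) <= e%:E)%E) ->
  (\int[mu]_(w in D) (phi w)%:E <= e%:E * \int[area R]_z Psi z)%E.
Proof.
move=> sf mD mphi mPsi phi0 Psi0 H mue.
pose m := sigma_finite_pack sf; pose ar := sigma_finite_pack area_sigma_finite.
pose E := [set p : plane R * plane R | box p.2 p.1].
pose F (p : plane R * plane R) : \bar R := ((\1_D p.1 * \1_E p)%:E * Psi p.2)%E.
have mE : measurable E by exact: measurable_boxes.
have mF : measurable_fun setT F.
  apply: emeasurable_funM.
    apply/measurable_EFinP; apply: measurable_funM.
      by apply: measurableT_comp; [exact: measurable_indic|exact: measurable_fst].
    exact: measurable_indic.
  by apply: measurableT_comp => //; exact: measurable_snd.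
have F0 p : (0 <= F p)%E by rewrite mule_ge0// lee_fin mulr_ge0.
have T := fubini_tonelli (m1 := m) (m2 := ar) F mF F0.
have L : (\int[mu]_(w in D) (phi w)%:E <= \int[m]_w \int[ar]_z F (w, z))%E.
  rewrite integral_mkcond; apply: ge0_le_integral => //.
  - by move=> w _; apply: erestrict_ge0 => x _; rewrite lee_fin.
  - apply: (measurable_restrict _ mD measurableT).1 => //.
    by rewrite setTI; apply: measurable_funTS; exact/measurable_EFinP.
  - exact: (measurable_fun_fubini_tonelli_F (m2 := ar) F).
  - move=> w _; rewrite patchE; case: ifPn => [/set_mem Dw|_]; last first.
      by apply: integral_ge0 => z _; exact: F0.
    apply: (@le_trans _ _ (\int[ar]_(z in box w) (phi w)%:E)%E).
      rewrite integral_cst; last exact: measurable_box.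
      (* a box has area 4, at least 1 *)
      rewrite [X in (_ <= _ * X)%E](area_box w).
      by rewrite -EFinM lee_fin ler_peMr//; lra.
    have mFw : measurable_fun setT (fun z => F (w, z)) by exact: measurableT_comp.
    apply: (@le_trans _ _ (\int[ar]_(z in box w) F (w, z))%E).
      apply: ge0_le_integral => //.
      + exact: measurable_box.
      + by move=> z _; rewrite lee_fin.
      + exact: measurable_funTS.
      + move=> z bz; rewrite /F /= !indicE !mem_set//=; last exact: box_sym.
        by rewrite mulr1 mul1e; apply: H; exact: box_sym.
    by apply: ge0_subset_integral => //; exact: measurable_box.
apply: le_trans L _; rewrite T.
have e0 : 0 <= e by rewrite -lee_fin; apply: le_trans (mue (0, 0)).
rewrite -ge0_integralZl//.
apply: ge0_le_integral => //.
- by move=> z _; apply: integral_ge0 => w _; exact: F0.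
- exact: (measurable_fun_fubini_tonelli_G (m1 := m) F).
- exact: emeasurable_funM.
move=> z _; rewrite /F /=.
under eq_integral => w _ do rewrite muleC.
rewrite ge0_integralZl//; last first.
  apply/measurable_EFinP; apply: measurable_funM; first exact: measurable_indic.
  rewrite (_ : (fun x => _) = \1_(box z))//.
  by apply: measurable_indic; exact: measurable_box.
rewrite muleC; apply: lee_wpmul2r => //.
rewrite (_ : (fun w => _) = (fun w => (\1_(box z `&` D) w)%:E)); last first.
  apply/funext => w; rewrite indicI /= mulrC; congr ((_ * _)%:E).
rewrite integral_indic//; last by apply: measurableI => //; exact: measurable_box.
by rewrite setIT; exact: mue.
Qed.

Lemma gauss_tonelli mu (f : plane R -> R) (c : R) :
  sigma_finite setT mu -> measurable_fun setT f -> (forall w, 0 <= f w) -> 0 < c ->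
  measurable_fun [set: plane R] (fun z => \int[mu]_w (f w * gauss c z w)%:E)%E /\
  (\int[area R]_z \int[mu]_w (f w * gauss c z w)%:E =
   (pi / c)%:E * \int[mu]_w (f w)%:E)%E.
Proof.
move=> sf mf f0 c0.
pose m := sigma_finite_pack sf; pose ar := sigma_finite_pack area_sigma_finite.
pose F (p : plane R * plane R) : \bar R := (f p.1 * gauss c p.2 p.1)%:E.
have [m11 m12 m21 m22] := measurable_coords.
have mF : measurable_fun setT F.
  apply/measurable_EFinP; apply: measurable_funM.
    by apply: (measurableT_comp mf); exact: measurable_fst.
  rewrite /gauss /sqn /=; apply: measurableT_comp => //; apply: measurableT_comp => //.
  apply: measurable_funM => //; apply: measurable_funD; apply: measurable_funX;
  exact: measurable_funB.
have F0 p : (0 <= F p)%E by rewrite lee_fin mulr_ge0// gauss_ge0.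
split; first exact: (measurable_fun_fubini_tonelli_G (m1 := m) F).
rewrite -[LHS](fubini_tonelli (m1 := m) (m2 := ar) F mF F0).
under eq_integral => w _.
  rewrite /F /=.
  under eq_integral => z _ do rewrite gaussC EFinM.
  rewrite ge0_integralZl//; last 3 first.
  - by apply/measurable_EFinP; exact: measurable_gauss.
  - by move=> z _; rewrite lee_fin gauss_ge0.
  - by rewrite lee_fin.
  rewrite (integral_gauss w c0) muleC; over.
rewrite ge0_integralZl//.
- exact/measurable_EFinP.
- by move=> w _; rewrite lee_fin.
- by rewrite lee_fin divr_ge0 ?pi_ge0// ltW.
Qed.

(** Moving the centre within a box halves the exponent and costs a constant. *)
Lemma gauss_box (c : R) z w x : 0 <= c -> box z w ->
  gauss c w x <= expR (2 * c) * gauss (c / 2) z x.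
Proof.
move=> c0 [h1 h2].
have sq (a : R) : `|a| < 1 -> a ^+ 2 <= 1.
  by move=> h; rewrite -(real_normK (num_real a)) expr_le1// ltW.
have q1 := sq _ h1; have q2 := sq _ h2.
rewrite /gauss -expRD ler_expR /sqn /=.
have p1 : (x.1 - z.1) ^+ 2 <= 2 * (x.1 - w.1) ^+ 2 + 2.
  have := sqr_ge0 ((x.1 - w.1) - (w.1 - z.1)); nra.
have p2 : (x.2 - z.2) ^+ 2 <= 2 * (x.2 - w.2) ^+ 2 + 2.
  have := sqr_ge0 ((x.2 - w.2) - (w.2 - z.2)); nra.
have := ler_wpM2l c0 p1; have := ler_wpM2l c0 p2; rewrite !mulrDr; lra.
Qed.

(** [box_average] for a Gaussian, whose values on a box are comparable by
    [gauss_box]. *)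
Lemma gauss_integral_le mu (B c : R) : sigma_finite setT mu -> 0 < c ->
  (forall z, (mu (box z) <= B%:E)%E) -> forall z,
  (\int[mu]_w (gauss c z w)%:E <= (B * (expR (2 * c) * (2 * pi / c)))%:E)%E.
Proof.
move=> sf c0 HB z.
have c20 : 0 < c / 2 by rewrite divr_gt0.
have mg k : measurable_fun [set: plane R] (gauss k z : plane R -> R).
  by exact: measurable_gauss.
apply: le_trans (@box_average mu setT B (gauss c z)
  (fun x => (expR (2 * c) * gauss (c / 2) z x)%:E) sf measurableT (mg c) _ _ _ _ _) _.
- by apply/measurable_EFinP; apply: measurable_funM.
- by move=> w; exact: gauss_ge0.
- by move=> w; rewrite lee_fin mulr_ge0 ?expR_ge0 ?gauss_ge0.
- move=> x w b; rewrite lee_fin gaussC [X in _ <= _ * X]gaussC.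
  exact: gauss_box (ltW c0) b.
- by move=> x; rewrite setIT.
under eq_integral => w _ do rewrite EFinM.
rewrite ge0_integralZl//; last 2 first.
- by apply/measurable_EFinP.
- by move=> x _; rewrite lee_fin gauss_ge0.
rewrite integral_gauss// -!EFinM lee_fin.
by rewrite (_ : pi / (c / 2) = 2 * pi / c)//; field; rewrite gt_eqF.
Qed.

End Boxes.

(** * Carleson estimate and bounded Toeplitz operators *)

Section Carleson.
Context {R : realType} (alpha : R) (alpha0 : 0 < alpha).
Implicit Types (z w : R * R) (mu : {measure set (plane R) -> \bar R}) (u p : R * R -> R).
Notation wgt := (gauss alpha (0, 0)).
Notation reproduced := (reproduced alpha).
Notation fock_sq := (fock_sq alpha).
Notation KC := (KC alpha).
Notation half_wgt := (half_wgt alpha).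

Lemma wsq_ge0 u w : 0 <= u w ^+ 2 * wgt w.
Proof. by rewrite mulr_ge0 ?sqr_ge0 ?gauss_ge0. Qed.

(** [box_average] for $u^2e^{-\alpha|w|^2}$: by [reproduced_local] it is bounded on a
    box by a Gaussian average of itself, and averaging preserves the integral
    up to a constant. *)
Lemma Carleson_boxes mu (D : set (plane R)) (e : R) u :
  sigma_finite setT mu -> measurable D -> (forall z, (mu (box z `&` D) <= e%:E)%E) ->
  reproduced u ->
  (\int[mu]_(w in D) (u w ^+ 2 * wgt w)%:E <=
   (288 * expR (alpha / 2) * e * fock_sq u)%:E)%E.
Proof.
move=> sf mD mue ru; have [[mu_ iu] _] := ru.
have mphi := intble_meas iu.
have a8 : 0 < alpha / 8 by rewrite divr_gt0.
have [mT ET] := gauss_tonelli area_sigma_finite mphi (wsq_ge0 u) a8.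
pose A := 36 * alpha / pi * expR (alpha / 2).
have A0 : 0 <= A by rewrite mulr_ge0 ?expR_ge0// divr_ge0 ?pi_ge0// mulr_ge0// ltW.
pose Psi z : \bar R := (A%:E * \int[area R]_w (u w ^+ 2 * wgt w * gauss (alpha / 8) z w)%:E)%E.
have Psi0 z : (0 <= Psi z)%E.
  rewrite mule_ge0// ?lee_fin//; apply: integral_ge0 => w _.
  by rewrite lee_fin mulr_ge0 ?gauss_ge0 ?wsq_ge0.
have mPsi : measurable_fun [set: plane R] Psi by exact: emeasurable_funM.
apply: le_trans (@box_average R mu D e (fun w => u w ^+ 2 * wgt w) Psi sf mD mphi mPsi
  (wsq_ge0 u) Psi0 _ mue) _.
  move=> z w b; have L := reproduced_local alpha0 w ru.
  have I := reproduced_local_int alpha0 w ru.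
  have iz : (area R).-integrable [set: plane R] (EFin \o (fun x : plane R => u x ^+ 2 * wgt x * gauss (alpha / 8) z x)).
    apply: (intble_le _ iu).
      by apply: measurable_cont_mul => //; exact: continuous_gauss.
    move=> x; rewrite ger0_norm; last by rewrite mulr_ge0 ?gauss_ge0 ?wsq_ge0.
    by rewrite ler_piMr ?wsq_ge0//; apply: gauss_le1; exact: ltW.
  rewrite /Psi EFin_Rint// -EFinM lee_fin; apply: le_trans L _.
  rewrite /A -(mulrA (36 * alpha / pi)); apply: ler_wpM2l; first by rewrite divr_ge0 ?pi_ge0// mulr_ge0// ltW.
  rewrite -RintZ//; apply: Rint_le => //; first exact: intbleZ.
  move=> x; rewrite mulrCA; apply: ler_wpM2l; first exact: wsq_ge0.
  have a40 : 0 <= alpha / 4 by rewrite divr_ge0// ltW.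
  have := @gauss_box R (alpha / 4) z w x a40 b.
  have e1 : 2 * (alpha / 4) = alpha / 2 by field.
  have e2 : alpha / 4 / 2 = alpha / 8 by field.
  by rewrite e1 e2.
rewrite /Psi ge0_integralZl//; last by move=> z _; apply: integral_ge0 => w _; rewrite lee_fin mulr_ge0 ?gauss_ge0 ?wsq_ge0.
rewrite ET EFin_Rint// -!EFinM lee_fin /A -/(fock_sq u).
rewrite le_eqVlt; apply/orP; left; apply/eqP.
have e' (q a s : R) : q != 0 -> a != 0 -> e * (36 * a / q * s * (q / (a / 8) * fock_sq u)) = 288 * s * e * fock_sq u.
  by move=> hq ha; field; rewrite hq ha.
by rewrite e'// gt_eqF// pi_gt0.
Qed.

(** The Toeplitz operator on real functions; as $H_z$ is real, it acts on real and
    imaginary parts separately. *)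
Definition toep mu p z : R := 2 * \int[mu]_w (p w * KC z w * wgt w).

Lemma gauss_shrink_half mu z : mu.-integrable [set: plane R] (EFin \o (gauss (alpha / 2) z : plane R -> R)) ->
  mu.-integrable [set: plane R] (EFin \o (gauss alpha z : plane R -> R)).
Proof.
move=> ig; apply: (intble_le _ ig).
  by exact: measurable_gauss.
move=> w; rewrite ger0_norm ?gauss_ge0// /gauss ler_expR lerN2 ler_wpM2r ?sqn_ge0//.
by have := alpha0; lra.
Qed.

Lemma mu_KC_L2 mu z : mu.-integrable [set: plane R] (EFin \o (gauss (alpha / 2) z : plane R -> R)) ->
  weighted_L2 alpha mu (KC z).
Proof.
move=> /gauss_shrink_half ig.
by apply: (@kernel_L2 _ _ _ _ z) ig; [exact: continuous_KC|move=> w; exact: KC_le].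
Qed.

(** Cauchy-Schwarz, with the Gaussian $e^{-\alpha|z-w|^2/2}$ that measures the kernel
    between the weights shared equally by the two factors. *)
Lemma toep_bound mu (B : R) p z :
  (forall z, (\int[mu]_w (gauss (alpha / 2) z w)%:E <= B%:E)%E) -> weighted_L2 alpha mu p ->
  (((toep mu p z) ^+ 2 * wgt z)%:E <=
    (4 * B)%:E * \int[mu]_w (p w ^+ 2 * wgt w * gauss (alpha / 2) z w)%:E)%E.
Proof.
move=> HB P; have [mp ip] := P.
have B0 : 0 <= B.
  by rewrite -lee_fin; apply: le_trans (HB z); apply: integral_ge0 => w _; rewrite lee_fin gauss_ge0.
have mg k x : measurable_fun [set: plane R] (gauss k x : plane R -> R).
  by exact: measurable_gauss.
have ig : mu.-integrable [set: plane R] (EFin \o (gauss (alpha / 2) z : plane R -> R)).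
  apply: intble_ge0 => //; first by move=> w; exact: gauss_ge0.
  by apply: le_lt_trans (HB z) _; rewrite ltry.
have KL := mu_KC_L2 ig.
pose F (w : plane R) : R := p w * (half_wgt w * gauss (alpha / 4) z w).
pose G (w : plane R) : R := KC z w * (half_wgt z * half_wgt w) * expR (alpha / 4 * sqn (w - z)).
have chw : continuous half_wgt by exact: continuous_gauss.
have mF : measurable_fun [set: plane R] F.
  by apply: measurable_cont_mul => //; apply: contM => //; exact: continuous_gauss.
have cG : continuous (G : R * R -> R).
  by rewrite /G; have cK := @continuous_KC R alpha z; rewrite /sqn /=; cont.
have mG : measurable_fun [set: plane R] G by exact: continuous_plane_measurable.
have F2 w : F w ^+ 2 = p w ^+ 2 * wgt w * gauss (alpha / 2) z w.
  rewrite /F !exprMn half_wgt_sq gauss_sq (_ : 2 * (alpha / 4) = alpha / 2); last by field.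
  by ring.
have Gle w : G w ^+ 2 <= gauss (alpha / 2) z w.
  have g0 := gauss_ge0 (alpha / 4) z w.
  have -> : gauss (alpha / 2) z w = gauss (alpha / 4) z w ^+ 2.
    by rewrite gauss_sq (_ : 2 * (alpha / 4) = alpha / 2)//; field.
  rewrite -[X in X <= _](real_normK (num_real _)); apply: lerXn2r; rewrite ?nnegrE//.
  have e : gauss (alpha / 2) z w * expR (alpha / 4 * sqn (w - z)) = gauss (alpha / 4) z w.
    by rewrite /gauss -expRD; congr expR; field.
  rewrite /G normrM (ger0_norm (expR_ge0 _)) -e; apply: ler_wpM2r; first exact: expR_ge0.
  have h0 : 0 <= half_wgt z * half_wgt w by rewrite mulr_ge0// ltW// half_wgt_gt0.
  rewrite (normrM (KC z w)) (ger0_norm h0) -gauss_exp_half; apply: ler_wpM2r => //.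
  exact: KC_le.
have iG : mu.-integrable [set: plane R] (EFin \o (fun w : plane R => G w ^+ 2)).
  apply: (intble_le _ ig); last by move=> w; rewrite ger0_norm ?sqr_ge0.
  by apply: continuous_plane_measurable; cont.
have iF' : mu.-integrable [set: plane R] (EFin \o (fun w : plane R => p w ^+ 2 * wgt w * gauss (alpha / 2) z w)).
  apply: (intble_le _ ip).
    by apply: measurable_cont_mul; [exact: continuous_gauss|exact: intble_meas ip].
  move=> x; rewrite ger0_norm; last by rewrite mulr_ge0 ?gauss_ge0 ?wsq_ge0.
  by rewrite ler_piMr ?wsq_ge0//; apply: gauss_le1; rewrite divr_ge0// ltW.
have iF : mu.-integrable [set: plane R] (EFin \o (fun w : plane R => F w ^+ 2)).
  by move: iF'; congr (_.-integrable _ _); apply/funext => w /=; rewrite F2.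
have CS := Cauchy_Schwarz mF mG iF iG.
have E : toep mu p z * half_wgt z = 2 * \int[mu]_w (F w * G w).
  rewrite /toep -mulrA; congr (_ * _); rewrite mulrC -RintZ; last exact: weighted_L2_prod.
  apply: eq_Rintegral => w _; rewrite /F /G -half_wgt_sq.
  have e : gauss (alpha / 4) z w * expR (alpha / 4 * sqn (w - z)) = 1.
    by rewrite /gauss -expRD addNr expR0.
  rewrite -[LHS]mulr1 -[X in _ * X = _]e; ring.
rewrite EFin_Rint// -EFinM lee_fin -half_wgt_sq -exprMn E exprMn.
have IG : \int[mu]_w (G w ^+ 2) <= B.
  have : \int[mu]_w (gauss (alpha / 2) z w) <= B.
    by rewrite -lee_fin -EFin_Rint//; exact: HB.
  by apply: le_trans; apply: Rint_le.
have F0 : 0 <= \int[mu]_w (F w ^+ 2) by apply: Rintegral_ge0 => w _; exact: sqr_ge0.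
have f4 : 0 <= 2 ^+ 2 :> R by exact: sqr_ge0.
apply: le_trans (ler_wpM2l f4 (le_trans CS (ler_wpM2l F0 IG))) _.
have -> : \int[mu]_w (F w ^+ 2) = \int[mu]_w (p w ^+ 2 * wgt w * gauss (alpha / 2) z w).
  by apply: eq_Rintegral => w _; rewrite F2.
by rewrite le_eqVlt; apply/orP; left; apply/eqP; ring.
Qed.

(** Integrating [toep_bound] over z only costs the mass of a Gaussian;
    harmonicity is that of kernel integrals. *)
Lemma toep_reproduced mu (B : R) p : sigma_finite setT mu ->
  (forall z, (\int[mu]_w (gauss (alpha / 2) z w)%:E <= B%:E)%E) -> weighted_L2 alpha mu p ->
  reproduced (toep mu p) /\
  fock_sq (toep mu p) <= 8 * pi * B / alpha * \int[mu]_w (p w ^+ 2 * wgt w).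
Proof.
move=> sf HB P; have [mp ip] := P.
have ig z : mu.-integrable [set: plane R] (EFin \o (gauss (alpha / 2) z : plane R -> R)).
  apply: intble_ge0 => //; last by apply: le_lt_trans (HB z) _; rewrite ltry.
    by exact: measurable_gauss.
  by move=> w; exact: gauss_ge0.
have hT : harmonic_real (toep mu p).
  rewrite (_ : toep mu p = (fun z => Kint alpha mu (fun w => 2 * (p w * wgt w)) (fun=> 0) z - 0)).
    by apply: Kint_harmonic; apply: exp_integrable_wgt => //; exact: ig.
  apply/funext => z; rewrite subr0 /toep /Kint -RintZ; last first.
    by apply: weighted_L2_prod => //; apply: mu_KC_L2.
  by apply: eq_Rintegral => w _; ring.
have cT : continuous (toep mu p) by have [[[]]] := hT.
have a20 : 0 < alpha / 2 by rewrite divr_gt0.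
have [mTon ETon] := gauss_tonelli sf (intble_meas ip) (wsq_ge0 p) a20.
have B0 : 0 <= B.
  by rewrite -lee_fin; apply: le_trans (HB (0, 0)); apply: integral_ge0 => w _; rewrite lee_fin gauss_ge0.
have mTw : measurable_fun [set: plane R] (fun z : plane R => toep mu p z ^+ 2 * wgt z).
  by apply: continuous_plane_measurable; apply: contM; [cont|exact: continuous_gauss].
have bound : (\int[area R]_z (toep mu p z ^+ 2 * wgt z)%:E <=
    (8 * pi * B / alpha * \int[mu]_w (p w ^+ 2 * wgt w))%:E)%E.
  apply: (@le_trans _ _ (\int[area R]_z ((4 * B)%:E *
      \int[mu]_w (p w ^+ 2 * wgt w * gauss (alpha / 2) z w)%:E))%E).
    apply: ge0_le_integral => //.
    - by move=> z _; rewrite lee_fin wsq_ge0.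
    - exact/measurable_EFinP.
    - exact: emeasurable_funM.
    - by move=> z _; exact: toep_bound.
  rewrite ge0_integralZl//; last 2 first.
  - by move=> z _; apply: integral_ge0 => w _; rewrite lee_fin mulr_ge0 ?gauss_ge0 ?wsq_ge0.
  - by rewrite lee_fin mulr_ge0.
  rewrite ETon EFin_Rint// -!EFinM lee_fin le_eqVlt; apply/orP; left; apply/eqP.
  by field; rewrite gt_eqF.
have iT : (area R).-integrable [set: plane R] (EFin \o (fun z : plane R => toep mu p z ^+ 2 * wgt z)).
  apply: intble_ge0 => //; first by move=> w; exact: wsq_ge0.
  by apply: le_lt_trans bound _; rewrite ltry.
split; last by rewrite -lee_fin -EFin_Rint.
by apply: harmonic_reproduced => //; split => //; exact: continuous_plane_measurable.
Qed.

End Carleson.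

(** * Normal families *)

Section Montel.
Context {R : realType} (alpha : R) (alpha0 : 0 < alpha).
Implicit Types (z w : R * R).
Notation reproduced := (reproduced alpha).
Notation fock_sq := (fock_sq alpha).
Notation KC := (KC alpha).
Notation half_wgt := (half_wgt alpha).

Lemma ultra_limit (U : set_system nat) (u : nat -> R) (B : R) : UltraFilter U ->
  (forall n, `|u n| <= B) -> exists l, forall e, 0 < e -> U [set n | `|u n - l| < e].
Proof.
move=> UU uB.
have UF : U [set n | `[- B, B]%classic (u n)].
  by apply: filterS filterT => n _; rewrite /= in_itv/= -ler_norml.
have [l [_ cl]] := @segment_compact R (- B) B (u @ U) _ UF.
exists l => e e0.
have [//|nU] := in_ultra_setVsetC [set n | `|u n - l| < e] UU.
have [x [/= h]] := cl [set x | ~ `|x - l| < e] (ball l e) nU (nbhsx_ballx l e e0).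
by rewrite /ball/= distrC.
Qed.

(** The quadratic form of [reproduced_equicontinuous] is continuous in z' and
    vanishes at z; it is nonnegative because the estimate holds for the kernel. *)
Lemma reproduced_near (M : R) z (e : R) : 0 < e ->
  \forall z' \near z, forall u, reproduced u -> fock_sq u <= M -> `|u z' - u z| < e.
Proof.
move=> e0.
pose phi z' : R := 2 * alpha / pi * M * (KC z z - 2 * KC z z' + KC z' z').
have cphi : continuous phi.
  have ck : continuous (fun z' : R * R => KC z' z') by rewrite /KC; cont.
  have ck' := @continuous_KC R alpha z.
  by rewrite /phi; cont.
have phi0 : phi z = 0 by rewrite /phi; ring.
have e20 : 0 < e ^+ 2 by rewrite exprn_gt0.
have := cphi z => /cvgrPdist_lt/(_ _ e20); rewrite phi0; apply: filterS => z'.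
rewrite sub0r normrN => h u ru uM.
rewrite -(@ltr_pXn2r _ 2) ?nnegrE ?(ltW e0)// real_normK ?num_real//.
apply: le_lt_trans h; apply: le_trans (ler_norm _).
rewrite -sqrrN opprB; apply: le_trans (reproduced_equicontinuous alpha0 z z' ru) _.
rewrite /phi -!mulrA; apply: ler_wpM2l => //; apply: ler_wpM2l; first exact: ltW.
apply: ler_wpM2l; first by rewrite invr_ge0 pi_ge0.
apply: ler_wpM2r => //.
have := reproduced_equicontinuous alpha0 z z' (reproduced_KC alpha0 z).
set D := KC z z - _ + _ => hD.
have c0 : 0 < 2 * alpha / pi by rewrite divr_gt0 ?pi_gt0// mulr_gt0.
have F0 := fock_sq_ge0 alpha (KC z).
have [//|D0] := leP 0 D.
have Fpos : 0 < fock_sq (KC z).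
  have := reproduced_sup alpha0 (0, 0) (reproduced_KC alpha0 z).
  rewrite KC_sym KC0 expr1n mul1r => hs.
  have g0 := gauss_gt0 alpha (0, 0) ((0, 0) : R * R).
  have : 0 < 36 * alpha / pi * fock_sq (KC z) by apply: lt_le_trans hs.
  by rewrite pmulr_rgt0// divr_gt0 ?pi_gt0// mulr_gt0.
have : 2 * alpha / pi * fock_sq (KC z) * D < 0 by rewrite pmulr_rlt0// mulr_gt0.
by move=> /(le_lt_trans hD); rewrite ltNge sqr_ge0.
Qed.

Lemma reproduced_bounded_at (M : R) z : exists B : R,
  forall u, reproduced u -> fock_sq u <= M -> `|u z| <= B.
Proof.
pose B := Num.sqrt (36 * alpha / pi * M) / half_wgt z.
exists B => u ru uM; have h0 := half_wgt_gt0 alpha z.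
have c0 : 0 <= 36 * alpha / pi by rewrite divr_ge0 ?pi_ge0// mulr_ge0// ltW.
have M0 : 0 <= M by apply: le_trans uM; exact: fock_sq_ge0.
rewrite /B ler_pdivlMr// -(ger0_norm (ltW h0)) -normrM.
rewrite -(@ler_pXn2r _ 2) ?nnegrE ?sqrtr_ge0// real_normK ?num_real// sqr_sqrtr; last exact: mulr_ge0.
rewrite exprMn half_wgt_sq; apply: le_trans (reproduced_sup alpha0 z ru) _.
exact: ler_wpM2l.
Qed.

(** Along an ultrafilter bounded sequences converge pointwise; equicontinuity and
    compactness make the convergence uniform. *)
Lemma Montel_ultra (U : set_system nat) (u : nat -> R * R -> R) (M : R) : UltraFilter U ->
  (forall n, reproduced (u n)) -> (forall n, fock_sq (u n) <= M) ->
  exists g : R * R -> R, forall (K : set (R * R)) (e : R), compact K -> 0 < e ->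
    U [set n | forall z, K z -> `|u n z - g z| < e].
Proof.
move=> UU ru uM.
have /choice[g Hg] : forall z, exists l, forall e, 0 < e -> U [set n | `|u n z - l| < e].
  move=> z; have [B HB] := reproduced_bounded_at M z.
  by apply: (@ultra_limit U (fun n => u n z) B UU) => n; exact: HB.
exists g => K e cK e0.
have e80 : 0 < e / 8 by rewrite divr_gt0.
move: cK => /compact_near_coveringP/(_ nat U (fun n z => `|u n z - g z| < e)); apply.
move=> z Kz.
exists ([set z' | forall u, reproduced u -> fock_sq u <= M -> `|u z' - u z| < e / 8],
        [set n | `|u n z - g z| < e / 8]).
  by split; [exact: reproduced_near|exact: Hg].
move=> [z' n] [/= h1 h2].
have gz : `|g z' - g z| < 3 * (e / 8).
  have [k [/= k1 k2]] := @filter_ex _ _ (ultra_proper) _ (filterI (Hg z' _ e80) (Hg z _ e80)).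
  have k3 := h1 _ (ru k) (uM k).
  have -> : g z' - g z = - (u k z' - g z') + (u k z' - u k z) + (u k z - g z) by ring.
  apply: le_lt_trans (ler_normD _ _) _.
  have := ler_normD (- (u k z' - g z')) (u k z' - u k z); rewrite normrN; lra.
have E : u n z' - g z' = (u n z' - u n z) + (u n z - g z) - (g z' - g z) by ring.
have F1 := ler_normD (u n z' - u n z) (u n z - g z).
have F2 := ler_normB ((u n z' - u n z) + (u n z - g z)) (g z' - g z).
by rewrite E; have := h1 _ (ru n) (uM n); lra.
Qed.

Lemma compact_in_square (K : set (R * R)) : compact K -> exists r : R,
  forall w, K w -> `|w.1| <= r /\ `|w.2| <= r.
Proof.
move=> cK; have cf : continuous (fun w : R * R => `|w.1| + `|w.2|) by cont.
have /compact_bounded[M [_ HM]] : compact ((fun w : R * R => `|w.1| + `|w.2|) @` K).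
  by apply: continuous_compact => //; exact: continuous_subspaceT.
exists (M + 1) => w Kw.
have M1 : M < M + 1 by rewrite ltrDl.
have := HM _ M1 _ (imageP _ Kw); rewrite /= ger0_norm ?addr_ge0// => h.
by have := normr_ge0 w.1; have := normr_ge0 w.2; split; lra.
Qed.

(** Each set of the ultrafilter contains arbitrarily large integers. *)
Lemma ultra_subsequence (U : set_system nat) (S : nat -> set nat) : UltraFilter U ->
  \oo `<=` U -> (forall k, U (S k)) ->
  exists phi : nat -> nat, {homo phi : m n / (m < n)%N} /\ forall k, S k (phi k).
Proof.
move=> UU Uoo US.
have /choice[f Hf] : forall km : nat * nat, exists n, S km.1 n /\ (km.2 < n)%N.
  move=> [k m]; have := Uoo _ (nbhs_infty_gt m) => Um.
  have [n [h1 h2]] := @filter_ex _ _ ultra_proper _ (filterI (US k) Um).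
  by exists n.
pose phi := fix phi k := if k is j.+1 then f (k, phi j) else f (k, 0%N).
exists phi; split; first by apply: homo_ltn; [exact: ltn_trans|move=> k; have [] := Hf (k.+1, phi k)].
by move=> [|k]; [have [] := Hf (0%N, 0%N)|have [] := Hf (k.+1, phi k)].
Qed.

(** Two sequences at once, so that real and imaginary parts converge along the same
    subsequence. *)
Lemma Montel (u v : nat -> R * R -> R) (M : R) :
  (forall n, reproduced (u n)) -> (forall n, fock_sq (u n) <= M) ->
  (forall n, reproduced (v n)) -> (forall n, fock_sq (v n) <= M) ->
  exists phi : nat -> nat, {homo phi : m n / (m < n)%N} /\
  exists g h, [/\ reproduced g, reproduced h & forall r e : R, 0 < e ->
    \forall k \near \oo, forall w, `|w.1| <= r -> `|w.2| <= r ->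
      `|u (phi k) w - g w| < e /\ `|v (phi k) w - h w| < e].
Proof.
move=> ru uM rv vM.
have [U [UU Uoo]] := @ultraFilterLemma nat \oo _.
have [g Hg] := Montel_ultra UU ru uM; have [h Hh] := Montel_ultra UU rv vM.
pose Q (r : R) : set (R * R) := `[- r, r]%classic `*` `[- r, r]%classic.
have cQ r : compact (Q r) by apply: compact_setX; exact: segment_compact.
have inQ r w : Q r w <-> `|w.1| <= r /\ `|w.2| <= r.
  by rewrite /Q /= !in_itv/= -!ler_norml.
pose S k := [set n | forall z, Q k%:R z -> `|u n z - g z| < k.+1%:R^-1] `&`
            [set n | forall z, Q k%:R z -> `|v n z - h z| < k.+1%:R^-1].
have US k : U (S k).
  have k0 : 0 < k.+1%:R^-1 :> R by rewrite invr_gt0.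
  by apply: filterI; [exact: Hg|exact: Hh].
have [phi [hphi Sphi]] := ultra_subsequence UU Uoo US.
have C (r e : R) : 0 < e -> \forall k \near \oo, forall w, `|w.1| <= r -> `|w.2| <= r ->
      `|u (phi k) w - g w| < e /\ `|v (phi k) w - h w| < e.
  move=> e0.
  have h1 : \forall k \near \oo, k.+1%:R^-1 < e.
    have /cvgrPdist_lt/(_ _ e0) := @cvg_harmonic R; apply: filterS => k.
    by rewrite sub0r normrN ger0_norm// harmonic_ge0.
  have h2 : \forall k \near \oo, r <= k%:R by exact: nbhs_infty_ger.
  near=> k => w w1 w2; have ke : k.+1%:R^-1 < e by near: k.
  have rk : r <= k%:R by near: k.
  have Qw : Q k%:R w by apply/inQ; split; exact: le_trans rk.
  by have [s1 s2] := Sphi k; split; apply: lt_trans ke; [exact: s1|exact: s2].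
exists phi; split => //; exists g, h.
have ptw z : u (phi k) z @[k --> \oo] --> g z /\ v (phi k) z @[k --> \oo] --> h z.
  have Cz e : 0 < e -> \forall k \near \oo, `|u (phi k) z - g z| < e /\ `|v (phi k) z - h z| < e.
    move=> e0; apply: filterS (C (Num.max `|z.1| `|z.2|) e e0) => k; apply.
      by rewrite le_max lexx.
    by rewrite le_max lexx orbT.
  split; apply/cvgrPdist_lt => e e0; apply: filterS (Cz e e0) => k [h1 h2];
  by rewrite distrC.
split => //.
- exact: (reproduced_limit alpha0 (fun k => ru (phi k)) (fun k => uM (phi k)) (fun z => (ptw z).1)).1.
- exact: (reproduced_limit alpha0 (fun k => rv (phi k)) (fun k => vM (phi k)) (fun z => (ptw z).2)).1.
Unshelve. all: by end_near. Qed.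

End Montel.

(** * Box masses controlled by the Berezin transform *)

Section BerezinBoxes.
Context {R : realType} (alpha : R) (alpha0 : 0 < alpha).
Implicit Types (z w : R * R) (mu : {measure set (plane R) -> \bar R}).
Notation wgt := (gauss alpha (0, 0)).
Notation reproduced := (reproduced alpha).
Notation fock_sq := (fock_sq alpha).

(** This is $|h_z(w)|^2e^{-\alpha|w|^2}$. *)
Definition berezin_kernel z w : R :=
  2 * gauss alpha z w * cos (alpha * (z.1 * w.2 - z.2 * w.1)) ^+ 2.

Lemma berezin_kernel_ge0 z w : 0 <= berezin_kernel z w.
Proof. by rewrite mulr_ge0 ?sqr_ge0// mulr_ge0 ?gauss_ge0. Qed.

Lemma measurable_berezin_kernel z : measurable_fun [set: plane R] (berezin_kernel z : plane R -> R).
Proof.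
apply: continuous_plane_measurable; rewrite /berezin_kernel /gauss /sqn /=; cont.
Qed.

Lemma berezin_kernel_sum mu z z' :
  (\int[mu]_w (berezin_kernel z w + berezin_kernel z' w)%:E =
   \int[mu]_w (berezin_kernel z w)%:E + \int[mu]_w (berezin_kernel z' w)%:E)%E.
Proof.
under eq_integral => w _ do rewrite EFinD.
rewrite ge0_integralD//; last 4 first.
- by move=> w _; rewrite lee_fin berezin_kernel_ge0.
- by apply/measurable_EFinP; exact: measurable_berezin_kernel.
- by move=> w _; rewrite lee_fin berezin_kernel_ge0.
- by apply/measurable_EFinP; exact: measurable_berezin_kernel.
Qed.

Definition berezin_to_0 mu := forall e : R, 0 < e -> exists M : R, forall z,
  M < sqn z -> (\int[mu]_w (berezin_kernel z w)%:E < e%:E)%E.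

Definition boxes_to_0 mu := forall e : R, 0 < e -> exists M : R, forall z,
  M < sqn z -> (mu (box z) <= e%:E)%E.

Lemma abs_sin_le (t : R) : `|sin t| <= `|t|.
Proof.
have [c _] := MVT_abs 0 t (@is_derive_sin R).
rewrite sin0 !subr0 => ->; rewrite normrM ler_piMl// ler_norml cos_geN1 cos_le1//.
Qed.

Lemma pi_lt4 : pi < 4 :> R.
Proof. by have := @pihalf_lt2 R; lra. Qed.

(** The sum is $1+\cos(2t-\varphi)\cos\varphi$, and $\cos\varphi$ is small near $\pi/2$. *)
Lemma cos2_shift (t phi : R) : `|phi - pi / 2| <= 1 / 2 ->
  1 / 2 <= cos t ^+ 2 + cos (t - phi) ^+ 2.
Proof.
move=> h.
have E : cos t ^+ 2 + cos (t - phi) ^+ 2 = 1 + cos (t + (t - phi)) * cos phi.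
  have -> : cos phi = cos (t - (t - phi)) by congr cos; ring.
  rewrite (cosD t (t - phi)) (cosB t (t - phi)).
  have := sin2cos2 t; have := sin2cos2 (t - phi).
  set a := cos t; set b := cos _; set c := sin t; set d := sin _ => e1 e2.
  have -> : 1 + (a * b - c * d) * (a * b + c * d) = 1 + a ^+ 2 * b ^+ 2 - c ^+ 2 * d ^+ 2 by ring.
  by rewrite e1 e2; ring.
have cp : `|cos phi| <= 1 / 2.
  have -> : phi = (phi - pi / 2) + pi / 2 by ring.
  rewrite cosDpihalf normrN; apply: le_trans (abs_sin_le _) h.
have : `|cos (t + (t - phi)) * cos phi| <= 1 / 2.
  rewrite normrM; apply: le_trans cp; apply: ler_piMl => //.
  by rewrite ler_norml cos_geN1 cos_le1.
by rewrite E ler_norml => /andP[]; lra.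
Qed.

(** With $s=\cos^2t$ the sum is $4s^2-3s+1$, which is least at $s=3/8$. *)
Lemma cos2_double (t : R) : 7 / 16 <= cos t ^+ 2 + cos (2 * t) ^+ 2.
Proof.
rewrite (_ : 2 * t = t *+ 2) ?mulr_natl// cos_mulr2n; have : 0 <= (8 * cos t ^+ 2 - 3) ^+ 2 by exact: sqr_ge0.
by set s := cos t ^+ 2; rewrite -mulr_natl; nra.
Qed.

(** The Berezin kernel at z vanishes along parallel lines whose spacing is of
    order 1/|z|. Turning z by a small angle shifts the phase by about a quarter
    turn near z, so the two kernels have no common zero there. *)
Lemma berezin_kernel_pair : exists2 k : R, 0 < k & forall z, 64 <= sqn z ->
  exists z', sqn z <= sqn z' /\
    forall w, box z w -> k <= berezin_kernel z w + berezin_kernel z' w.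
Proof.
(* On the box |w-z|^2 is at most 2 and |w-z'|^2 at most 4 + 2/alpha^2. *)
exists (expR (- (4 * alpha + 2 / alpha))); first exact: expR_gt0.
move=> z z64; set N := sqn z in z64.
have N0 : 0 < N by lra.
(* The phase at w is shifted by t * alpha * Re(z^* w), which is pi/2 at w = z. *)
pose t := pi / (2 * alpha * N).
have aN0 : 0 < 2 * alpha * N by rewrite !mulr_gt0.
have t0 : 0 <= t by rewrite divr_ge0 ?pi_ge0// ltW.
pose z' : R * R := (z.1 - t * z.2, z.2 + t * z.1).
have sz' : sqn z' = (1 + t ^+ 2) * N by rewrite /N /sqn /=; ring.
exists z'; split; first by rewrite sz' -/N mulrDl mul1r lerDl mulr_ge0 ?sqr_ge0// ltW.
move=> w [b1 b2].
have sq (a : R) : `|a| < 1 -> a ^+ 2 <= 1.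
  by move=> h; rewrite -(real_normK (num_real a)) expr_le1// ltW.
have q1 := sq _ b1; have q2 := sq _ b2.
have t2N : t ^+ 2 * N <= 1 / alpha ^+ 2.
  have -> : t ^+ 2 * N = pi ^+ 2 / (4 * N) / alpha ^+ 2.
    by rewrite /t; field; rewrite (gt_eqF N0) (gt_eqF alpha0).
  rewrite ler_pM2r ?invr_gt0 ?exprn_gt0// ler_pdivrMr ?mulr_gt0// mul1r.
  have := @pi_lt4; have := @pi_ge0 R; nra.
pose s := t * alpha * (z.1 * w.1 + z.2 * w.2).
have eB : alpha * (z'.1 * w.2 - z'.2 * w.1) = alpha * (z.1 * w.2 - z.2 * w.1) - s.
  by rewrite /z' /s /=; ring.
pose d := z.1 * (w.1 - z.1) + z.2 * (w.2 - z.2).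
have es : s - pi / 2 = pi / 2 * (d / N).
  rewrite /s /t (_ : z.1 * w.1 + z.2 * w.2 = d + N); last by rewrite /d /N /sqn; ring.
  by field; rewrite (gt_eqF N0) (gt_eqF alpha0).
have dN : `|d / N| <= 1 / 4.
  have d2 : d ^+ 2 <= 2 * N.
    have : d ^+ 2 <= (z.1 ^+ 2 + z.2 ^+ 2) * ((w.1 - z.1) ^+ 2 + (w.2 - z.2) ^+ 2).
      rewrite /d; set a := w.1 - z.1; set b := w.2 - z.2.
      have := sqr_ge0 (z.1 * b - z.2 * a).
      suff -> : (z.1 * b - z.2 * a) ^+ 2 = (z.1 ^+ 2 + z.2 ^+ 2) * (a ^+ 2 + b ^+ 2) -
          (z.1 * a + z.2 * b) ^+ 2 by lra.
      by ring.
    move=> h; apply: le_trans h _; rewrite -/(sqn z) -/N mulrC ler_pM2r//; lra.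
  rewrite -(@ler_pXn2r _ 2) ?nnegrE ?divr_ge0// real_normK ?num_real//.
  rewrite expr_div_n ler_pdivrMr ?exprn_gt0//; apply: le_trans d2 _.
  by nra.
have hs : `|s - pi / 2| <= 1 / 2.
  rewrite es normrM (ger0_norm (_ : 0 <= pi / 2)); last by rewrite divr_ge0 ?pi_ge0.
  have := normr_ge0 (d / N); have := @pihalf_lt2 R; have := @pi_ge0 R; nra.
have C := cos2_shift (alpha * (z.1 * w.2 - z.2 * w.1)) hs.
rewrite /berezin_kernel eB.
have a1 : 0 < alpha^-1 by rewrite invr_gt0.
have g1 : expR (- (4 * alpha + 2 / alpha)) <= gauss alpha z w.
  rewrite /gauss ler_expR lerN2 /sqn /=.
  have : alpha * ((w.1 - z.1) ^+ 2 + (w.2 - z.2) ^+ 2) <= alpha * 2.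
    by rewrite ler_pM2l//; lra.
  by have := alpha0; lra.
have g2 : expR (- (4 * alpha + 2 / alpha)) <= gauss alpha z' w.
  rewrite /gauss ler_expR lerN2 /sqn /=.
  have e : (w.1 - (z.1 - t * z.2)) ^+ 2 + (w.2 - (z.2 + t * z.1)) ^+ 2 <=
      4 + 2 / alpha ^+ 2.
    have h1 := sqr_ge0 ((w.1 - z.1) - t * z.2).
    have h2 := sqr_ge0 ((w.2 - z.2) + t * z.1).
    have : 2 * (t ^+ 2 * N) <= 2 / alpha ^+ 2 by lra.
    by rewrite /N /sqn; lra.
  apply: le_trans (ler_wpM2l (ltW alpha0) e) _.
  have -> : alpha * (4 + 2 / alpha ^+ 2) = 4 * alpha + 2 / alpha by field; rewrite gt_eqF.
  by [].
set k := expR _ in g1 g2 *; have k0 : 0 < k by exact: expR_gt0.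
set c1 := cos _ ^+ 2 in C *; set c2 := cos _ ^+ 2 in C *.
have c10 : 0 <= c1 by exact: sqr_ge0.
have c20 : 0 <= c2 by exact: sqr_ge0.
have := ler_wpM2r c10 g1; have := ler_wpM2r c20 g2.
have := ler_wpM2l (ltW k0) C.
lra.
Qed.

(** The second point of [berezin_kernel_pair] is at least as far out as the first,
    so both Berezin transforms are small. *)
Lemma berezin_boxes mu : berezin_to_0 mu -> boxes_to_0 mu.
Proof.
move=> Hb e e0; have [k k0 Hk] := berezin_kernel_pair.
have ke0 : 0 < k * e / 2 by rewrite divr_gt0// mulr_gt0.
have [M HM] := Hb _ ke0.
exists (Num.max M 64) => z; rewrite gt_max => /andP[zM z64].
have [z' [zz' Hz]] := Hk z (ltW z64).
have I1 := HM z zM; have I2 := HM z' (lt_le_trans zM zz').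
have L := @measure_le_integral R mu (box z) k (fun w => berezin_kernel z w + berezin_kernel z' w)
  (measurable_box z) k0 (measurable_funD (measurable_berezin_kernel z) (measurable_berezin_kernel z'))
  (fun w => addr_ge0 (berezin_kernel_ge0 z w) (berezin_kernel_ge0 z' w)) Hz.
have S : (\int[mu]_w (berezin_kernel z w + berezin_kernel z' w)%:E <= (k * e)%:E)%E.
  rewrite berezin_kernel_sum.
  by apply: le_trans (leeD (ltW I1) (ltW I2)) _; rewrite -EFinD lee_fin; lra.
have := le_trans L S; rewrite EFinM lee_pmul2l// ?lte_fin//.
Qed.

(** For the real points x and 2x the phases have ratio 2, so by [cos2_double] the
    kernels have no common zero, and x can be taken as large as the hypothesis
    demands. *)
Lemma berezin_locally_finite mu : berezin_to_0 mu -> locally_finite mu.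
Proof.
move=> Hb r; have [M HM] := Hb 1 ltr01.
pose x : R := `|M| + 1.
have x1 : 1 <= x by rewrite lerDr.
have xM : M < x ^+ 2 by have := ler_norm M; rewrite /x; have := normr_ge0 M; nra.
have I1 : (\int[mu]_w (berezin_kernel (x, 0%R) w)%:E < 1)%E.
  by apply: HM; rewrite /sqn /= expr0n addr0.
have I2 : (\int[mu]_w (berezin_kernel ((2 * x)%R, 0%R) w)%:E < 1)%E.
  apply: HM; rewrite /sqn /= expr0n addr0; apply: lt_trans xM _; nra.
pose k := expR (- (alpha * ((`|r| + 2 * x) ^+ 2 + `|r| ^+ 2))).
have k0 : 0 < k by exact: expR_gt0.
have g c w : 0 <= c <= 2 * x -> square r w -> k <= gauss alpha (c, 0) w.
  move=> /andP[c0 c1] [w1 w2]; rewrite /k /gauss ler_expR lerN2 ler_pM2l// /sqn /= subr0.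
  have rr := ler_norm r.
  apply: lerD; rewrite -[X in X <= _](real_normK (num_real _)); apply: lerXn2r; rewrite ?nnegrE//.
  - by rewrite addr_ge0//; lra.
  - by apply: le_trans (ler_normB _ _) _; rewrite (ger0_norm c0); lra.
  - exact: le_trans w2 rr.
have Hz w : square r w -> k / 2 <= berezin_kernel (x, 0) w + berezin_kernel (2 * x, 0) w.
  move=> Qw; have g1 : k <= gauss alpha (x, 0) w by apply: g => //; apply/andP; split; lra.
  have g2 : k <= gauss alpha (2 * x, 0) w by apply: g => //; apply/andP; split; lra.
  rewrite /berezin_kernel /= !mul0r !subr0.
  have -> : alpha * (2 * x * w.2) = 2 * (alpha * (x * w.2)) by ring.
  have C := cos2_double (alpha * (x * w.2)).
  set c1 := cos _ ^+ 2 in C *; set c2 := cos _ ^+ 2 in C *.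
  have c10 : 0 <= c1 by exact: sqr_ge0.
  have c20 : 0 <= c2 by exact: sqr_ge0.
  have := ler_wpM2r c10 g1; have := ler_wpM2r c20 g2.
  have := ler_wpM2l (ltW k0) C.
  lra.
have k20 : 0 < k / 2 by rewrite divr_gt0.
have L := @measure_le_integral R mu (square r) (k / 2)
  (fun w => berezin_kernel (x, 0) w + berezin_kernel (2 * x, 0) w)
  (measurable_square r) k20
  (measurable_funD (measurable_berezin_kernel (x, 0)) (measurable_berezin_kernel (2 * x, 0)))
  (fun w => addr_ge0 (berezin_kernel_ge0 (x, 0) w) (berezin_kernel_ge0 (2 * x, 0) w)) Hz.
have S : (\int[mu]_w (berezin_kernel (x, 0%R) w + berezin_kernel ((2 * x)%R, 0%R) w)%:E < +oo)%E.
  rewrite berezin_kernel_sum.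
  by apply: lte_add_pinfty; [apply: lt_trans I1 _|apply: lt_trans I2 _]; rewrite ltry.
have := le_lt_trans L S; rewrite ltNge; apply: contraPlt; rewrite leye_eq => /eqP ->.
by rewrite gt0_muley ?lte_fin// leye_eq.
Qed.

(** Boxes far away have small mass and the others lie in one square. *)
Lemma boxes_bounded mu : locally_finite mu -> boxes_to_0 mu ->
  exists2 B : R, 0 <= B & forall z, (mu (box z) <= B%:E)%E.
Proof.
move=> lf b0; have [M HM] := b0 1 ltr01.
pose r : R := `|M| + 2.
have f : mu (square r) \is a fin_num by rewrite ge0_fin_numE//; exact: lf.
exists (Num.max 1 (fine (mu (square r)))); first by rewrite le_max ler01.
move=> z; have [h|h] := ltP M (sqn z).
  by apply: le_trans (HM z h) _; rewrite lee_fin le_max lexx.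
apply: (@le_trans _ _ (mu (square r))); last first.
  by rewrite -[X in (X <= _)%E](fineK f) lee_fin le_max lexx orbT.
apply: le_measure; rewrite ?inE; [exact: measurable_box|exact: measurable_square|].
exact: box_in_square (le_trans h (ler_norm M)).
Qed.

(** Off a large square the Carleson estimate has a small constant; on the square
    the functions tend to 0 uniformly and the measure is finite. *)
Lemma integral_to_0 mu (u : nat -> R * R -> R) (M : R) :
  locally_finite mu -> boxes_to_0 mu -> (forall n, reproduced (u n)) ->
  (forall n, fock_sq (u n) <= M) ->
  (forall r e : R, 0 < e -> \forall n \near \oo, forall w, `|w.1| <= r -> `|w.2| <= r -> `|u n w| < e) ->
  forall e : R, 0 < e ->
    \forall n \near \oo, (\int[mu]_w (u n w ^+ 2 * wgt w)%:E <= e%:E)%E.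
Proof.
move=> lf b0 ru uM u0 e e0.
have M0 : 0 <= M by apply: le_trans (uM 0%N); exact: fock_sq_ge0.
pose K := 288 * expR (alpha / 2) * (M + 1).
have K0 : 0 < K by rewrite mulr_gt0 ?mulr_gt0 ?expR_gt0//; lra.
have eK : 0 < e / 2 / K by rewrite !divr_gt0.
have [M1 HM1] := b0 _ eK.
pose r : R := `|M1| + 2.
have mQ := @measurable_square R r.
have f : mu (square r) \is a fin_num by rewrite ge0_fin_numE//; exact: lf.
set m := fine (mu (square r)).
have m0 : 0 <= m by rewrite fine_ge0.
pose d : R := Num.min 1 (e / 2 / (m + 1)).
have d0 : 0 < d by rewrite lt_min ltr01 !divr_gt0//; lra.
have d1 : d <= 1 by rewrite ge_min lexx.
have dm : d * m <= e / 2.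
  have : d <= e / 2 / (m + 1) by rewrite ge_min lexx orbT.
  rewrite ler_pdivlMr; last by lra.
  by rewrite mulrDr mulr1; lra.
have HD z : (mu (box z `&` ~` square r) <= (e / 2 / K)%:E)%E.
  have mB := measurable_box z.
  have [h|h] := ltP M1 (sqn z).
    apply: le_trans (HM1 z h); apply: le_measure; rewrite ?inE//.
      by apply: measurableI => //; exact: measurableC.
  rewrite (_ : box z `&` ~` square r = set0) ?measure0 ?lee_fin ?ltW//.
  apply/seteqP; split=> // w [bw nQ]; apply: nQ.
  exact: box_in_square (le_trans h (ler_norm M1)) w bw.
have sf := locally_finite_sigma lf.
apply: filterS (u0 r d d0) => n un.
have mphi : measurable_fun [set: plane R] (fun w : plane R => (u n w ^+ 2 * wgt w)%:E).
  by apply/measurable_EFinP; exact: intble_meas (ru n).1.2.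
rewrite -(setUv (square r)) ge0_integral_setU//; last 4 first.
- exact: measurableC.
- by rewrite setUv.
- by move=> w _; rewrite lee_fin wsq_ge0.
- by rewrite disj_set2E setICr.
have I1 : (\int[mu]_(w in square r) (u n w ^+ 2 * wgt w)%:E <= (e / 2)%:E)%E.
  apply: (@le_trans _ _ (\int[mu]_(w in square r) (d%:E))%E).
    apply: ge0_le_integral => //.
    - by move=> w _; rewrite lee_fin wsq_ge0.
    - exact: measurable_funTS.
    - move=> w [w1 w2]; rewrite lee_fin; have h := un w w1 w2.
      have g1 : wgt w <= 1 by apply: gauss_le1; exact: ltW.
      have s1 : u n w ^+ 2 <= d.
        by rewrite -(real_normK (num_real (u n w))); have := normr_ge0 (u n w); nra.
      apply: le_trans s1; apply: ler_piMr => //; exact: sqr_ge0.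
  by rewrite integral_cst// -(fineK f) -EFinM lee_fin.
have I2 := Carleson_boxes alpha0 sf (measurableC mQ) HD (ru n).
apply: le_trans (leeD I1 I2) _; rewrite -EFinD lee_fin.
have -> : 288 * expR (alpha / 2) * (e / 2 / K) * fock_sq (u n) = e / 2 * (fock_sq (u n) / (M + 1)).
  rewrite /K; field; rewrite (gt_eqF (expR_gt0 _)) andbT.
  by rewrite gt_eqF//; lra.
have : fock_sq (u n) / (M + 1) <= 1.
  rewrite ler_pdivrMr ?mul1r; last by lra.
  by have := uM n; lra.
move=> h; have e20 : 0 <= e / 2 by rewrite divr_ge0// ltW.
by have := ler_wpM2l e20 h; lra.
Qed.

End BerezinBoxes.

(** * From complex functions to their real and imaginary parts *)

Import Normc.
Local Open Scope complex_scope.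

Section Dictionary.
Context {R : realType} (alpha : R) (alpha0 : 0 < alpha).
Implicit Types (f g : R * R -> R[i]) (z w : R * R) (mu : {measure set (plane R) -> \bar R}).
Notation wgt := (gauss alpha (0, 0)).
Notation reproduced := (reproduced alpha).
Notation fock_sq := (fock_sq alpha).
Notation KC := (KC alpha).
Notation KS := (KS alpha).
Notation half_wgt := (half_wgt alpha).
Notation Re f := (fun w : R * R => complex.Re (f w)).
Notation Im f := (fun w : R * R => complex.Im (f w)).

Lemma normc_sq (x : R[i]) : normc x ^+ 2 = complex.Re x ^+ 2 + complex.Im x ^+ 2.
Proof. by case: x => a b; rewrite /normc sqr_sqrtr// addr_ge0 ?sqr_ge0. Qed.

Lemma normc_cplx z : normc (cplx z) ^+ 2 = sqn z.
Proof. by rewrite normc_sq. Qed.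

Lemma Re_scale (x : R[i]) (k : R) : complex.Re (x * k%:C) = complex.Re x * k.
Proof. by case: x => a b; rewrite /= mulr0 subr0. Qed.

Lemma Im_scale (x : R[i]) (k : R) : complex.Im (x * k%:C) = complex.Im x * k.
Proof. by case: x => a b; rewrite /= mulr0 add0r. Qed.

Lemma weighted_sqE f w : weighted_sq alpha f w = Re f w ^+ 2 * wgt w + Im f w ^+ 2 * wgt w.
Proof.
rewrite /weighted_sq normc_sq Re_scale Im_scale !exprMn normc_cplx.
have -> : expR (- (alpha * sqn w / 2)) ^+ 2 = wgt w by rewrite wgtE expr2 -expRD; congr expR; field.
by [].
Qed.

Lemma fockKE z w : fockK alpha (cplx z) (cplx w) = KC z w +i* KS z w.
Proof.
rewrite /fockK /expC /KC /KS; case: z w => [x y] [a b] /=; simpc.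
by apply/eqP; rewrite eq_complex /=; apply/andP; split; apply/eqP;
  congr (expR _ * _); try congr cos; try congr sin; ring.
Qed.

Lemma harmHE z w : harmH alpha (cplx z) (cplx w) = (2 * KC z w)%:C.
Proof.
rewrite /harmH fockKE; simpc.
by apply/eqP; rewrite eq_complex /=; apply/andP; split; apply/eqP; ring.
Qed.

Lemma half_wgt_exp z : half_wgt z * expR (alpha * sqn z / 2) = 1.
Proof. by rewrite /half_wgt /gauss sqn0 -expRD -[RHS]expR0; congr expR; ring. Qed.

Lemma harmh_real z w : harmh alpha (cplx z) (cplx w) = (Num.sqrt 2 * half_wgt z * KC z w)%:C.
Proof.
rewrite harmhE !fockkE normc_cplx fockKE.
have -> : (expR (alpha * sqn z / 2))^-1 = half_wgt z.
  have e0 : expR (alpha * sqn z / 2) != 0 by rewrite gt_eqF ?expR_gt0.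
  by apply: (mulIf e0); rewrite mulVf// half_wgt_exp.
simpc; apply/eqP; rewrite eq_complex /=; apply/andP; split; apply/eqP; last by ring.
by field.
Qed.

Lemma berezin_kernelE z w : 2 * wgt z * (KC z w ^+ 2 * wgt w) = berezin_kernel alpha z w.
Proof.
rewrite /berezin_kernel /KC exprMn; set c := cos _ ^+ 2.
transitivity (2 * (wgt z * expR (alpha * (z.1 * w.1 + z.2 * w.2)) ^+ 2 * wgt w) * c); first by ring.
congr (_ * _ * _); rewrite !wgtE /gauss expr2 -!expRD; congr expR; rewrite /sqn /=; ring.
Qed.

Lemma harmh_sq_wgt z w : (Num.sqrt 2 * half_wgt z * KC z w) ^+ 2 * wgt w = berezin_kernel alpha z w.
Proof.
have s2 : Num.sqrt 2 ^+ 2 = 2 :> R by rewrite sqr_sqrtr.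
rewrite -berezin_kernelE -(half_wgt_sq _ z) -[X in X * _ ^+ 2]s2.
by set c := KC z w; ring.
Qed.

Lemma berezinE mu z : berezin alpha mu z = (\int[mu]_w (berezin_kernel alpha z w)%:E)%E.
Proof.
apply: eq_integral => w _; congr (_%:E); rewrite harmh_real normc_cplx -wgtE normc_sq /= expr0n addr0.
exact: harmh_sq_wgt.
Qed.

Lemma normc_gt (M : R) z : 0 <= M -> (M < normc (cplx z)) = (M ^+ 2 < sqn z).
Proof. by move=> M0; rewrite -normc_cplx ltr_pXn2r// nnegrE// /normc sqrtr_ge0. Qed.

Lemma berezin_vanishesE mu : berezin_vanishes alpha mu <-> berezin_to_0 alpha mu.
Proof.
split=> H e e0; have [M HM] := H e e0.
  exists (`|M| ^+ 2) => z; rewrite -normc_gt// => h.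
  by rewrite -berezinE; apply: HM; exact: le_lt_trans (ler_norm M) h.
exists (1 + `|M|) => z; have M1 : 0 <= 1 + `|M| by rewrite addr_ge0.
rewrite normc_gt// => h; rewrite berezinE; apply: HM; apply: le_lt_trans h.
by have := ler_norm M; have := normr_ge0 M; nra.
Qed.

Lemma harmonic_measurable u : harmonic_real u -> measurable_fun [set: plane R] (u : plane R -> R).
Proof. by move=> [[[_ _ cu _ _] _ _] _]; exact: continuous_plane_measurable. Qed.

Lemma F2h_normsqE f : measurable_fun [set: plane R] (Re f : plane R -> R) ->
  measurable_fun [set: plane R] (Im f : plane R -> R) ->
  F2h_normsq alpha f = ((alpha / pi)%:E * (\int[area R]_w (Re f w ^+ 2 * wgt w)%:E +
    \int[area R]_w (Im f w ^+ 2 * wgt w)%:E))%E.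
Proof.
move=> mr mi.
have mw : measurable_fun [set: plane R] (wgt : plane R -> R).
  by exact: measurable_gauss.
have m2 (u : R * R -> R) : measurable_fun [set: plane R] (u : plane R -> R) ->
    measurable_fun [set: plane R] (fun w : plane R => (u w ^+ 2 * wgt w)%:E).
  by move=> m; apply/measurable_EFinP; apply: measurable_funM => //; exact: measurable_funX.
have p0 : 0 <= alpha / pi by rewrite divr_ge0 ?pi_ge0// ltW.
rewrite -ge0_integralD//; last 4 first.
- by move=> w _; rewrite lee_fin; exact: (wsq_ge0 _ (fun w => complex.Re (f w))).
- exact: m2.
- by move=> w _; rewrite lee_fin; exact: (wsq_ge0 _ (fun w => complex.Im (f w))).
- exact: m2.
rewrite -ge0_integralZl//; last 2 first.
- by apply: emeasurable_funD; exact: m2.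
- by move=> w _; rewrite -EFinD lee_fin -mulrDl mulr_ge0 ?gauss_ge0// addr_ge0 ?sqr_ge0.
apply: eq_integral => w _; rewrite -EFinD -EFinM; congr (_%:E).
rewrite normc_sq normc_cplx -wgtE; ring.
Qed.

(** Square integrable harmonic functions satisfy the reproducing formula, and
    conversely kernel integrals are harmonic. *)
Lemma F2h_reproduced f : F2h alpha f <-> reproduced (Re f) /\ reproduced (Im f).
Proof.
split=> [[[hr hi] fin]|[rr ri]].
  have mr := harmonic_measurable hr; have mi := harmonic_measurable hi.
  have p0 : 0 < alpha / pi by rewrite divr_gt0 ?pi_gt0.
  have fin2 : (\int[area R]_w (Re f w ^+ 2 * wgt w)%:E +
      \int[area R]_w (Im f w ^+ 2 * wgt w)%:E < +oo)%E.
    move: fin; rewrite F2h_normsqE//; case: (_ + _)%E => [r _| |//]; first by rewrite ltry.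
    by rewrite gt0_muley.
  have Ige0 (u : R * R -> R) : (0 <= \int[area R]_w (u w ^+ 2 * wgt w)%:E)%E.
    by apply: integral_ge0 => w _; rewrite lee_fin wsq_ge0.
  have L (u : R * R -> R) : measurable_fun [set: plane R] (u : plane R -> R) ->
     (\int[area R]_w (u w ^+ 2 * wgt w)%:E < +oo)%E -> weighted_L2 alpha (area R) u.
    move=> m h; split=> //; apply: intble_ge0 => //; last by move=> w; exact: wsq_ge0.
    apply: measurable_funM; first exact: measurable_funX.
    by exact: measurable_gauss.
  split; apply: harmonic_reproduced => //; apply: L => //; apply: le_lt_trans fin2.
    by rewrite leeDl.
  by rewrite leeDr.
split; first by split; [exact: (reproduced_harmonic alpha0 rr)|exact: (reproduced_harmonic alpha0 ri)].
have [[mr ir] _] := rr; have [[mi ii] _] := ri.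
by rewrite F2h_normsqE// (EFin_Rint ir) (EFin_Rint ii) -EFinD -EFinM ltry.
Qed.

Lemma F2h_normE f : F2h alpha f ->
  F2h_norm alpha f = (Num.sqrt (alpha / pi * (fock_sq (Re f) + fock_sq (Im f))))%:E.
Proof.
move=> /F2h_reproduced[[[mr ir] _] [[mi ii] _]].
by rewrite /F2h_norm F2h_normsqE// (EFin_Rint ir) (EFin_Rint ii) -EFinD -EFinM.
Qed.

Lemma weighted_sq_mu mu f : F2h alpha f ->
  (\int[mu]_w (weighted_sq alpha f w)%:E = \int[mu]_w (Re f w ^+ 2 * wgt w)%:E +
    \int[mu]_w (Im f w ^+ 2 * wgt w)%:E)%E.
Proof.
move=> /F2h_reproduced[[[mr ir] _] [[mi ii] _]].
rewrite -ge0_integralD//; first by apply: eq_integral => w _; rewrite weighted_sqE.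
- by move=> w _; rewrite lee_fin; exact: (wsq_ge0 _ (fun w => complex.Re (f w))).
- by have /measurable_EFinP := intble_meas ir.
- by move=> w _; rewrite lee_fin; exact: (wsq_ge0 _ (fun w => complex.Im (f w))).
- by have /measurable_EFinP := intble_meas ii.
Qed.

Lemma weighted_sq_area f : F2h alpha f ->
  (\int[area R]_w (weighted_sq alpha f w)%:E = (fock_sq (Re f) + fock_sq (Im f))%:E)%E.
Proof.
move=> Ff; have [[[_ ir] _] [[_ ii] _]] := (F2h_reproduced f).1 Ff.
by rewrite (weighted_sq_mu _ Ff) (EFin_Rint ir) (EFin_Rint ii) -EFinD.
Qed.

Lemma F2h_bounded_fock_sq (f : nat -> R * R -> R[i]) : F2h_bounded alpha f ->
  exists M : R, forall n, fock_sq (Re (f n)) <= M /\ fock_sq (Im (f n)) <= M.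
Proof.
move=> [F [M HM]]; exists (pi / alpha * M ^+ 2) => n.
have := HM n; rewrite F2h_normE// lee_fin.
have a0 := fock_sq_ge0 alpha (Re (f n)); have b0 := fock_sq_ge0 alpha (Im (f n)).
have p0 : 0 < alpha / pi by rewrite divr_gt0 ?pi_gt0.
set s := fock_sq _ + fock_sq _ => h.
have s0 : 0 <= alpha / pi * s by rewrite mulr_ge0 ?addr_ge0// ltW.
have : alpha / pi * s <= M ^+ 2.
  by rewrite -(sqr_sqrtr s0) lerXn2r ?nnegrE ?sqrtr_ge0//; apply: le_trans h; exact: sqrtr_ge0.
rewrite -ler_pdivlMl// invf_div => h2; rewrite /s in h2.
by split; lra.
Qed.

Lemma F2h_norm_cvg0 (f : nat -> R * R -> R[i]) : (forall n, F2h alpha (f n)) ->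
  (F2h_norm alpha (f n) @[n --> \oo] --> 0%E) <->
  (fock_sq (Re (f n)) + fock_sq (Im (f n)) @[n --> \oo] --> (0 : R)).
Proof.
move=> F; have p0 : 0 < alpha / pi by rewrite divr_gt0 ?pi_gt0.
have s0 n : 0 <= fock_sq (Re (f n)) + fock_sq (Im (f n)) by rewrite addr_ge0 ?fock_sq_ge0.
have s1 n : 0 <= alpha / pi * (fock_sq (Re (f n)) + fock_sq (Im (f n))).
  by rewrite mulr_ge0// ltW.
rewrite (_ : (fun n => F2h_norm alpha (f n)) = (fun n =>
  (Num.sqrt (alpha / pi * (fock_sq (Re (f n)) + fock_sq (Im (f n)))))%:E)); last first.
  by apply/funext => n; exact: F2h_normE.
split=> [H|H].
  pose x n := Num.sqrt (alpha / pi * (fock_sq (Re (f n)) + fock_sq (Im (f n)))).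
  have {}H : x n @[n --> \oo] --> (0 : R) by exact: (@fine_cvg _ _ \oo _ _ _ H).
  have {}H : (alpha / pi)^-1 * (x n * x n) @[n --> \oo] --> ((alpha / pi)^-1 * (0 * 0) : R).
    by apply: seq_cvgZ; apply: cvgM.
  rewrite !mulr0 in H; move: H; apply: cvg_trans; apply: near_eq_cvg; near=> n.
  by rewrite /x -expr2 sqr_sqrtr// mulKf// gt_eqF.
apply: cvg_EFin; first by near=> n.
have := seq_cvgZ (c := alpha / pi) H; rewrite mulr0 => {}H.
have : Num.sqrt (alpha / pi * (fock_sq (Re (f n)) + fock_sq (Im (f n)))) @[n --> \oo] -->
    (Num.sqrt 0 : R) by apply: continuous_cvg; [exact: sqrt_continuous|exact: H].
by rewrite sqrtr0.
Unshelve. all: by end_near. Qed.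

End Dictionary.

(** * The three implications *)

Section Equivalence.
Context {R : realType} (alpha : R) (alpha0 : 0 < alpha).
Context (mu : {measure set (plane R) -> \bar R}).
Implicit Types (f g : R * R -> R[i]) (z w : R * R) (p : R * R -> R).
Notation wgt := (gauss alpha (0, 0)).
Notation reproduced := (reproduced alpha).
Notation fock_sq := (fock_sq alpha).
Notation KC := (KC alpha).
Notation KS := (KS alpha).
Notation half_wgt := (half_wgt alpha).
Notation toep := (toep alpha mu).
Notation Re f := (fun w : R * R => complex.Re (f w)).
Notation Im f := (fun w : R * R => complex.Im (f w)).

Lemma toeplitz_integrandE f z w : toeplitz_integrand alpha f z w =
  (2 * (Re f w * KC z w * wgt w)) +i* (2 * (Im f w * KC z w * wgt w)).
Proof.
rewrite /toeplitz_integrand harmHE normc_cplx -wgtE; case: (f w) => a b /=.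
by simpc; apply/eqP; rewrite eq_complex /=; apply/andP; split; apply/eqP; ring.
Qed.

Lemma intble_half p : mu.-integrable setT (EFin \o (fun w : plane R => 2 * p w)) ->
  mu.-integrable setT (EFin \o (p : plane R -> R)).
Proof.
move=> /(intbleZ 2^-1); congr (mu.-integrable _ _); apply/funext => w /=.
by rewrite mulKf.
Qed.

Lemma integrable_toeplitz f z : integrableC mu (toeplitz_integrand alpha f z) <->
  mu.-integrable setT (EFin \o (fun w : plane R => Re f w * KC z w * wgt w)) /\
  mu.-integrable setT (EFin \o (fun w : plane R => Im f w * KC z w * wgt w)).
Proof.
rewrite /integrableC.
under eq_fun do rewrite toeplitz_integrandE /=.
under [X in _ /\ mu.-integrable _ X]eq_fun do rewrite toeplitz_integrandE /=.
split=> -[h1 h2]; split; [exact: intble_half h1|exact: intble_half h2|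
  exact: intbleZ h1|exact: intbleZ h2].
Qed.

Lemma toeplitzE f z : integrableC mu (toeplitz_integrand alpha f z) ->
  toeplitz alpha mu f z = toep (Re f) z +i* toep (Im f) z.
Proof.
move=> /integrable_toeplitz[i1 i2]; rewrite /toeplitz /integralC /toep.
rewrite -!RintZ//.
by congr (_ +i* _); apply: eq_Rintegral => w _; rewrite toeplitz_integrandE.
Qed.

Definition kern (c : R) z w : R[i] := (c * KC z w)%:C.

Lemma reproduced0 : reproduced (fun=> 0).
Proof.
have := reproduced_lin alpha0 0 0 (reproduced_KC alpha0 (0, 0)) (reproduced_KC alpha0 (0, 0)).
by congr (reproduced _); apply/funext => w; rewrite !mul0r addr0.
Qed.

Lemma reproducedZ (c : R) p : reproduced p -> reproduced (fun w => c * p w).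
Proof.
move=> rp; have := reproduced_lin alpha0 c 0 rp rp.
by congr (reproduced _); apply/funext => w; rewrite mul0r addr0.
Qed.

Lemma reproducedB u v : reproduced u -> reproduced v -> reproduced (fun w => u w - v w).
Proof.
move=> ru rv; have := reproduced_lin alpha0 1 (-1) ru rv.
by congr (reproduced _); apply/funext => w; rewrite mul1r mulN1r.
Qed.

Lemma F2h_kern c z : F2h alpha (kern c z).
Proof.
apply/(F2h_reproduced alpha0); split; last exact: reproduced0.
by apply: reproducedZ; exact: reproduced_KC.
Qed.

Lemma Rint0 (m : {measure set (plane R) -> \bar R}) p :
  (forall w, p w = 0) -> \int[m]_w p w = 0.
Proof. by move=> h; rewrite /Rintegral integral0_eq// => w _; rewrite h. Qed.

Lemma fock_sq0 : fock_sq (fun=> 0) = 0.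
Proof.
by apply: Rint0 => w; rewrite expr0n mul0r.
Qed.

Lemma fock_sqZ (c : R) p : weighted_L2 alpha (area R) p ->
  fock_sq (fun w => c * p w) = c ^+ 2 * fock_sq p.
Proof.
move=> [mp ip]; rewrite /fock_sq -RintZ//; apply: eq_Rintegral => w _.
by rewrite exprMn mulrA.
Qed.

(** The reproducing formula at z computes the norm of the kernel. *)
Lemma fock_sq_KC z : fock_sq (KC z) * wgt z <= pi / alpha.
Proof.
have [[_ iz] /(_ z)] := reproduced_KC alpha0 z.
have -> : \int[area R]_w (KC z w * KC z w * wgt w) = fock_sq (KC z).
  by apply: eq_Rintegral => w _; rewrite -expr2.
have an0 : alpha != 0 by rewrite gt_eqF.
have pn0 : pi != 0 :> R by rewrite gt_eqF// pi_gt0.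
move=> h; have -> : fock_sq (KC z) = pi / (2 * alpha) * (KC z z + KC z (0, 0)).
  have E (a p F : R) : a != 0 -> p != 0 -> F = p / (2 * a) * (2 * a / p * F).
    by move=> ha hp; field; rewrite ha hp.
  by rewrite h; exact: E.
have -> : KC z (0, 0) = 1 by rewrite KC_sym KC0.
have e1 : KC z z * wgt z = 1.
  rewrite /KC (_ : z.1 * z.2 - z.2 * z.1 = 0) ?mulr0 ?cos0 ?mulr1; last by ring.
  by rewrite wgtE -expRD -[RHS]expR0; congr expR; rewrite /sqn; ring.
have w1 : wgt z <= 1 by apply: gauss_le1; exact: ltW.
have -> : pi / alpha = pi / (2 * alpha) * 2 by field; rewrite gt_eqF.
rewrite -mulrA; apply: ler_wpM2l; last by rewrite mulrDl e1 mul1r; lra.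
by rewrite divr_ge0 ?pi_ge0// mulr_ge0// ltW.
Qed.

Section CompactToBerezin.
Hypothesis Tc : toeplitz_compact alpha mu.

Lemma kern_toeplitz c z : toeplitz alpha mu (kern c z) = fun x => (c * toep (KC z) x)%:C.
Proof.
apply/funext => x; have I := Tc.1 _ (F2h_kern c z) x.
have [I1 _] := (integrable_toeplitz _ _).1 (Tc.1 _ (F2h_kern 1 z) x).
rewrite toeplitzE// /toep; congr (_ +i* _); rewrite /=; last first.
  by rewrite Rint0 ?mulr0// => w; rewrite !mul0r.
rewrite [RHS]mulrCA; congr (_ * _); rewrite -RintZ; last first.
  by move: I1; congr (mu.-integrable _ _); apply/funext => w /=; rewrite mul1r.
by apply: eq_Rintegral => w _; rewrite !mulrA.
Qed.

Lemma reproduced_toep_KC z : reproduced (toep (KC z)).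
Proof.
have [T1 _ _] := Tc.2; have /(F2h_reproduced alpha0)[] := T1 _ (F2h_kern 1 z).
by rewrite kern_toeplitz /= => + _; congr (reproduced _); apply/funext => w; rewrite mul1r.
Qed.

Lemma toep_KC_sym z x : toep (KC z) x = toep (KC x) z.
Proof.
rewrite /toep; congr (_ * _); apply: eq_Rintegral => w _; congr (_ * _).
exact: mulrC.
Qed.

Lemma berezin_toep z :
  (\int[mu]_w (berezin_kernel alpha z w)%:E = (wgt z * toep (KC z) z)%:E)%E.
Proof.
have [I1 _] := (integrable_toeplitz _ _).1 (Tc.1 _ (F2h_kern 1 z) z).
have {}I1 : mu.-integrable setT (EFin \o (fun w : plane R => KC z w ^+ 2 * wgt w)).
  by move: I1; congr (mu.-integrable _ _); apply/funext => w /=; rewrite mul1r expr2.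
have := EFin_Rint (intbleZ (2 * wgt z) I1).
under eq_integral do rewrite berezin_kernelE.
move=> ->; rewrite RintZ// /toep; congr (_%:E).
rewrite mulrCA mulrA; congr (_ * _); apply: eq_Rintegral => w _.
Qed.

(** Normalised kernels at points escaping to infinity form a bounded family, and
    their images tend pointwise to 0: by symmetry T h_z(x) is a value at z
    of T K_x, which is small compared with the growth of the kernel. Compactness
    makes the images small in norm, and the Berezin transform at z is, up to the
    weight, the value of T h_z at z. *)
Lemma compact_berezin (z : nat -> R * R) : (forall n, n%:R <= sqn (z n)) ->
  exists phi : nat -> nat, (wgt (z (phi k)) * toep (KC (z (phi k))) (z (phi k))) ^+ 2 @[k --> \oo] --> (0 : R).
Proof.
move=> zn; pose c n := Num.sqrt 2 * half_wgt (z n).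
have s2 : Num.sqrt 2 ^+ 2 = 2 :> R by rewrite sqr_sqrtr.
have an0 : alpha != 0 by rewrite gt_eqF.
have pn0 : pi != 0 :> R by rewrite gt_eqF// pi_gt0.
have c2 n : c n ^+ 2 = 2 * wgt (z n) by rewrite exprMn s2 half_wgt_sq.
have p0 : 0 < alpha / pi by rewrite divr_gt0 ?pi_gt0.
have B : F2h_bounded alpha (fun n => kern (c n) (z n)).
  split=> [n|]; first exact: F2h_kern.
  exists (Num.sqrt 2) => n; rewrite (F2h_normE alpha0 (F2h_kern _ _)) lee_fin ler_sqrt// /= fock_sq0 addr0.
  rewrite (fock_sqZ _ (area_KC_L2 alpha0 _)) c2.
  have := fock_sq_KC (z n); rewrite -(ler_pM2l p0).
  have E (a p : R) : a != 0 -> p != 0 -> a / p * (p / a) = 1.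
    by move=> ha hp; field; rewrite ha hp.
  rewrite (E _ _ an0 pn0).
  by lra.
have [T1 _ T3] := Tc.2; have [phi [phi_inc [g [Fg cv]]]] := T3 _ B.
exists phi; have phi_ge k : (k <= phi k)%N.
  by elim: k => // k IH; apply: leq_ltn_trans IH _; exact: phi_inc.
pose y k := z (phi k).
have yn k : k%:R <= sqn (y k) by apply: le_trans (zn _); rewrite ler_nat.
pose u k x := c (phi k) * toep (KC (y k)) x.
have ru k : reproduced (u k) by apply: reproducedZ; exact: reproduced_toep_KC.
have [rg rg'] := (F2h_reproduced alpha0 _).1 Fg.
pose v k x := u k x - complex.Re (g x).
have rv k : reproduced (v k) by exact: reproducedB.
have F k : F2h alpha (fun w => toeplitz alpha mu (kern (c (phi k)) (z (phi k))) w - g w).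
  apply/(F2h_reproduced alpha0); rewrite kern_toeplitz; split.
    by move: (rv k); congr (reproduced _); apply/funext => w; rewrite /v; case: (g w).
  move: (reproducedB reproduced0 rg'); congr (reproduced _); apply/funext => w.
  by case: (g w).
have := (F2h_norm_cvg0 alpha0 F).1 cv => {}cv.
have vcv : fock_sq (v k) @[k --> \oo] --> (0 : R).
  apply: seq_cvg0_le cv => k; rewrite fock_sq_ge0/=.
  have -> : (fun w => complex.Re (toeplitz alpha mu (kern (c (phi k)) (z (phi k))) w - g w)) = v k.
    by apply/funext => w; rewrite kern_toeplitz /v /u /y; case: (g w).
  by rewrite lerDl fock_sq_ge0.
have C0 : 0 <= 36 * alpha / pi by rewrite divr_ge0 ?pi_ge0// mulr_ge0// ltW.
have g0 x : complex.Re (g x) = 0.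
  have u0 : u k x ^+ 2 @[k --> \oo] --> (0 : R).
    have := seq_cvgZ (c := 2) (reproduced_vanish alpha0 (reproduced_toep_KC x) yn).
    rewrite mulr0; apply: cvg_trans; apply: near_eq_cvg; near=> k.
    by rewrite /u (exprMn _ (c (phi k))) c2 toep_KC_sym -/(y k); ring.
  have v0 : v k x ^+ 2 * wgt x @[k --> \oo] --> (0 : R).
    have := seq_cvgZ (c := 36 * alpha / pi) vcv; rewrite mulr0; apply: seq_cvg0_le => k.
    by rewrite mulr_ge0 ?sqr_ge0 ?gauss_ge0//= reproduced_sup.
  have : complex.Re (g x) ^+ 2 * wgt x = 0.
    have h := seq_cvgD (seq_cvgZ (c := 2 * wgt x) u0) (seq_cvgZ (c := 2) v0).
    rewrite !mulr0 addr0 in h.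
    apply: (@seq_cvg_unique _ (fun=> complex.Re (g x) ^+ 2 * wgt x)); first exact: cvg_cst.
    apply: seq_cvg0_le h => k; rewrite mulr_ge0 ?sqr_ge0 ?gauss_ge0//=.
    have := mulr_ge0 (sqr_ge0 (2 * u k x - complex.Re (g x))) (gauss_ge0 alpha (0, 0) x).
    by rewrite /v; set a := u k x; set b := complex.Re _; lra.
  by move/eqP; rewrite mulf_eq0 (gt_eqF (gauss_gt0 _ _ _)) orbF sqrf_eq0 => /eqP.
have := seq_cvgZ (c := 18 * alpha / pi) vcv; rewrite mulr0; apply: seq_cvg0_le => k.
rewrite sqr_ge0/=; have := reproduced_sup alpha0 (y k) (rv k).
rewrite {1}/v g0 subr0 /u exprMn c2 -/(y k).
set a := toep _ _; set b := wgt _; set d := fock_sq _.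
have -> : 36 * alpha / pi * d = 2 * (18 * alpha / pi * d) by ring.
have -> : 2 * b * a ^+ 2 * b = 2 * (b * a) ^+ 2 by ring.
by rewrite ler_pM2l.
Unshelve. all: by end_near. Qed.

Lemma compact_to_0 : berezin_to_0 alpha mu.
Proof.
move=> e e0; apply: contrapT => /forallNP H.
have /choice[z Hz] : forall n : nat, exists z, n%:R <= sqn z /\ e <= wgt z * toep (KC z) z.
  move=> n; have /existsNP[z /not_implyP[h1 h2]] := H n%:R.
  exists z; split; first exact: ltW.
  by move: h2; rewrite berezin_toep lte_fin => /negP; rewrite -leNgt.
have [phi cv] := compact_berezin (fun n => (Hz n).1).
have e2 : 0 < e ^+ 2 by rewrite exprn_gt0.
have /cvgr0Pnorm_lt /(_ _ e2) := cv.
move=> /filter_ex[k]; rewrite ger0_norm ?sqr_ge0// ltNge => /negP; apply.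
by rewrite lerXn2r ?nnegrE ?(Hz (phi k)).2//; [exact: ltW|exact: le_trans (ltW e0) (Hz (phi k)).2].
Qed.

End CompactToBerezin.

Lemma cvge_small (x : nat -> \bar R) : (forall n, 0 <= x n)%E ->
  (forall e : R, 0 < e -> \forall n \near \oo, (x n <= e%:E)%E) -> x n @[n --> \oo] --> 0%E.
Proof.
move=> x0 H; apply/fine_cvgP; split.
  apply: filterS (H 1 ltr01) => n h; rewrite ge0_fin_numE//.
  by apply: le_lt_trans h _; rewrite ltry.
apply/cvgr0Pnorm_lt => e e0; have e20 : 0 < e / 2 by rewrite divr_gt0.
apply: filterS (H _ e20) => n h.
have f : x n \is a fin_num by rewrite ge0_fin_numE//; apply: le_lt_trans h _; rewrite ltry.
move: h; rewrite -(fineK f) lee_fin /= ger0_norm ?fine_ge0// => h; lra.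
Qed.

(** The Carleson inequality and its vanishing both follow from the masses of boxes,
    bounded everywhere and small far away. *)
Lemma berezin_to_carleson : berezin_to_0 alpha mu -> vanishing_fock_carleson alpha mu.
Proof.
move=> H; have b0 := berezin_boxes alpha0 H; have lf := berezin_locally_finite alpha0 H.
have [B B0 HB] := boxes_bounded lf b0; have sf := locally_finite_sigma lf.
pose K := 288 * expR (alpha / 2) * B.
have K0 : 0 <= K by rewrite !mulr_ge0// expR_ge0.
have L p : reproduced p -> (\int[mu]_w (p w ^+ 2 * wgt w)%:E <= (K * fock_sq p)%:E)%E.
  by move=> rp; apply: (Carleson_boxes alpha0 sf measurableT _ rp) => z; rewrite setIT.
split.
  exists (K + 1); first by lra.
  move=> f Ff; have [rr ri] := (F2h_reproduced alpha0 f).1 Ff.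
  rewrite (weighted_sq_area alpha0 Ff) (weighted_sq_mu alpha0 mu Ff).
  apply: le_trans (leeD (L _ rr) (L _ ri)) _; rewrite -EFinM -EFinD lee_fin.
  have := fock_sq_ge0 alpha (Re f); have := fock_sq_ge0 alpha (Im f); lra.
move=> f Bf f0; have [M HM] := F2h_bounded_fock_sq alpha0 Bf.
have sq0 (r e : R) : 0 < e -> \forall n \near \oo, forall w, `|w.1| <= r -> `|w.2| <= r -> normc (f n w) < e.
  move=> e0; have cQ : compact (`[- r, r]%classic `*` `[- r, r]%classic : set (R * R)).
    by apply: compact_setX; exact: segment_compact.
  apply: filterS (f0 _ cQ _ e0) => n h w w1 w2; apply: h.
  by split; rewrite /= in_itv/= -ler_norml.
have absle (x : R[i]) : `|complex.Re x| <= normc x /\ `|complex.Im x| <= normc x.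
  have n0 : 0 <= normc x by case: (x) => a b; rewrite /normc sqrtr_ge0.
  split; rewrite -(@ler_pXn2r _ 2) ?nnegrE// real_normK ?num_real// normc_sq.
    by rewrite lerDl sqr_ge0.
  by rewrite lerDr sqr_ge0.
have FR n := (F2h_reproduced alpha0 (f n)).1 (Bf.1 n).
have I1 := integral_to_0 alpha0 lf b0 (fun n => (FR n).1) (fun n => (HM n).1).
have I2 := integral_to_0 alpha0 lf b0 (fun n => (FR n).2) (fun n => (HM n).2).
have h1 (e : R) : 0 < e -> \forall n \near \oo, (\int[mu]_w (Re (f n) w ^+ 2 * wgt w)%:E <= e%:E)%E.
  apply: I1 => r d d0; apply: filterS (sq0 r d d0) => n h w w1 w2.
  exact: le_lt_trans (absle _).1 (h w w1 w2).
have h2 (e : R) : 0 < e -> \forall n \near \oo, (\int[mu]_w (Im (f n) w ^+ 2 * wgt w)%:E <= e%:E)%E.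
  apply: I2 => r d d0; apply: filterS (sq0 r d d0) => n h w w1 w2.
  exact: le_lt_trans (absle _).2 (h w w1 w2).
apply: cvge_small => [n|e e0].
  by apply: integral_ge0 => w _; rewrite lee_fin /weighted_sq sqr_ge0.
have e20 : 0 < e / 2 by rewrite divr_gt0.
apply: filterS2 (h1 _ e20) (h2 _ e20) => n {}h1 {}h2.
rewrite (weighted_sq_mu alpha0 mu (Bf.1 n)); apply: le_trans (leeD h1 h2) _.
by rewrite -EFinD lee_fin; lra.
Qed.
(** Tested on $K_z$, the Carleson inequality compares Gaussian averages of mu with
    those of area. *)
Lemma carleson_gauss : fock_carleson alpha mu -> exists2 C : R, 0 <= C &
  forall z, (\int[mu]_w (gauss alpha z w)%:E <= C%:E)%E.
Proof.
move=> [C C0 HC]; exists (C * (pi / alpha)).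
  by apply: mulr_ge0; [exact: ltW|apply: divr_ge0; [exact: pi_ge0|exact: ltW]].
move=> z; pose f w : R[i] := KC z w +i* KS z w.
have Ff : F2h alpha f.
  by apply/(F2h_reproduced alpha0); split; [exact: reproduced_KC|exact: reproduced_KS].
have E w : weighted_sq alpha f w = expR (alpha * sqn z) * gauss alpha z w.
  by rewrite weighted_sqE -mulrDl KC2_KS2 -expR_wgt expr2 -expRD; congr (expR _ * _); ring.
have I (nu : {measure set (plane R) -> \bar R}) : (\int[nu]_w (weighted_sq alpha f w)%:E =
    (expR (alpha * sqn z))%:E * \int[nu]_w (gauss alpha z w)%:E)%E.
  under eq_integral do rewrite E EFinM.
  apply: ge0_integralZl; rewrite ?lee_fin ?expR_ge0//.
    apply/measurable_EFinP; apply: (@continuous_plane_measurable R (gauss alpha z)).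
    exact: continuous_gauss.
  by move=> w _; rewrite lee_fin gauss_ge0.
have := HC f Ff; rewrite !I muleCA lee_pmul2l// ?lte_fin ?expR_gt0// => h.
by apply: le_trans h _; rewrite (integral_gauss z alpha0) -EFinM.
Qed.

Lemma carleson_box_bound : fock_carleson alpha mu ->
  locally_finite mu /\ exists B : R, forall z, (mu (box z) <= B%:E)%E.
Proof.
move=> /carleson_gauss[C C0 HC].
have mg z : measurable_fun [set: plane R] (gauss alpha z : plane R -> R).
  by exact: measurable_gauss.
have L z (A : set (plane R)) (k : R) : measurable A -> 0 < k ->
    (forall w, A w -> k <= gauss alpha z w) -> (mu A <= (C / k)%:E)%E.
  move=> mA k0 kA.
  have := le_trans (measure_le_integral mu mA k0 (mg z) (gauss_ge0 alpha z) kA) (HC z).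
  by rewrite mulrC EFinM -lee_pdivlMl.
have sq (a r : R) : `|a| <= r -> a ^+ 2 <= r ^+ 2.
  move=> h; rewrite -(real_normK (num_real a)) lerXn2r// nnegrE//.
  exact: le_trans h.
split=> [r|].
  apply: le_lt_trans (L (0, 0) _ (expR (- (alpha * (2 * r ^+ 2)))) (measurable_square r) (expR_gt0 _) _) _;
    last by rewrite ltry.
  move=> w [/sq w1 /sq w2]; rewrite /gauss ler_expR lerN2 ler_pM2l// sqn0 /sqn; lra.
exists (C / expR (- (alpha * 2))) => z; apply: (L z _ _ (measurable_box z) (expR_gt0 _)).
move=> w [/ltW/sq w1 /ltW/sq w2]; rewrite /gauss ler_expR lerN2 ler_pM2l// /sqn /=.
by move: w1 w2; rewrite expr1n; lra.
Qed.

Lemma fock_sqB_le u v : weighted_L2 alpha (area R) u -> weighted_L2 alpha (area R) v ->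
  fock_sq (fun w => u w - v w) <= 2 * fock_sq u + 2 * fock_sq v.
Proof.
move=> U V; have D := weighted_L2_lin 1 (-1) U V.
have -> : fock_sq (fun w => u w - v w) = fock_sq (fun w => 1 * u w + -1 * v w).
  by congr (fock_sq _); apply/funext => w; rewrite mul1r mulN1r.
rewrite /fock_sq -!RintZ ?(U.2, V.2)// -RintD; [|exact: intbleZ U.2|exact: intbleZ V.2].
apply: Rint_le; [exact: D.2|exact: intbleD (intbleZ 2 U.2) (intbleZ 2 V.2)|].
move=> w; have := mulr_ge0 (sqr_ge0 (u w + v w)) (gauss_ge0 alpha (0, 0) w).
by set c := wgt w; lra.
Qed.

Lemma normc_le (x : R[i]) : normc x <= `|complex.Re x| + `|complex.Im x|.
Proof.
have n0 : 0 <= normc x by case: (x) => a b; rewrite /normc sqrtr_ge0.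
rewrite -(@ler_pXn2r _ 2) ?nnegrE ?addr_ge0// normc_sq sqrrD !real_normK ?num_real//.
by rewrite -addrA lerD2l lerDr mulrn_wge0// mulr_ge0.
Qed.

(** A bounded sequence converges uniformly on compact sets along a subsequence;
    the differences with the limit tend to 0 in $L^2(\mu)$ by the vanishing
    condition, and the operator is bounded from there to the Fock space. *)
Lemma carleson_to_compact : vanishing_fock_carleson alpha mu -> toeplitz_compact alpha mu.
Proof.
move=> [HC Hv]; have [lf [B HB]] := carleson_box_bound HC.
have sf := locally_finite_sigma lf; have a20 : 0 < alpha / 2 by rewrite divr_gt0.
set B' := B * (expR (2 * (alpha / 2)) * (2 * pi / (alpha / 2))).
have {HB} HB z : (\int[mu]_w (gauss (alpha / 2) z w)%:E <= B'%:E)%E by exact: gauss_integral_le.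
have muL f : F2h alpha f -> weighted_L2 alpha mu (Re f) /\ weighted_L2 alpha mu (Im f).
  move=> Ff; have [[[mr ir] _] [[mi ii] _]] := (F2h_reproduced alpha0 f).1 Ff.
  have [C C0 {}HC] := HC; have fin : (\int[mu]_w (weighted_sq alpha f w)%:E < +oo)%E.
    by apply: le_lt_trans (HC f Ff) _; rewrite (weighted_sq_area alpha0 Ff) -EFinM ltry.
  rewrite (weighted_sq_mu alpha0 mu Ff) in fin.
  have Ige0 (u : R * R -> R) : (0 <= \int[mu]_w (u w ^+ 2 * wgt w)%:E)%E.
    by apply: integral_ge0 => w _; rewrite lee_fin wsq_ge0.
  split; (split => //; apply: intble_ge0; [|by move=> w; apply: mulr_ge0; rewrite ?sqr_ge0 ?gauss_ge0|]).
  - exact: intble_meas ir.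
  - by apply: le_lt_trans fin; rewrite leeDl.
  - exact: intble_meas ii.
  - by apply: le_lt_trans fin; rewrite leeDr.
have igh z : mu.-integrable [set: plane R] (EFin \o (gauss (alpha / 2) z : plane R -> R)).
  apply: intble_ge0 => [|w|]; [|exact: gauss_ge0|by apply: le_lt_trans (HB z) _; rewrite ltry].
  by exact: measurable_gauss.
have KL z := mu_KC_L2 alpha0 (igh z).
have int f z : F2h alpha f -> integrableC mu (toeplitz_integrand alpha f z).
  move=> /muL[Lr Li]; apply/integrable_toeplitz.
  by split; apply: weighted_L2_prod.
have T f : F2h alpha f -> toeplitz alpha mu f = fun z => toep (Re f) z +i* toep (Im f) z.
  by move=> Ff; apply/funext => z; apply: toeplitzE; exact: int.
have toep_lin (a b : R) p q z : weighted_L2 alpha mu p -> weighted_L2 alpha mu q ->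
    toep (fun w => a * p w + b * q w) z = a * toep p z + b * toep q z.
  move=> Lp Lq; rewrite /toep mulrCA (mulrCA b) -mulrDr.
  rewrite -(RintZ a (weighted_L2_prod Lp (KL z))) -(RintZ b (weighted_L2_prod Lq (KL z))).
  rewrite -RintD; [|exact/intbleZ/weighted_L2_prod..].
  by congr (_ * _); apply: eq_Rintegral => w _; ring.
split=> [f Ff z|]; first exact: int.
split.
- move=> f Ff; have [Lr Li] := muL f Ff; rewrite T//; apply/(F2h_reproduced alpha0).
  by split; [exact: (toep_reproduced alpha0 sf HB Lr).1|exact: (toep_reproduced alpha0 sf HB Li).1].
- move=> a f g Ff Fg z.
  have [rf jf] := (F2h_reproduced alpha0 f).1 Ff; have [rg jg] := (F2h_reproduced alpha0 g).1 Fg.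
  have [Lrf Lif] := muL f Ff; have [Lrg Lig] := muL g Fg; case: a => a b.
  have ReE : Re (fun w => (a +i* b) * f w + g w) =
      (fun w => 1 * (a * Re f w + - b * Im f w) + 1 * Re g w).
    by apply/funext => w; case: (f w) (g w) => [x y] [x' y'] /=; ring.
  have ImE : Im (fun w => (a +i* b) * f w + g w) =
      (fun w => 1 * (b * Re f w + a * Im f w) + 1 * Im g w).
    by apply/funext => w; case: (f w) (g w) => [x y] [x' y'] /=; ring.
  rewrite !T//; last first.
    by apply/(F2h_reproduced alpha0); rewrite ReE ImE; split; do !apply: reproduced_lin.
  rewrite ReE ImE !toep_lin//; [|exact: weighted_L2_lin..].
  by apply/eqP; rewrite eq_complex /=; apply/andP; split; apply/eqP; ring.
- move=> f Bf; have [M HM] := F2h_bounded_fock_sq alpha0 Bf.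
  have FR n := (F2h_reproduced alpha0 (f n)).1 (Bf.1 n).
  have [phi [inc [g [h [rg rh cv]]]]] := Montel alpha0 (fun n => (FR n).1) (fun n => (HM n).1)
     (fun n => (FR n).2) (fun n => (HM n).2).
  exists phi; split=> //.
  pose G w := g w +i* h w; have FG : F2h alpha G by apply/(F2h_reproduced alpha0).
  have FTG : F2h alpha (toeplitz alpha mu G).
    have [Lr Li] := muL G FG; rewrite T//; apply/(F2h_reproduced alpha0).
    by split; [exact: (toep_reproduced alpha0 sf HB Lr).1|exact: (toep_reproduced alpha0 sf HB Li).1].
  exists (toeplitz alpha mu G); split=> //.
  pose d k w := f (phi k) w - G w.
  have dE k : Re (d k) = (fun w => Re (f (phi k)) w - g w) /\ Im (d k) = (fun w => Im (f (phi k)) w - h w).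
    by split; apply/funext => w; rewrite /d /=; case: (f _ w).
  have Fd k : F2h alpha (d k).
    apply/(F2h_reproduced alpha0); have [-> ->] := dE k.
    by split; apply: reproducedB => //; apply FR.
  have Bd : F2h_bounded alpha d.
    split=> //; exists (Num.sqrt (alpha / pi * (4 * M + 2 * fock_sq g + 2 * fock_sq h))) => k.
    rewrite (F2h_normE alpha0 (Fd k)) lee_fin ler_sqrt; last first.
      rewrite mulr_ge0 ?divr_ge0 ?pi_ge0 ?(ltW alpha0)// !addr_ge0 ?mulr_ge0 ?fock_sq_ge0//.
      by apply: le_trans (HM 0%N).1; exact: fock_sq_ge0.
    apply: ler_wpM2l; first by rewrite divr_ge0 ?pi_ge0// ltW.
    have [-> ->] := dE k; have [m1 m2] := HM (phi k).
    have := fock_sqB_le (FR (phi k)).1.1 rg.1; have := fock_sqB_le (FR (phi k)).2.1 rh.1.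
    lra.
  have d0 : cvg0_on_compacts d.
    move=> A cA e e0; have [r Hr] := compact_in_square cA.
    have e20 : 0 < e / 2 by rewrite divr_gt0.
    apply: filterS (cv r _ e20) => k Hk w Aw; have [w1 w2] := Hr w Aw.
    have [h1 h2] := Hk w w1 w2; apply: le_lt_trans (normc_le _) _.
    have [E1 E2] := dE k; have {}E1 := congr1 (@^~ w) E1; have {}E2 := congr1 (@^~ w) E2.
    by rewrite /= in E1 E2; rewrite E1 E2; lra.
  have cd := Hv d Bd d0.
  have TdE k : (fun w => toeplitz alpha mu (f (phi k)) w - toeplitz alpha mu G w) =
      fun w => toep (Re (d k)) w +i* toep (Im (d k)) w.
    apply/funext => w; have [Lr Li] := muL _ (Bf.1 (phi k)); have [Lg Lh] := muL G FG.
    rewrite (T _ (Bf.1 (phi k))) (T _ FG); have [-> ->] := dE k.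
    have E p q : weighted_L2 alpha mu p -> weighted_L2 alpha mu q ->
        toep (fun w => p w - q w) w = toep p w - toep q w.
      move=> Lp Lq; rewrite -[X in X - _]mul1r -mulN1r -toep_lin//; congr (toep _ w).
      by apply/funext => x; rewrite mul1r mulN1r.
    by rewrite !E.
  have FT k : F2h alpha (fun w => toeplitz alpha mu (f (phi k)) w - toeplitz alpha mu G w).
    have [Lr Li] := muL _ (Fd k); rewrite TdE; apply/(F2h_reproduced alpha0).
    by split; [exact: (toep_reproduced alpha0 sf HB Lr).1|exact: (toep_reproduced alpha0 sf HB Li).1].
  apply/(F2h_norm_cvg0 alpha0 FT).
  have {}cd : fine (\int[mu]_w (weighted_sq alpha (d k) w)%:E) @[k --> \oo] --> (0 : R).
    exact: (@fine_cvg _ _ \oo _ _ _ cd).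
  have {}cd := seq_cvgZ (c := 8 * pi * B' / alpha) cd.
  rewrite mulr0 in cd; apply: seq_cvg0_le cd => k; apply/andP; split.
    by apply: addr_ge0; exact: fock_sq_ge0.
  have [Lr Li] := muL _ (Fd k); rewrite (weighted_sq_mu alpha0 mu (Fd k)).
  rewrite (EFin_Rint Lr.2) (EFin_Rint Li.2) -EFinD [fine _]/=.
  have -> : Re (fun w => toeplitz alpha mu (f (phi k)) w - toeplitz alpha mu G w) = toep (Re (d k)).
    by apply/funext => w; rewrite (congr1 (@^~ w) (TdE k)).
  have -> : Im (fun w => toeplitz alpha mu (f (phi k)) w - toeplitz alpha mu G w) = toep (Im (d k)).
    by apply/funext => w; rewrite (congr1 (@^~ w) (TdE k)).
  rewrite mulrDr.
  by apply: lerD; [exact: (toep_reproduced alpha0 sf HB Lr).2|exact: (toep_reproduced alpha0 sf HB Li).2].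
Qed.

End Equivalence.

Theorem theorem3p2 (R : realType) (alpha : R) (halpha : 0 < alpha)
    (mu : {measure set (plane R) -> \bar R}) :
  (toeplitz_compact alpha mu <-> berezin_vanishes alpha mu) /\
  (berezin_vanishes alpha mu <-> vanishing_fock_carleson alpha mu).
Proof.
have ab : toeplitz_compact alpha mu -> berezin_vanishes alpha mu.
  by move=> Tc; apply/berezin_vanishesE; exact: compact_to_0.
have bc : berezin_vanishes alpha mu -> vanishing_fock_carleson alpha mu.
  by move=> /berezin_vanishesE; exact: berezin_to_carleson.
have ca := @carleson_to_compact R alpha halpha mu.
by split; split=> // h; [exact/ca/bc|exact/ab/ca].
Qed.
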